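(* Let $n\ge 3$ and $m\ge 1$ be integers, let $\mathcal{M}$ be a generic collection of $m$ lines in $\mathbb{P}^n$, let $S=\mathbb{C}[x_0,\ldots,x_n]$, and let $R$ be the coordinate ring of $\mathcal{M}$. Then $\mathrm{reg}_S(R)=\alpha$, where $\alpha$ is the smallest non-negative integer satisfying $\binom{n+\alpha}{\alpha}\ge m(\alpha+1)$.
   Context: Let $\mathbb{P}^n$ be projective $n$-space over $\mathbb{C}$ with homogeneous coordinate ring $S=\mathbb{C}[x_0,\ldots,x_n]$ (standard grading). The defining ideal of a line in $\mathbb{P}^n$ is the ideal of $S$ of all forms vanishing on it; it is minimally generated by $n-1$ linear forms. For a collection $\mathcal{M}=\{\mathcal{L}_1,\ldots,\mathcal{L}_m\}$ of lines with defining ideals $L_1,\ldots,L_m$, the defining ideal of $\mathcal{M}$ is $J=\bigcap_{i=1}^m L_i$ and the coordinate ring of $\mathcal{M}$ is $R=S/J$. The collection $\mathcal{M}$ is a generic collection if the lines are defined by linear forms ($n-1$ linear forms generating each $L_i$) whose coefficients, all taken together, are algebraically independent over $\mathbb{Q}$. For a finitely generated graded $S$-module $M$, $\mathrm{reg}_S(M)=\sup\{\,j-i : \mathrm{Tor}_i^S(M,\mathbb{C})_j\neq 0\,\}$ (Castelnuovo-Mumford regularity). *)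

(* Defs.v *)
From HB Require Import structures.
From mathcomp Require Import all_boot all_order all_algebra.
From mathcomp Require Import boolp reals.
From mathcomp Require Import complex.
From mathcomp Require Import mpoly.

Set Implicit Arguments.
Unset Strict Implicit.
Unset Printing Implicit Defensive.

Import GRing.Theory Quotient.
Local Open Scope ring_scope.
Local Open Scope quotient_scope.

Section Ideals.
Variables (K : fieldType) (N : nat).
Local Notation S := {mpoly K[N]}.

(* S_d for an integer d, so that S_d = 0 when d < 0. *)
Definition homogz (d : int) (f : S) : Prop :=
  match d with
  | Posz k => f \is k.-homog
  | Negz _ => f = 0
  end.

Definition in_span (G : S -> Prop) (f : S) : Prop :=
  exists (k : nat) (c g : 'I_k -> S),
    (forall i, G (g i)) /\ f = \sum_i c i * g i.

Record homog_ideal := HomogIdeal {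
  ideal_carrier :> S -> Prop;
  ideal0 : ideal_carrier 0;
  idealD : forall f g, ideal_carrier f -> ideal_carrier g ->
    ideal_carrier (f + g);
  idealM : forall c f, ideal_carrier f -> ideal_carrier (c * f);
  ideal_pihomog : forall d f, ideal_carrier f ->
    ideal_carrier (pihomog mdeg d f)
}.

Lemma in_span0 G : in_span G 0.
Proof.
exists 0%N, (fun _ => 0), (fun _ => 0); split; first by case.
by rewrite big_ord0.
Qed.

Lemma in_spanD G f g : in_span G f -> in_span G g -> in_span G (f + g).
Proof.
move=> [k1 [c1 [g1 [G1 ->]]]] [k2 [c2 [g2 [G2 ->]]]].
exists (k1 + k2)%N,
  (fun i => match split i with inl a => c1 a | inr b => c2 b end),
  (fun i => match split i with inl a => g1 a | inr b => g2 b end); split.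
  by move=> i; case: (split i).
rewrite big_split_ord /=; congr (_ + _); apply: eq_bigr => i _.
  by rewrite -[lshift _ i]/(unsplit (inl i)) unsplitK.
by rewrite -[rshift _ i]/(unsplit (inr i)) unsplitK.
Qed.

Lemma in_spanM G c f : in_span G f -> in_span G (c * f).
Proof.
move=> [k [d [g [Gg ->]]]]; exists k, (fun i => c * d i), g; split=> //.
by rewrite mulr_sumr; apply: eq_bigr => i _; rewrite mulrA.
Qed.

Lemma in_span_sum G (I : Type) (r : seq I) (F : I -> S) :
  (forall i, in_span G (F i)) -> in_span G (\sum_(i <- r) F i).
Proof.
by move=> h; elim/big_ind: _ => //; [exact: in_span0|exact: in_spanD].
Qed.

Lemma in_span_pihomog (G : S -> Prop) d f :
    (forall g, G g -> exists e, g \is e.-homog) ->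
  in_span G f -> in_span G (pihomog mdeg d f).
Proof.
move=> hG [k [c [g [Gg ->]]]]; rewrite raddf_sum; apply: in_span_sum => i.
have [e he] := hG _ (Gg i).
rewrite (pihomog_partitionE (leqnn (mmeasure mdeg (c i)))) mulr_suml raddf_sum.
apply: in_span_sum => j.
have hh : pihomog mdeg j (c i) * g i \is (j + e).-homog.
  by apply: dhomogM => //; exact: pihomogP.
have [<-|ne] := eqVneq (j + e)%N d.
  rewrite /= (pihomog_dE hh); apply: in_spanM.
  exists 1%N, (fun _ => 1), (fun _ => g i); split=> //.
  by rewrite big_ord1 mul1r.
by rewrite /= (pihomog_ne0 ne hh); exact: in_span0.
Qed.

Section Quotient.
Variable I : homog_ideal.

Definition ideal_pred : pred S := fun f => `[< I f >].

Lemma ideal_zmod_closed : zmod_closed ideal_pred.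
Proof.
split=> [|f g]; first by apply/asboolP; exact: ideal0.
move=> /asboolP If /asboolP Ig; apply/asboolP.
by apply: idealD => //; rewrite -mulN1r; exact: idealM.
Qed.

HB.instance Definition _ :=
  GRing.isZmodClosed.Build S ideal_pred ideal_zmod_closed.
Definition ideal_zmod : zmodClosed S := GRing.ZmodClosed.clone S ideal_pred _.

(* S / I as an S-module. *)
Definition quotmod := {quot ideal_zmod}.
HB.instance Definition _ := GRing.Zmodule.on quotmod.

Definition quotmod_pi (f : S) : quotmod := \pi_({quot ideal_zmod}) f.

Lemma quotmod_piP f g : quotmod_pi f = quotmod_pi g <-> I (f - g).
Proof.
rewrite /quotmod_pi; split=> [/eqP|h].
  by rewrite (eqquotE {quot ideal_zmod}) => /asboolP.
by apply/eqP; rewrite (eqquotE {quot ideal_zmod}); apply/asboolP.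
Qed.

Lemma quotmod_piD f g : quotmod_pi (f + g) = quotmod_pi f + quotmod_pi g.
Proof. exact: (raddfD (\pi_({quot ideal_zmod}))). Qed.

Lemma quotmod_pi0 : quotmod_pi 0 = 0.
Proof. exact: (raddf0 (\pi_({quot ideal_zmod}))). Qed.

Lemma quotmod_pi_surj u : exists f, u = quotmod_pi f.
Proof. by exists (repr (u : {quot ideal_zmod})); rewrite /quotmod_pi reprK. Qed.

Definition quotmod_scale (f : S) (u : quotmod) : quotmod :=
  quotmod_pi (f * repr (u : {quot ideal_zmod})).

Lemma quotmod_scaleE f g : quotmod_scale f (quotmod_pi g) = quotmod_pi (f * g).
Proof.
apply/quotmod_piP; rewrite -mulrBr; apply: idealM.
by apply/quotmod_piP; rewrite /quotmod_pi reprK.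
Qed.

Fact quotmod_scaleA f g u :
  quotmod_scale f (quotmod_scale g u) = quotmod_scale (f * g) u.
Proof. by have [h ->] := quotmod_pi_surj u; rewrite !quotmod_scaleE mulrA. Qed.

Fact quotmod_scale1 : left_id 1 quotmod_scale.
Proof. by move=> u; have [h ->] := quotmod_pi_surj u; rewrite quotmod_scaleE mul1r. Qed.

Fact quotmod_scaleDr : right_distributive quotmod_scale +%R.
Proof.
move=> f u v; have [g ->] := quotmod_pi_surj u; have [h ->] := quotmod_pi_surj v.
by rewrite -quotmod_piD !quotmod_scaleE mulrDr quotmod_piD.
Qed.

Fact quotmod_scaleDl u : {morph quotmod_scale^~ u : f g / f + g}.
Proof.
move=> f g; have [h ->] := quotmod_pi_surj u.
by rewrite !quotmod_scaleE mulrDl quotmod_piD.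
Qed.

HB.instance Definition _ := GRing.Zmodule_isLmodule.Build S quotmod
  quotmod_scaleA quotmod_scale1 quotmod_scaleDr quotmod_scaleDl.

End Quotient.

Record gradedModule := GradedModule {
  gm_sort :> lmodType S;
  gm_comp : int -> gm_sort -> Prop;
  gm_comp0 : forall d, gm_comp d 0;
  gm_compD : forall d u v, gm_comp d u -> gm_comp d v -> gm_comp d (u + v);
  gm_compZ : forall (e : nat) d f u, f \is e.-homog -> gm_comp d u ->
    gm_comp (e%:Z + d) (f *: u);
  gm_span : forall u, exists (s : seq int) (c : int -> gm_sort),
    (forall d, gm_comp d (c d)) /\ u = \sum_(d <- s) c d;
  gm_direct : forall (s : seq int) (c : int -> gm_sort), uniq s ->
    (forall d, gm_comp d (c d)) -> \sum_(d <- s) c d = 0 ->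
    forall d, d \in s -> c d = 0
}.

Section QuotientGrading.
Variable I : homog_ideal.

Definition quot_comp (d : int) (u : quotmod I) : Prop :=
  exists f : S, homogz d f /\ u = quotmod_pi I f.

Lemma homogz0 d : homogz d 0.
Proof. by case: d => // k; exact: dhomog0. Qed.

Lemma quot_comp0 d : quot_comp d 0.
Proof. by exists 0; split; [exact: homogz0|rewrite quotmod_pi0]. Qed.

Lemma quot_compD d u v : quot_comp d u -> quot_comp d v -> quot_comp d (u + v).
Proof.
move=> [f [hf ->]] [g [hg ->]]; exists (f + g); rewrite quotmod_piD; split=> //.
by case: d hf hg => k /=; [exact: dhomogD|move=> -> ->; rewrite addr0].
Qed.

Lemma quot_compZ (e : nat) d f u :
  f \is e.-homog -> quot_comp d u -> quot_comp (e%:Z + d) (f *: u).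
Proof.
move=> hf [g [hg ->]]; exists (f * g); split; last exact: quotmod_scaleE.
case: d hg => k /= hg; first exact: dhomogM.
by rewrite hg mulr0; exact: homogz0.
Qed.

Lemma quotmod_pi_sum (J : Type) (r : seq J) (F : J -> S) :
  quotmod_pi I (\sum_(i <- r) F i) = \sum_(i <- r) quotmod_pi I (F i).
Proof. by apply: big_morph; [exact: quotmod_piD|exact: quotmod_pi0]. Qed.

Lemma quot_span u : exists (s : seq int) (c : int -> quotmod I),
  (forall d, quot_comp d (c d)) /\ u = \sum_(d <- s) c d.
Proof.
have [f ->] := quotmod_pi_surj u.
exists [seq k%:Z | k <- index_iota 0 (mmeasure mdeg f)],
  (fun d => if d is Posz k then quotmod_pi I (pihomog mdeg k f) else 0); split.
  case=> k; last exact: quot_comp0.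
  by exists (pihomog mdeg k f); split=> //; exact: pihomogP.
rewrite big_map big_mkord -quotmod_pi_sum; congr quotmod_pi.
exact: pihomog_partitionE.
Qed.

Lemma quot_direct (s : seq int) (c : int -> quotmod I) : uniq s ->
  (forall d, quot_comp d (c d)) -> \sum_(d <- s) c d = 0 ->
  forall d, d \in s -> c d = 0.
Proof.
move=> us /boolp.choice [F hF] s0 d ds; have [hd ->] := hF d.
case: d ds hd => k ks /= hk; last by rewrite hk quotmod_pi0.
rewrite -quotmod_pi0; apply/quotmod_piP; rewrite subr0.
suff -> : F k = pihomog mdeg k (\sum_(e <- s) F e).
  apply: ideal_pihomog; rewrite -[X in ideal_carrier _ X]subr0.
  apply/quotmod_piP; rewrite quotmod_pi0 quotmod_pi_sum -[RHS]s0.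
  by apply: eq_bigr => e _; rewrite -(hF e).2.
rewrite raddf_sum (bigD1_seq (Posz k)) //= (pihomog_dE hk) big1 ?addr0 // => e ne.
have := (hF e).1; case: e ne => j /= ne; last by move=> ->; rewrite raddf0.
by apply: pihomog_ne0.
Qed.

Definition quotient_module : gradedModule :=
  @GradedModule (quotmod I) quot_comp quot_comp0 quot_compD quot_compZ
    quot_span quot_direct.

End QuotientGrading.

(* A graded resolution of M by free modules of finite rank. The i-th module
   F_i is the direct sum of the S(- res_deg i k), k < res_rank i; its elements
   are row vectors, and F_(i+1) -> F_i is v |-> v *m res_diff i. The
   augmentation F_0 -> M sends the k-th basis vector to res_aug k. *)
Record free_resolution (M : gradedModule) := FreeResolution {
  res_rank : nat -> nat;
  res_deg : forall i, 'I_(res_rank i) -> int;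
  res_diff : forall i, 'M[S]_(res_rank i.+1, res_rank i);
  res_aug : 'I_(res_rank 0) -> M;
  res_diff_homog : forall i k l,
    homogz (res_deg k - res_deg l) (res_diff i k l);
  res_aug_homog : forall k, gm_comp (res_deg k) (res_aug k);
  res_aug_surj : forall u : M, exists v : 'rV[S]_(res_rank 0),
    u = \sum_k v 0 k *: res_aug k;
  res_exact0 : forall v : 'rV[S]_(res_rank 0),
    \sum_k v 0 k *: res_aug k = 0 <-> exists w, v = w *m res_diff 0;
  res_exact : forall i (v : 'rV[S]_(res_rank i.+1)),
    v *m res_diff i = 0 <-> exists w, v = w *m res_diff i.+1
}.

Section Tor.
Variables (M : gradedModule) (F : free_resolution M).

(* K = S / (x_0, ..., x_(N-1)), so F_i tensor K is K^(res_rank i), and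
   tensoring the differential with K keeps the constant coefficients. *)
Definition tor_diff i : 'M[K]_(res_rank F i.+1, res_rank F i) :=
  map_mx (fun f : S => f@_0%MM) (res_diff F i).

Definition tor_deg i (j : int) (v : 'rV[K]_(res_rank F i)) : Prop :=
  forall k, v 0 k != 0 -> res_deg k = j.

Definition tor_cycle i : 'rV[K]_(res_rank F i) -> Prop :=
  match i with
  | 0 => fun _ => True
  | i'.+1 => fun v => v *m tor_diff i' = 0
  end.

Definition tor_boundary i (j : int) (v : 'rV[K]_(res_rank F i)) : Prop :=
  exists w, tor_deg j w /\ v = w *m tor_diff i.

End Tor.

(* Tor_i^S(M, K)_j <> 0. The homology does not depend on the resolution, so
   quantifying F existentially or universally makes no difference as soon as
   M is finitely generated. *)
Definition Tor_neq0 (M : gradedModule) (i : nat) (j : int) : Prop :=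
  exists (F : free_resolution M) (v : 'rV[K]_(res_rank F i)),
    [/\ tor_deg j v, tor_cycle v & ~ tor_boundary j v].

(* r = sup {j - i : Tor_i^S(M, K)_j <> 0}, as a least upper bound in the
   integers. No integer satisfies this when the set is empty or unbounded. *)
Definition is_regularity (M : gradedModule) (r : int) : Prop :=
  (forall i j, Tor_neq0 M i j -> j - i%:Z <= r) /\
  (forall b : int, (forall i j, Tor_neq0 M i j -> j - i%:Z <= b) -> r <= b).

End Ideals.

Section Lines.
Variables (R : realType) (n : nat).
Local Notation C := R[i].
Local Notation S := {mpoly C[n.+1]}.

(* Points of P^n are given by their nonzero vectors of homogeneous coordinates,
   and a subset of P^n by the set of all the vectors representing its points. *)
Definition is_line (X : 'rV[C]_n.+1 -> Prop) : Prop :=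
  exists A : 'M[C]_(2, n.+1),
    \rank A = 2%N /\ forall v, X v <-> v != 0 /\ (v <= A)%MS.

Definition vanishing_form (X : 'rV[C]_n.+1 -> Prop) (f : S) : Prop :=
  (exists d, f \is d.-homog) /\ forall v, X v -> f.@[v 0] = 0.

Definition vanishing_ideal (X : 'rV[C]_n.+1 -> Prop) : S -> Prop :=
  in_span (vanishing_form X).

Definition linear_form (a : 'rV[C]_n.+1) : S := \sum_k a 0 k *: 'X_k.

Definition alg_indep_rat (I : finType) (a : I -> C) : Prop :=
  forall p : {mpoly rat[#|I|]},
    mmap ratr (fun k => a (enum_val k)) p = 0 -> p = 0.

(* Row k of a i holds the coefficients of the k-th linear form of the i-th
   line. *)
Definition generic_collection (m : nat) (X : 'I_m -> 'rV[C]_n.+1 -> Prop) :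
    Prop :=
  exists a : 'I_m -> 'M[C]_(n.-1, n.+1),
    alg_indep_rat (fun t : 'I_m * 'I_n.-1 * 'I_n.+1 => a t.1.1 t.1.2 t.2) /\
    forall i f, vanishing_ideal (X i) f <->
      in_span (fun g => exists k, g = linear_form (row k (a i))) f.

Section CoordinateRing.
Variables (m : nat) (X : 'I_m -> 'rV[C]_n.+1 -> Prop).

Definition collection_ideal_carrier (f : S) : Prop :=
  forall i, vanishing_ideal (X i) f.

Fact collection_ideal0 : collection_ideal_carrier 0.
Proof. by move=> i; exact: in_span0. Qed.

Fact collection_idealD f g : collection_ideal_carrier f ->
  collection_ideal_carrier g -> collection_ideal_carrier (f + g).
Proof. by move=> hf hg i; exact: (in_spanD (hf i) (hg i)). Qed.

Fact collection_idealM c f :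
  collection_ideal_carrier f -> collection_ideal_carrier (c * f).
Proof. by move=> hf i; exact: (in_spanM _ (hf i)). Qed.

Fact collection_ideal_pihomog d f : collection_ideal_carrier f ->
  collection_ideal_carrier (pihomog mdeg d f).
Proof. by move=> hf i; apply: in_span_pihomog (hf i) => g []. Qed.

Definition collection_ideal : homog_ideal C n.+1 :=
  HomogIdeal collection_ideal0 collection_idealD collection_idealM
    collection_ideal_pihomog.

(* Only the graded S-module structure of S / J matters for the regularity. *)
Definition coordinate_ring : gradedModule C n.+1 :=
  quotient_module collection_ideal.

End CoordinateRing.
End Lines.

(* Main.v *)
Require Import Defs.
From HB Require Import structures.
From mathcomp Require Import all_boot all_order all_algebra.
From mathcomp Require Import boolp reals complex mpoly.
From mathcomp Require Import zify ring lra.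

Set Implicit Arguments.
Unset Strict Implicit.
Unset Printing Implicit Defensive.

Import Order.TTheory GRing.Theory Num.Theory.
Local Open Scope ring_scope.

(* Let E be the product of the coordinate rings of the lines, so that R embeds
   in E and E_d has dimension m (d + 1).  The main point is the theorem of
   Hartshorne and Hirschowitz that R_d = E_d as soon as
   m (d + 1) <= 'C(n + d, d).  It suffices to exhibit one collection of lines
   over a field of characteristic 0, since the condition is the nonvanishing of a
   determinant with rational coefficients.  In P^3 lines are specialized to the
   rulings of a quadric, and for n >= 4 to pairs of lines of a hyperplane that
   meet; pulling such lines apart leaves, in the limit, a condition at their
   intersection point on the residual form.

   Given this, E / R lives exactly in the degrees below alpha.  The Koszul
   homology of E vanishes in positive degrees, so that of R vanishes in degrees
   above alpha, while an element of E of degree alpha - 1 outside R yields a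
   nonzero class of R in degree alpha.  Koszul homology is compared with
   Tor by shifting along the syzygies of an arbitrary free resolution, and a free
   resolution exists because the vanishing of Koszul homology bounds the
   degrees of the generators of each syzygy module. *)

(** * Linear conditions on forms *)

(** A form f = H g + h has a trace on the hypersurface H = 0 and a residual form g, and the lines
    have to be placed so that both interpolation problems are solvable. When there are as many
    conditions as unknowns there is no slack: both problems must be filled exactly. The obstacle is
    arithmetic. The number of forms need not be a multiple of d + 1, and a remainder in the residual
    problem can only be filled by single points; the degenerations that leave a point on the
    residual form exist to supply them. In P^3 a plane is a poor choice of H, since any two of its
    lines meet, while a quadric carries families of disjoint lines. Degrees congruent to 1 modulo 3
    have no remainder there but reduce to degrees that have one, and degree 4 is too small for the
    construction that repairs this. General position is treated without topology: a condition that
    holds at one point must persist, on every line of parameters through it, outside finitely many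
    values. This is enough to combine conditions known at unrelated special positions. *)

Section Solvability.
Variables (K : fieldType) (V : lmodType K).
Implicit Types (P : V -> Prop).

Definition subspace P := P 0 /\ forall a f g, P f -> P g -> P (a *: f + g).

Definition solvable_on (I : Type) P (phi : I -> V -> K) :=
  forall c : I -> K, exists f, P f /\ forall i, phi i f = c i.

Definition free_in (D : finType) P := exists b : D -> V,
  (forall i, P (b i)) /\
  forall c : D -> K, \sum_i c i *: b i = 0 -> forall i, c i = 0.

Definition spanned_by (D : finType) P := exists b : D -> V,
  forall f, P f -> exists c : D -> K, f = \sum_i c i *: b i.

Lemma subspaceD P f g : subspace P -> P f -> P g -> P (f + g).
Proof. by move=> [_ h] pf pg; have := h 1 f g pf pg; rewrite scale1r. Qed.

Lemma subspaceZ P a f : subspace P -> P f -> P (a *: f).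
Proof. by move=> [h0 h] pf; rewrite -[_ *: _]addr0; apply: h. Qed.

Lemma subspace_sum P (I : finType) (F : I -> V) :
  subspace P -> (forall i, P (F i)) -> P (\sum_i F i).
Proof.
move=> sP PF; elim/big_ind: _ => //; first by case: sP.
by move=> x y; exact: subspaceD.
Qed.

Lemma scalar_at0 (phi : V -> K) : scalar phi -> phi 0 = 0.
Proof.
move=> h; have := h 1 0 0; rewrite scale1r addr0 mul1r => /eqP.
by rewrite -subr_eq0 opprD addNKr oppr_eq0 => /eqP.
Qed.

Lemma scalar_sum (I : finType) (phi : V -> K) (c : I -> K) (b : I -> V) :
  scalar phi -> phi (\sum_i c i *: b i) = \sum_i c i * phi (b i).
Proof.
move=> h; apply: (big_rec2 (fun x y => phi x = y)); first exact: scalar_at0.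
move=> i y x _ <-.
exact: h.
Qed.

(** The matrix has more rows than columns, so its left kernel is nonzero. *)
Lemma linear_relation (I D : finType) (A : I -> D -> K) : (#|D| < #|I|)%N ->
  exists y : I -> K, (exists i, y i != 0) /\ forall d, \sum_i y i * A i d = 0.
Proof.
move=> lt; pose M := \matrix_(i < #|I|, j < #|D|) A (enum_val i) (enum_val j).
have : kermx M != 0.
  apply/eqP => k0; have := mxrank_ker M; rewrite k0 mxrank0 => /esym/eqP.
  rewrite subn_eq0 => h; have := leq_trans h (rank_leq_col M).
  by rewrite leqNgt lt.
case/rowV0Pn => y /sub_kermxP yM y0.
have [j yj] : exists j, y 0 j != 0.
  apply: contrapT => /forallNP h; move/eqP: y0; apply; apply/rowP => j.
  by rewrite mxE; apply/eqP; apply: contra_notT (h j).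
exists (fun i => y 0 (enum_rank i)); split; first by exists (enum_val j); rewrite enum_valK.
move=> d; have := congr1 (fun B : 'rV_#|D| => B 0 (enum_rank d)) yM.
rewrite !mxE => e; rewrite -[RHS]e (reindex (@enum_val I I)) /=; last first.
  by apply: onW_bij; exact: enum_val_bij.
by apply: eq_bigr => i _; rewrite enum_valK mxE enum_rankK.
Qed.

Lemma exists_common_zero (I D : finType) P (phi : I -> V -> K) :
  subspace P -> (forall i, scalar (phi i)) -> free_in D P -> (#|I| < #|D|)%N ->
  exists f, [/\ P f, f != 0 & forall i, phi i f = 0].
Proof.
move=> sP sphi [b [Pb fb]] lt.
have [y [[i0 yi0] hy]] := linear_relation (fun d i => phi i (b d)) lt.
exists (\sum_i y i *: b i); split.
- by apply: subspace_sum => // i; exact: subspaceZ.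
- by apply/eqP => /fb/(_ i0)/eqP; exact/negP.
- by move=> i; rewrite scalar_sum.
Qed.

(** The old conditions do not see [f0], so a multiple of it adjusts the new one without disturbing
    them. *)
Lemma solvable_extend (I : Type) P (phi : I -> V -> K) (psi : V -> K) f0 :
  subspace P -> (forall i, scalar (phi i)) -> scalar psi ->
  P f0 -> (forall i, phi i f0 = 0) -> psi f0 != 0 -> solvable_on P phi ->
  solvable_on P (fun (o : option I) f => if o is Some i then phi i f else psi f).
Proof.
move=> sP sphi spsi P0 z0 n0 s c; have [f [Pf hf]] := s (c \o Some).
exists ((c None - psi f) / psi f0 *: f0 + f); split; first by case: sP => _; apply.
by case=> [i|]; rewrite ?sphi ?spsi /= ?z0 ?mulr0 ?add0r ?hf // divfK // subrK.
Qed.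

Lemma solvable_reindex (I J : Type) P (phi : I -> V -> K) (psi : J -> V -> K)
    (h : J -> I) (h' : I -> J) :
  cancel h h' -> (forall j f, P f -> psi j f = phi (h j) f) ->
  solvable_on P phi -> solvable_on P psi.
Proof.
move=> hK e s c; have [f [Pf hf]] := s (c \o h'); exists f; split=> // j.
by rewrite e // hf /= hK.
Qed.

(* A general point adds one to the rank as long as a nonzero solution of the
   homogeneous system remains. *)
Lemma solvable_points (I D : finType) (Y : Type) P (phi : I -> V -> K)
    (ev : Y -> V -> K) k :
  subspace P -> (forall i, scalar (phi i)) -> (forall y, scalar (ev y)) ->
  (forall f, P f -> (forall i, phi i f = 0) -> f != 0 -> exists y, ev y f != 0) ->
  free_in D P -> (#|I| + k <= #|D|)%N -> solvable_on P phi ->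
  exists y : 'I_k -> Y, solvable_on P
    (fun s f => match s with inl i => phi i f | inr j => ev (y j) f end).
Proof.
move=> sP sphi sev hev fD; elim: k => [|k IH] le s.
  have y : 'I_0 -> Y by case.
  exists y => c; have [f [Pf hf]] := s (c \o inl); exists f; split=> //.
  by case=> [i|[]//]; rewrite hf.
have [y sy] := IH (leq_trans (leq_add (leqnn _) (leqnSn _)) le) s.
pose psi := fun (s : I + 'I_k) f =>
  match s with inl i => phi i f | inr j => ev (y j) f end.
have spsi i : scalar (psi i) by case: i => i; [exact: sphi|exact: sev].
have lt : (#|{: I + 'I_k}| < #|D|)%N by rewrite card_sum card_ord -addnS.
have [f0 [P0 n0 z0]] := exists_common_zero sP spsi fD lt.
have [y0 hy0] := hev _ P0 (fun i => z0 (inl i)) n0.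
exists (fun j => if unlift ord_max j is Some j' then y j' else y0).
have := solvable_extend sP spsi (sev y0) P0 z0 hy0 sy.
apply: (@solvable_reindex _ _ _ _ _
  (fun s : I + 'I_k.+1 => match s with
    | inl i => Some (inl i)
    | inr j => if unlift ord_max j is Some j' then Some (inr j') else None end)
  (fun o => match o with
    | Some (inl i) => inl i
    | Some (inr j) => inr (lift ord_max j)
    | None => inr ord_max end)).
  by case=> // j; case: unliftP => [j' ->|->].
by case=> // j f _; case: unliftP => [j' _|_].
Qed.

(** A nonzero [f] together with the solutions [e i] of the unit systems would be one vector too many
    for a space spanned by |D| vectors. In a linear relation among them [phi i] reads off the
    coefficient of [e i], so all of these vanish, and then so does that of [f]. *)
Lemma solvable_inj (I D : finType) P (phi : I -> V -> K) f :
  (forall i, scalar (phi i)) -> spanned_by D P -> (#|D| <= #|I|)%N ->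
  solvable_on P phi -> P f -> (forall i, phi i f = 0) -> f = 0.
Proof.
move=> sphi [b hb] le s Pf zf; apply: contrapT => /eqP fn0.
have [e he] := boolp.choice (fun i => s (fun j => (i == j)%:R)).
pose e' (o : option I) := if o is Some i then e i else f.
have Pe' o : P (e' o) by case: o => [i|] //=; case: (he i).
have [a ha] := boolp.choice (fun o => hb _ (Pe' o)).
have lt : (#|D| < #|{: option I}|)%N by rewrite card_option.
have [y [[o yo] hy]] := linear_relation a lt.
have rel : \sum_o y o *: e' o = 0.
  under eq_bigr => o' _ do rewrite ha scaler_sumr.
  rewrite exchange_big big1 // => d _.
  under eq_bigr => o' _ do rewrite scalerA.
  by rewrite -scaler_suml hy scale0r.
have yS i : y (Some i) = 0.
  have := congr1 (phi i) rel; rewrite scalar_sum // scalar_at0 //.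
  rewrite (bigD1 (Some i)) //= (he i).2 eqxx mulr1 big1 ?addr0 // => -[j|] /=.
    by move=> ne; rewrite (he j).2; have [e0|_] := eqVneq j i; [rewrite e0 eqxx in ne|rewrite mulr0].
  by rewrite zf mulr0.
case: o yo => [i|]; first by rewrite yS eqxx.
move: rel; rewrite (bigD1 None) //= big1 ?addr0.
  by move/eqP; rewrite scaler_eq0 (negPf fn0) orbF => /eqP ->; rewrite eqxx.
by case=> [i|] // _; rewrite yS scale0r.
Qed.

Lemma solvable_of_det (I : finType) P (phi : I -> V -> K) (b : I -> V) :
  subspace P -> (forall i, scalar (phi i)) -> (forall i, P (b i)) ->
  \det (\matrix_(i, j < #|I|) phi (enum_val j) (b (enum_val i))) != 0 ->
  solvable_on P phi.
Proof.
move=> sP sphi Pb; set M := \matrix_(i, j) _ => dM c.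
pose x := (\row_j c (enum_val j)) *m invmx M.
exists (\sum_i x 0 (enum_rank i) *: b i); split.
  by apply: subspace_sum => // i; exact: subspaceZ.
move=> i; rewrite scalar_sum // (reindex (@enum_val I I)) /=; last first.
  by apply: onW_bij; exact: enum_val_bij.
have : (x *m M) 0 (enum_rank i) = c i.
  by rewrite mulmxKV ?unitmxE ?unitfE // mxE enum_rankK.
rewrite mxE => <-; apply: eq_bigr => j _.
by rewrite enum_valK !mxE enum_rankK.
Qed.

(** The solutions of the unit systems at [s0] give a square matrix of polynomials that specializes
    to the identity at [s0]; [q] is its determinant. *)
Lemma solvable_poly_open (I : finType) P (Phi : I -> V -> {poly K}) s0 :
  subspace P -> (forall i, linear (Phi i)) ->
  solvable_on P (fun i f => (Phi i f).[s0]) ->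
  exists q : {poly K}, q != 0 /\ forall s, q.[s] != 0 ->
    solvable_on P (fun i f => (Phi i f).[s]).
Proof.
move=> sP lPhi h.
have [b hb] := boolp.choice (fun i => h (fun j => (i == j)%:R)).
pose M := \matrix_(i, j < #|I|) Phi (enum_val j) (b (enum_val i)).
have detM s : (\det M).[s] = \det (map_mx (horner_eval s) M).
  by rewrite det_map_mx.
exists (\det M); split.
  apply/eqP => d0; have := detM s0; rewrite d0 horner0.
  have -> : map_mx (horner_eval s0) M = 1%:M.
    apply/matrixP => i j; rewrite !mxE /horner_eval (hb _).2.
    by rewrite (inj_eq enum_val_inj).
  by rewrite det1 => /eqP; rewrite eq_sym oner_eq0.
move=> s; rewrite detM => ds; apply: (@solvable_of_det _ _ _ b) => // [i|i|].
- by move=> a f g; rewrite lPhi hornerD hornerZ.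
- by case: (hb i).
apply: contraNneq ds => <-; apply/eqP; congr (\det _).
by apply/matrixP => i j; rewrite !mxE.
Qed.

End Solvability.

(** * Conditions that are open along every line of parameters *)

Section LineOpen.
Variables (K : numFieldType) (T : Type).
Implicit Types (p : T -> K).

Definition segment p0 p1 (s : K) : T -> K := fun t => p0 t + s * (p1 t - p0 t).

(* The condition is open and dense, for the Zariski topology, on every line
   through one of its points; nonempty conditions of this kind are jointly
   satisfiable. *)
Definition line_open (Phi : (T -> K) -> Prop) := forall p0 p1, Phi p0 ->
  exists q : {poly K}, q != 0 /\ forall s, q.[s] != 0 -> Phi (segment p0 p1 s).

Definition poly_along (a : (T -> K) -> K) := forall p0 p1,
  exists q : {poly K}, forall s, a (segment p0 p1 s) = q.[s].

Lemma segment0 p0 p1 : segment p0 p1 0 = p0.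
Proof. by apply: funext => t; rewrite /segment mul0r addr0. Qed.

Lemma segmentC p0 p1 s : segment p1 p0 (1 - s) = segment p0 p1 s.
Proof. by apply: funext => t; rewrite /segment; ring. Qed.

(** Characteristic 0 enters here: the natural numbers supply more points than [q] has roots. *)
Lemma exists_nonroot (q : {poly K}) : q != 0 -> exists s : K, q.[s] != 0.
Proof.
move=> q0; apply: contrapT => /forallNP h.
pose r := [seq (i%:R : K) | i <- iota 0 (size q).+1].
have : (size r < size q)%N.
  apply: max_poly_roots => //.
    by apply/allP => x _; rewrite rootE; apply: contra_notT (h x).
  by rewrite map_inj_uniq ?iota_uniq // => i j /eqP; rewrite eqr_nat => /eqP.
by rewrite size_map size_iota ltnNge leqnSn.
Qed.

Lemma line_openI Phi Psi : line_open Phi -> line_open Psi ->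
  line_open (fun p => Phi p /\ Psi p).
Proof.
move=> h1 h2 p0 p1 [a b]; have [q [q0 hq]] := h1 _ p1 a.
have [r [r0 hr]] := h2 _ p1 b; exists (q * r); split; first by rewrite mulf_neq0.
by move=> s; rewrite hornerM mulf_eq0 negb_or => /andP [/hq ? /hr ?].
Qed.

(** On the segment from a point of [Phi] to a point of [Psi] each condition fails for finitely many
    parameters only; [r'] is [r] read from the other end of the segment. *)
Lemma line_open_meet Phi Psi : line_open Phi -> line_open Psi ->
  (exists p, Phi p) -> (exists p, Psi p) -> exists p, Phi p /\ Psi p.
Proof.
move=> h1 h2 [p0 a] [p1 b].
have [q [q0 hq]] := h1 _ p1 a; have [r [r0 hr]] := h2 _ p0 b.
pose r' := r \Po (1 - 'X).
have r'0 : r' != 0.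
  apply/eqP => e; move/eqP: r0; apply.
  have : r' \Po (1 - 'X) = 0 by rewrite e comp_poly0.
  rewrite /r' -comp_polyA rmorphB /= comp_polyX rmorph1 opprB addrC subrK.
  by rewrite comp_polyXr.
have [s hs] := exists_nonroot (mulf_neq0 q0 r'0).
move: hs; rewrite hornerM mulf_eq0 negb_or => /andP [s1 s2].
exists (segment p0 p1 s); split; first exact: hq.
by rewrite -segmentC; apply: hr; move: s2; rewrite horner_comp !hornerE.
Qed.

Lemma line_open_forall (I : finType) (Phi : I -> (T -> K) -> Prop) :
  (forall i, line_open (Phi i)) -> line_open (fun p => forall i, Phi i p).
Proof.
move=> h p0 p1 a; have [q hq] := boolp.choice (fun i => h i p0 p1 (a i)).
exists (\prod_i q i); split; first by apply/prodf_neq0 => i _; case: (hq i).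
move=> s; rewrite horner_prod => /prodf_neq0 hs i.
by apply: (hq i).2; exact: hs.
Qed.

Lemma line_open_impl (Q : Prop) (Phi : (T -> K) -> Prop) :
  line_open Phi -> line_open (fun p => Q -> Phi p).
Proof.
move=> h p0 p1 a; have [q|nq] := pselect Q.
  by have [r [r0 hr]] := h _ p1 (a q); exists r; split=> // s /hr.
by exists 1; split=> //; exact: oner_neq0.
Qed.

Lemma line_open_neq0 a : poly_along a -> line_open (fun p => a p != 0).
Proof.
move=> h p0 p1 n0; have [q hq] := h p0 p1; exists q; split.
  by apply/eqP => q0; move: n0; rewrite -(segment0 p0 p1) hq q0 horner0 eqxx.
by move=> s; rewrite hq.
Qed.

Lemma poly_along_coord t : poly_along (fun p => p t).
Proof.
move=> p0 p1; exists ((p0 t)%:P + (p1 t - p0 t) *: 'X) => s.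
by rewrite !hornerE /segment [s * _]mulrC.
Qed.

Lemma poly_along_const c : poly_along (fun=> c).
Proof. by move=> p0 p1; exists c%:P => s; rewrite hornerC. Qed.

Lemma poly_alongD a b : poly_along a -> poly_along b ->
  poly_along (fun p => a p + b p).
Proof.
move=> ha hb p0 p1; have [q hq] := ha p0 p1; have [r hr] := hb p0 p1.
by exists (q + r) => s; rewrite hornerD hq hr.
Qed.

Lemma poly_alongM a b : poly_along a -> poly_along b ->
  poly_along (fun p => a p * b p).
Proof.
move=> ha hb p0 p1; have [q hq] := ha p0 p1; have [r hr] := hb p0 p1.
by exists (q * r) => s; rewrite hornerM hq hr.
Qed.

Lemma poly_alongN a : poly_along a -> poly_along (fun p => - a p).
Proof.
by move=> ha p0 p1; have [q hq] := ha p0 p1; exists (- q) => s; rewrite hornerN hq.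
Qed.

(** Testing polynomial dependence on segments only allows an arbitrary function space of parameters
    and reduces openness to determinants in one variable. *)
Definition functional_family (V : lmodType K) I (phi : (T -> K) -> I -> V -> K) :=
  forall p0 p1, exists Phi : I -> V -> {poly K}, (forall i, linear (Phi i)) /\
    forall s i f, phi (segment p0 p1 s) i f = (Phi i f).[s].

Lemma line_open_solvable (V : lmodType K) (I : finType) (P : V -> Prop)
    (phi : (T -> K) -> I -> V -> K) :
  subspace P -> functional_family phi ->
  line_open (fun p => solvable_on P (phi p)).
Proof.
move=> sP h p0 p1 s0; have [Phi [lPhi e]] := h p0 p1.
have [q [q0 hq]] : exists q : {poly K}, q != 0 /\ forall s, q.[s] != 0 ->
    solvable_on P (fun i f => (Phi i f).[s]).
  apply: (@solvable_poly_open _ _ _ _ _ 0) => // c; have [f [Pf hf]] := s0 c.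
  by exists f; split=> // i; rewrite -e segment0.
exists q; split=> // s /hq hs c; have [f [Pf hf]] := hs c.
by exists f; split=> // i; rewrite e.
Qed.

Lemma functional_family_sum (V : lmodType K) (I J : Type)
    (phi : (T -> K) -> I -> V -> K) (psi : (T -> K) -> J -> V -> K) :
  functional_family phi -> functional_family psi ->
  functional_family (fun p (s : I + J) f =>
    match s with inl i => phi p i f | inr j => psi p j f end).
Proof.
move=> h1 h2 p0 p1; have [F [lF eF]] := h1 p0 p1; have [G [lG eG]] := h2 p0 p1.
exists (fun s => match s with inl i => F i | inr j => G j end).
by split; [case|move=> s [i|j] f].
Qed.

End LineOpen.

(** * Restriction of forms to parametrized lines *)

Section Forms.

Lemma mpoly_morph_eq (N : nat) (K A : comNzRingType)
    (F G : {rmorphism {mpoly K[N]} -> A}) :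
  (forall c, F c%:MP = G c%:MP) -> (forall i, F 'X_i = G 'X_i) -> F =1 G.
Proof.
move=> hC hX f; rewrite [f]mpolyE !rmorph_sum; apply: eq_bigr => m _.
rewrite -mul_mpolyC !rmorphM /= hC; congr (_ * _).
rewrite mpolyXE_id !rmorph_prod; apply: eq_bigr => i _.
by rewrite !rmorphXn /= hX.
Qed.

Section LineRestriction.
Variables (K A : comNzRingType) (N : nat) (phi : {rmorphism K -> A}).
Implicit Types (u v : 'I_N -> A) (f g : {mpoly K[N]}).

(** The restriction to the line through u and v, at the point u + X v. The ring [A] is kept apart
    from [K] so that the coordinates of the line may be polynomials in a deformation parameter or in
    indeterminate coefficients. *)
Definition line_restr u v f : {poly A} :=
  mmap (polyC \o phi) (fun i => (u i)%:P + (v i)%:P * 'X) f.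

HB.instance Definition _ u v :=
  GRing.RMorphism.copy (line_restr u v)
    (mmap (polyC \o phi) (fun i => (u i)%:P + (v i)%:P * 'X)).

Lemma line_restrX u v i : line_restr u v 'X_i = (u i)%:P + (v i)%:P * 'X.
Proof. by rewrite /line_restr mmapX mmap1U. Qed.

Lemma line_restrC u v c : line_restr u v c%:MP = (phi c)%:P.
Proof. by rewrite /line_restr mmapC. Qed.

Lemma line_restrZ u v c f : line_restr u v (c *: f) = phi c *: line_restr u v f.
Proof. by rewrite /line_restr mmapZ /= mul_polyC. Qed.

Lemma size_line_restr u v d f :
  f \is d.-homog -> (size (line_restr u v f) <= d.+1)%N.
Proof.
move=> hf; rewrite /line_restr /mmap.
apply: (leq_trans (size_sum _ _ _)); apply/bigmax_leqP_seq => m ms _.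
rewrite /= mul_polyC; apply: (leq_trans (size_scale_leq _ _)).
rewrite -(dhomogP _ _ _ hf m ms) /= mdegE /mmap1.
elim/big_rec2: _ => [|i k q _ IH]; first by rewrite size_poly1.
apply: (leq_trans (size_polyMleq _ _)).
have : (size (((u i)%:P + (v i)%:P * 'X) ^+ m i)%R <= (m i).+1)%N.
  apply: (leq_trans (size_poly_exp_leq _ _)); rewrite ltnS.
  have : (size ((u i)%:P + (v i)%:P * 'X)%R <= 2)%N.
    rewrite addrC mul_polyC (leq_trans (size_polyD _ _)) // geq_max.
    rewrite (leq_trans (size_scale_leq _ _)) ?size_polyX //=.
    by rewrite (leq_trans (size_polyC_leq1 _)).
  case: (size _) => [|[|[|//]]] _ //=; by rewrite ?mul0n ?mul1n.
move: IH; case: (size _) => [|a]; case: (size _) => [|b] //=; lia.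
Qed.

Lemma line_restr_coef0 u v f :
  (line_restr u v f)`_0 = mmap phi u f.
Proof.
rewrite -horner_coef0.
pose F : {rmorphism _ -> A} := horner_eval 0 \o line_restr u v.
apply: (@mpoly_morph_eq _ _ _ F (mmap phi u)) => [c|i] /=.
  by rewrite /horner_eval line_restrC hornerC mmapC.
by rewrite /horner_eval line_restrX mmapX mmap1U !hornerE.
Qed.

End LineRestriction.

Section OverField.
Variable K : numFieldType.

Definition lf N (u v : 'I_N -> K) : {mpoly K[N]} -> {poly K} :=
  line_restr idfun u v.

HB.instance Definition _ N u v :=
  GRing.RMorphism.copy (@lf N u v) (line_restr idfun u v).

Section Basics.
Variable N : nat.
Implicit Types (u v : 'I_N -> K) (f g : {mpoly K[N]}).

Lemma lfX u v i : lf u v 'X_i = (u i)%:P + (v i)%:P * 'X.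
Proof. exact: line_restrX. Qed.

Lemma lfC u v c : lf u v c%:MP = c%:P.
Proof. exact: line_restrC. Qed.

Lemma lfZ u v c f : lf u v (c *: f) = c *: lf u v f.
Proof. exact: line_restrZ. Qed.

Lemma lf_linear u v : linear (lf u v).
Proof. by move=> a f g; rewrite rmorphD /= lfZ. Qed.

Lemma size_lf u v d f : f \is d.-homog -> (size (lf u v f) <= d.+1)%N.
Proof. exact: size_line_restr. Qed.

Lemma lf_horner u v f s : (lf u v f).[s] = f.@[fun i => u i + s * v i].
Proof.
pose F : {rmorphism _ -> K} := horner_eval s \o lf u v.
apply: (@mpoly_morph_eq _ _ _ F (meval (fun i => u i + s * v i))) => [c|i] /=.
  by rewrite /horner_eval lfC hornerC mevalC.
by rewrite /horner_eval lfX mevalXU !hornerE mulrC.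
Qed.

Lemma lf_coef0 u v f : (lf u v f)`_0 = f.@[u].
Proof. exact: line_restr_coef0. Qed.

Lemma lf_scale u v c f : lf u (fun i => c * v i) f = lf u v f \Po (c *: 'X).
Proof.
pose F : {rmorphism _ -> _} := comp_poly (c *: 'X) \o lf u v.
apply: (@mpoly_morph_eq _ _ _ (lf u (fun i => c * v i)) F) => [b|i] /=.
  by rewrite !lfC comp_polyC.
rewrite !lfX comp_polyD comp_polyM !comp_polyC comp_polyX polyCM -!mul_polyC.
by rewrite mulrA [c%:P * _]mulrC.
Qed.

Lemma lf_shift u v c f :
  lf (fun i => u i + c * v i) v f = lf u v f \Po ('X + c%:P).
Proof.
pose F : {rmorphism _ -> _} := comp_poly ('X + c%:P) \o lf u v.
apply: (@mpoly_morph_eq _ _ _ (lf (fun i => u i + c * v i) v) F) => [b|i] /=.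
  by rewrite !lfC comp_polyC.
rewrite !lfX comp_polyD comp_polyM !comp_polyC comp_polyX polyCD polyCM; ring.
Qed.

Lemma meval_homogZ d f u c :
  f \is d.-homog -> f.@[fun i => c * u i] = c ^+ d * f.@[u].
Proof.
move=> hf; rewrite !mevalE mulr_sumr big_seq [RHS]big_seq.
apply: eq_bigr => m ms; rewrite mulrCA; congr (_ * _).
under eq_bigr => i _ do rewrite exprMn.
rewrite big_split /=; congr (_ * _).
by rewrite prodrXr -mdegE (dhomogP _ _ _ hf m ms).
Qed.


Lemma meval_scalar u : scalar (meval u : {mpoly K[N]} -> K).
Proof. by move=> a f g; rewrite mevalD mevalZ. Qed.

Lemma coef_lf_scalar u v k : scalar (fun f : {mpoly K[N]} => (lf u v f)`_k).
Proof. by move=> a f g; rewrite lf_linear coefD coefZ. Qed.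

Definition forms d := fun f : {mpoly K[N]} => is_true (f \is d.-homog).

Lemma forms_subspace d : subspace (forms d).
Proof. by split=> [|a f g hf hg]; rewrite /forms ?dhomog0 // dhomogD // dhomogZ. Qed.

Lemma coefM_top (p q : {poly K}) a b : (size p <= a.+1)%N -> (size q <= b.+1)%N ->
  (p * q)`_(a + b) = p`_a * q`_b.
Proof.
move=> sp sq; rewrite coefM (bigD1 (inord a)) //= inordK ?ltnS ?leq_addr //.
rewrite addKn big1 ?addr0 // => i ne.
have [lt|le] := ltnP a i.
  by rewrite nth_default ?mul0r // (leq_trans sp).
have lt : (i < a)%N.
  rewrite ltn_neqAle le andbT; apply: contra ne => /eqP e.
  by rewrite -val_eqE /= inordK ?e // ltnS leq_addr.
rewrite [q`_ _]nth_default ?mulr0 // (leq_trans sq) //; lia.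
Qed.

(** The point v is at infinity for the parameter of the line; the top coefficient is the value
    there, as the constant one is the value at u. *)
Lemma lf_coef_top d u v f : f \is d.-homog -> (lf u v f)`_d = f.@[v].
Proof.
move=> hf; rewrite /lf /line_restr /mmap mevalE coef_sum big_seq [RHS]big_seq.
apply: eq_bigr => m ms; rewrite /= coefCM; congr (_ * _).
rewrite -(dhomogP _ _ _ hf m ms) /= mdegE /mmap1.
suff [] : (\prod_(i < N) ((u i)%:P + (v i)%:P * 'X) ^+ m i)`_(\sum_(i < N) m i)
    = \prod_(i < N) v i ^+ m i /\
  (size (\prod_(i < N) ((u i)%:P + (v i)%:P * 'X) ^+ m i)%R
     <= (\sum_(i < N) m i).+1)%N by [].
have szl (a b : K) : (size (a%:P + b%:P * 'X)%R <= 2)%N.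
  rewrite addrC mul_polyC (leq_trans (size_polyD _ _)) // geq_max.
  rewrite (leq_trans (size_scale_leq _ _)) ?size_polyX //=.
  by rewrite (leq_trans (size_polyC_leq1 _)).
have szM (p q : {poly K}) a b : (size p <= a.+1)%N -> (size q <= b.+1)%N ->
    (size (p * q)%R <= (a + b).+1)%N.
  by move=> sp sq; apply: (leq_trans (size_polyMleq _ _)); lia.
have pw (a b : K) k : ((a%:P + b%:P * 'X) ^+ k)`_k = b ^+ k /\
    (size ((a%:P + b%:P * 'X) ^+ k)%R <= k.+1)%N.
  elim: k => [|k [IH1 IH2]]; first by rewrite !expr0 coef1 size_poly1.
  rewrite !exprS -add1n; split; last exact: szM.
  by rewrite coefM_top // IH1 coefD coefC mul_polyC coefZ coefX add0r mulr1.
elim/big_rec3: _ => [|i a b c _ [IH1 IH2]]; first by rewrite coef1 size_poly1.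
have [h1 h2] := pw (u i) (v i) (m i).
by split; [rewrite coefM_top // h1 IH1|exact: szM].
Qed.

End Basics.

(** Induction on the number of variables: [U] reads [f] as a polynomial in the last variable with
    coefficients in the others, and [W] serves to show that [U] is injective. *)
Lemma meval_neq0 N (f : {mpoly K[N]}) : f != 0 -> exists u, f.@[u] != 0.
Proof.
elim: N f => [|N IH] f f0.
  exists (fun=> 0); move: f0; rewrite [f]nvar0_mpolyC mevalC.
  by apply: contra => /eqP ->; rewrite mpolyC0.
pose X i : {poly {mpoly K[N]}} :=
  if unlift ord_max i is Some j then ('X_j)%:P else 'X.
pose U : {rmorphism _ -> _} := mmap (polyC \o @mpolyC N K) X.
pose W : {rmorphism {mpoly K[N]} -> {mpoly K[N.+1]}} :=
  mmap (@mpolyC N.+1 K) (fun i => 'X_(lift ord_max i)).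
have UK g : (map_poly W (U g)).['X_ord_max] = g.
  pose F : {rmorphism _ -> _} := horner_eval ('X_ord_max : {mpoly K[N.+1]}) \o
    (map_poly W \o U).
  rewrite -[RHS]/(idfun g).
  apply: (@mpoly_morph_eq _ _ _ F idfun) => [c|i] /=.
    by rewrite /U /= mmapC /= map_polyC /= /horner_eval hornerC /W /= mmapC.
  rewrite /U /= mmapX mmap1U /X; case: unliftP => [j ->|->].
    by rewrite map_polyC /horner_eval hornerC /W /= mmapX mmap1U.
  by rewrite map_polyX /horner_eval hornerX.
have : U f != 0.
  by apply: contra f0 => /eqP e; rewrite -[f]UK e rmorph0 horner0.
move=> U0.
have [k nk] : exists k, (U f)`_k != 0.
  by exists (size (U f)).-1; rewrite -lead_coefE lead_coef_eq0.
have [u hu] := IH _ nk.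
have ne : map_poly (meval u) (U f) != 0.
  by apply/eqP => e; move: hu; rewrite -coef_map e coef0 eqxx.
have [s hs] := exists_nonroot ne.
exists (fun i => if unlift ord_max i is Some j then u j else s).
suff <- : (map_poly (meval u) (U f)).[s] =
    f.@[fun i => if unlift ord_max i is Some j then u j else s] by [].
pose F : {rmorphism _ -> _} := horner_eval s \o (map_poly (meval u) \o U).
apply: (@mpoly_morph_eq _ _ _ F (meval _)) => [c|i] /=.
  by rewrite /U /= mmapC map_polyC /= /horner_eval hornerC !mevalC.
rewrite /U /= mmapX mmap1U /X mevalXU; case: unliftP => [j _|_].
  by rewrite map_polyC /horner_eval hornerC /= mevalXU.
by rewrite map_polyX /horner_eval hornerX.
Qed.

Lemma forms_free n d : free_in 'I_('C(n + d, d)) (@forms n.+1 d).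
Proof.
have e : \dim (fullv : {vspace dhomog n.+1 K d}) = 'C(n + d, d).
  by rewrite dimvf /dim /= addnC.
rewrite -e; exists (fun i : 'I__ => val (vbasis (fullv : {vspace dhomog n.+1 K d}))`_i).
split=> [i|c h i]; first exact: dhomog_is_dhomog.
have /freeP fr := basis_free (vbasisP (fullv : {vspace dhomog n.+1 K d})).
apply: fr; apply: val_inj; rewrite /= -[RHS]h raddf_sum /=.
by [].
Qed.

Lemma forms_spanned n d : spanned_by 'I_('C(n + d, d)) (@forms n.+1 d).
Proof.
have e : \dim (fullv : {vspace dhomog n.+1 K d}) = 'C(n + d, d).
  by rewrite dimvf /dim /= addnC.
rewrite -e; exists (fun i : 'I__ => val (vbasis (fullv : {vspace dhomog n.+1 K d}))`_i).
move=> f hf; pose g := DHomog hf.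
exists (fun i => coord (vbasis fullv) i g).
rewrite -[f]/(val g) {1}(coord_vbasis (memvf g)) raddf_sum /=.
by [].
Qed.

(** A moving line: the outer variable runs along the line, the inner one is the deformation
    parameter. *)
Definition lfP N (U V : 'I_N -> {poly K}) (f : {mpoly K[N]}) : {poly {poly K}} :=
  line_restr (polyC : {rmorphism K -> {poly K}}) U V f.

Lemma lfP_linear N (U V : 'I_N -> {poly K}) k : linear (fun f => (lfP U V f)`_k).
Proof.
move=> a f g.
by rewrite /lfP rmorphD /= line_restrZ coefD coefZ mul_polyC.
Qed.

Lemma lfP_horner N (U V : 'I_N -> {poly K}) f k s :
  ((lfP U V f)`_k).[s] = (lf (fun i => (U i).[s]) (fun i => (V i).[s]) f)`_k.
Proof.
pose F : {rmorphism _ -> _} := map_poly (horner_eval s) \o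
  line_restr (polyC : {rmorphism K -> {poly K}}) U V.
pose G : {rmorphism {mpoly K[N]} -> {poly K}} :=
  lf (fun i => (U i).[s]) (fun i => (V i).[s]).
have FG : F f = G f.
  apply: mpoly_morph_eq => [c|i] /=.
    by rewrite line_restrC lfC map_polyC /= /horner_eval hornerC.
  rewrite line_restrX lfX rmorphD rmorphM /= map_polyX !map_polyC.
  by rewrite /= /horner_eval.
have := congr1 (fun p : {poly K} => p`_k) FG.
by rewrite /= (coef_map (horner_eval s)).
Qed.

Lemma coef_lf_family T I N (u v : (T -> K) -> I -> 'I_N -> K) (k : I -> nat) :
  (forall i l, poly_along (fun p => u p i l)) ->
  (forall i l, poly_along (fun p => v p i l)) ->
  functional_family (fun p i (f : {mpoly K[N]}) => (lf (u p i) (v p i) f)`_(k i)).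
Proof.
move=> hu hv p0 p1.
have [U eU] := boolp.choice (fun il : I * 'I_N => hu il.1 il.2 p0 p1).
have [V eV] := boolp.choice (fun il : I * 'I_N => hv il.1 il.2 p0 p1).
exists (fun i f => (lfP (fun l => U (i, l)) (fun l => V (i, l)) f)`_(k i)).
split=> [i|s i f]; first exact: lfP_linear.
rewrite lfP_horner; congr (lf _ _ f)`_ _; apply: funext => l.
  exact: (eU (i, l)).
exact: (eV (i, l)).
Qed.

Lemma meval_family T I N (u : (T -> K) -> I -> 'I_N -> K) :
  (forall i l, poly_along (fun p => u p i l)) ->
  functional_family (fun p i (f : {mpoly K[N]}) => f.@[u p i]).
Proof.
move=> hu p0 p1.
have [F [lF eF]] := @coef_lf_family T I N u (fun _ _ _ => 0) (fun=> 0%N) hu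
  (fun _ _ => poly_along_const 0) p0 p1.
by exists F; split=> // s i f; rewrite -eF lf_coef0.
Qed.

End OverField.

End Forms.

(** * Lines and a quadric surface in P^3 *)

Section Quadric.
Variable K : numFieldType.

Lemma poly_ext_off (p q r : {poly K}) : r != 0 ->
  (forall s, r.[s] != 0 -> p.[s] = q.[s]) -> p = q.
Proof.
move=> r0 h; apply/eqP; rewrite -subr_eq0; apply/negPn/negP => n0.
have [s] := exists_nonroot (mulf_neq0 n0 r0).
rewrite hornerM mulf_eq0 negb_or !hornerE => /andP [n1 /h e].
by move: n1; rewrite e subrr eqxx.
Qed.

Lemma poly_ext (p q : {poly K}) : (forall s, p.[s] = q.[s]) -> p = q.
Proof. by move=> h; apply: (@poly_ext_off _ _ 1) => //; exact: oner_neq0. Qed.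

Lemma exists_fresh (bad : seq K) t : exists a : 'I_t -> K,
  injective a /\ forall j, a j \notin bad.
Proof.
elim: t => [|t [a [ia ha]]].
  have a : 'I_0 -> K by case.
  by exists a; split; case.
pose q := \prod_(b <- bad ++ codom a) ('X - b%:P).
have [s hs] : exists s, q.[s] != 0.
  by apply: exists_nonroot; rewrite prodf_seq_neq0; apply/allP => b _; rewrite polyXsubC_eq0.
have ns : s \notin bad ++ codom a.
  by move: hs; rewrite -[_ != 0]/(~~ root _ _) root_prod_XsubC.
move: ns; rewrite mem_cat negb_or => /andP [n1 n2].
exists (fun j => if unlift ord_max j is Some i then a i else s); split.
  move=> i j; case: unliftP => [i' ->|->]; case: unliftP => [j' ->|->] //.
  - by move/ia => ->.
  - by move=> e; rewrite -e codom_f in n2.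
  - by move=> e; rewrite e codom_f in n2.
by move=> j; case: unliftP.
Qed.

(** Geometrically, the lines through [u j] and [v j] and the points [pts i] impose independent
    conditions on forms of degree d, a line counting for the d + 1 coefficients of its
    restriction. *)
Definition config_solvable N d (J I : Type) (u v : J -> 'I_N -> K)
    (pts : I -> 'I_N -> K) :=
  solvable_on (@forms K N d) (fun (s : (J * 'I_d.+1) + I) f =>
    match s with
    | inl jk => (lf (u jk.1) (v jk.1) f)`_jk.2
    | inr i => f.@[pts i]
    end).

Lemma config_solvableP N d (J I : Type) (u v : J -> 'I_N -> K)
    (pts : I -> 'I_N -> K) :
  config_solvable d u v pts <-> forall (G : J -> {poly K}) (c : I -> K),
    (forall j, (size (G j) <= d.+1)%N) ->
    exists f, [/\ f \is d.-homog, forall j, lf (u j) (v j) f = G j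
      & forall i, f.@[pts i] = c i].
Proof.
split=> h.
  move=> G c sG; have [f [hf e]] := h (fun s =>
    match s with inl jk => (G jk.1)`_jk.2 | inr i => c i end).
  exists f; split=> // [j|i]; last exact: (e (inr i)).
  apply/polyP => k.
  have [lt|le] := ltnP k d.+1; first by have := e (inl (j, Ordinal lt)).
  by rewrite !nth_default // (leq_trans _ le) // (size_lf _ _ hf).
move=> c.
have [|f [hf e e']] := h (fun j => \poly_(k < d.+1) c (inl (j, inord k))) (c \o inr).
  by move=> j; exact: size_poly.
exists f; split=> // -[[j k]|i] //=; rewrite e coef_poly ltn_ord.
by congr (c (inl (_, _))); apply: val_inj; rewrite /= inordK.
Qed.

Lemma config_family T N d (J I : Type) (u v : (T -> K) -> J -> 'I_N -> K)
    (pts : (T -> K) -> I -> 'I_N -> K) :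
  (forall j l, poly_along (fun p => u p j l)) ->
  (forall j l, poly_along (fun p => v p j l)) ->
  (forall i l, poly_along (fun p => pts p i l)) ->
  functional_family (fun p (s : (J * 'I_d.+1) + I) (f : {mpoly K[N]}) =>
    match s with
    | inl jk => (lf (u p jk.1) (v p jk.1) f)`_jk.2
    | inr i => f.@[pts p i]
    end).
Proof.
move=> hu hv hp; apply: functional_family_sum; last exact: (@meval_family K T _ _ pts).
by apply: (@coef_lf_family K T _ _ (fun p (jk : J * 'I_d.+1) => u p jk.1)
  (fun p (jk : J * 'I_d.+1) => v p jk.1) (fun jk => jk.2)).
Qed.

Lemma config_open T N d (J I : finType) (u v : (T -> K) -> J -> 'I_N -> K)
    (pts : (T -> K) -> I -> 'I_N -> K) :
  (forall j l, poly_along (fun p => u p j l)) ->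
  (forall j l, poly_along (fun p => v p j l)) ->
  (forall i l, poly_along (fun p => pts p i l)) ->
  line_open (fun p => config_solvable d (u p) (v p) (pts p)).
Proof.
move=> hu hv hp; apply: line_open_solvable; first exact: forms_subspace.
exact: config_family.
Qed.

(** An affine chart of the Segre embedding of P^1 x P^1; fixing x or y gives a line of one of the
    two rulings of [quadric]. *)
Definition qr (x y : K) : 'I_4 -> K := fun i => [:: 1; x; y; x * y]`_i.

Definition quadric : {mpoly K[4]} := 'X_0 * 'X_3 - 'X_1 * 'X_2.

Lemma quadric_homog : quadric \is 2.-homog.
Proof.
by apply: rpredB; rewrite -[2%N]/(1 + 1)%N; apply: dhomogM;
  rewrite dhomogX /= mdeg1.
Qed.

Lemma meval_quadric u : quadric.@[u] = u 0 * u 3 - u 1 * u 2.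
Proof. by rewrite /quadric mevalB !mevalM !mevalXU. Qed.

Lemma quadric_qr x y : quadric.@[qr x y] = 0.
Proof. by rewrite meval_quadric /qr /=; ring. Qed.

(** The quadric vanishes at both points, so only the middle coefficient survives. It is nonzero
    precisely when the points lie on no common line of a ruling. *)
Lemma lf_quadric x y x' y' :
  lf (qr x y) (qr x' y') quadric = ((x - x') * (y - y')) *: 'X.
Proof.
by apply: poly_ext => s; rewrite lf_horner meval_quadric /qr /= hornerZ hornerX; ring.
Qed.

Section Bidegree.
Variables A B : nat.

(** A matrix of format (A, B) stands for a form of bidegree (A - 1, B - 1) on the quadric,
    dehomogenized. *)
Definition bieval (xy : K * K) (M : 'M[K]_(A, B)) : K :=
  \sum_i \sum_j M i j * (xy.1 ^+ i * xy.2 ^+ j).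

Lemma bieval_scalar xy : scalar (bieval xy).
Proof.
move=> a M M'; rewrite /bieval mulr_sumr -big_split; apply: eq_bigr => i _ /=.
rewrite mulr_sumr -big_split; apply: eq_bigr => j _ /=.
by rewrite !mxE mulrDl -!mulrA.
Qed.

Definition anymx := fun _ : 'M[K]_(A, B) => True.

Lemma anymx_subspace : subspace anymx. Proof. by split. Qed.

Lemma anymx_free : free_in ('I_A * 'I_B)%type anymx.
Proof.
exists (fun ij => delta_mx ij.1 ij.2); split=> // c.
move=> /matrixP h [i j]; have := h i j; rewrite mxE summxE => <-.
rewrite (bigD1 (i, j)) //= !mxE !eqxx mulr1 big1 ?addr0 // => -[i' j'] ne.
rewrite !mxE /= [i == _]eq_sym [j == _]eq_sym -xpair_eqE.
by rewrite (negPf ne) mulr0.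
Qed.

Lemma bieval_neq0 M : anymx M -> M != 0 -> exists xy, bieval xy M != 0.
Proof.
move=> _ M0; have [i [j nij]] : exists i j, M i j != 0.
  apply: contrapT => h; move/eqP: M0; apply; apply/matrixP => i j; rewrite mxE.
  by apply: contrapT => ne; apply: h; exists i, j; apply/eqP.
pose r y i' : K := \sum_(j' < B) M i' j' * y ^+ j'.
have [y hy] : exists y, r y i != 0.
  have : rVpoly (row i M) != 0.
    apply/eqP => e; move: nij; have := congr1 (fun p : {poly K} => p`_j) e.
    by rewrite coef_rVpoly_ord mxE coef0 => ->; rewrite eqxx.
  move=> /exists_nonroot [y hy]; exists y; move: hy.
  rewrite horner_poly /r; apply: contra_neq => e0; rewrite -[RHS]e0; apply: eq_bigr => j' _.
  by rewrite valK mxE.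
have [x hx] : exists x, (rVpoly (\row_i' r y i')).[x] != 0.
  apply: exists_nonroot; apply/eqP => e.
  have := congr1 (fun p : {poly K} => p`_i) e.
  by rewrite coef_rVpoly_ord mxE coef0 => e0; rewrite e0 eqxx in hy.
exists (x, y); move: hx; rewrite horner_poly /bieval /=.
apply: contra_neq => e0; rewrite -[RHS]e0; apply: eq_bigr => i' _.
rewrite valK mxE /r mulr_suml; apply: eq_bigr => j' _.
by rewrite mulrA mulrAC.
Qed.

Lemma bieval_family T I (x y : (T -> K) -> I -> K) :
  (forall i, poly_along (fun p => x p i)) ->
  (forall i, poly_along (fun p => y p i)) ->
  functional_family (fun p i M => bieval (x p i, y p i) M).
Proof.
move=> hx hy p0 p1.
have [X eX] := boolp.choice (fun i => hx i p0 p1).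
have [Y eY] := boolp.choice (fun i => hy i p0 p1).
exists (fun i (M : 'M[K]_(A, B)) => \sum_k \sum_l M k l *: (X i ^+ k * Y i ^+ l)); split.
  move=> i a M M'; rewrite scaler_sumr -big_split; apply: eq_bigr => k _ /=.
  rewrite scaler_sumr -big_split; apply: eq_bigr => l _ /=.
  by rewrite !mxE scalerDl scalerA.
move=> s i M; rewrite horner_sum; apply: eq_bigr => k _.
rewrite horner_sum; apply: eq_bigr => l _.
by rewrite !hornerE /= eX eY.
Qed.

Lemma bieval_points (I : finType) phi k :
  (forall i : I, scalar (phi i)) -> (#|I| + k <= A * B)%N ->
  solvable_on anymx phi -> exists xy : 'I_k -> K * K,
  solvable_on anymx (fun s M =>
    match s with inl i => phi i M | inr j => bieval (xy j) M end).
Proof.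
move=> sphi le; apply: (solvable_points anymx_subspace sphi bieval_scalar).
- by move=> f Pf _; exact: bieval_neq0.
- exact: anymx_free.
- by rewrite card_prod !card_ord.
Qed.

End Bidegree.

End Quadric.

(** * Traces on the quadric *)

Section QuadricStep.
Variable K : numFieldType.

(* The form of degree d that restricts to x^i y^j on the quadric. *)
Definition bimonomial d i j : {mpoly K[4]} :=
  if (i <= j)%N then 'X_0 ^+ (d - j) * 'X_2 ^+ (j - i) * 'X_3 ^+ i
  else 'X_0 ^+ (d - i) * 'X_1 ^+ (i - j) * 'X_3 ^+ j.

Definition biform d (P G : {poly K}) : {mpoly K[4]} :=
  \sum_(i < d.+1) \sum_(j < d.+1) (P`_i * G`_j) *: bimonomial d i j.

Lemma mpolyX_homog N (i : 'I_N) k : ('X_i ^+ k : {mpoly K[N]}) \is k.-homog.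
Proof.
by rewrite -[X in X.-homog]mul1n; apply: dhomogMn; rewrite dhomogX /= mdeg1.
Qed.

Lemma bimonomial_homog d i j : (i <= d)%N -> (j <= d)%N ->
  bimonomial d i j \is d.-homog.
Proof.
move=> hi hj; rewrite /bimonomial; case: leqP => ij.
  have {2}-> : (d = d - j + (j - i) + i)%N by lia.
  by do 2![apply: dhomogM; last exact: mpolyX_homog]; exact: mpolyX_homog.
have {2}-> : (d = d - i + (i - j) + j)%N by lia.
by do 2![apply: dhomogM; last exact: mpolyX_homog]; exact: mpolyX_homog.
Qed.

Lemma meval_bimonomial d i j x y :
  (bimonomial d i j).@[qr x y] = x ^+ i * y ^+ j.
Proof.
rewrite /bimonomial; case: leqP => ij.
  rewrite !mevalM !rmorphXn /= !mevalXU /qr /= expr1n mul1r exprMn.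
  by rewrite mulrCA -exprD subnK.
rewrite !mevalM !rmorphXn /= !mevalXU /qr /= expr1n mul1r exprMn.
by rewrite mulrA -exprD subnK // ltnW.
Qed.

Lemma biform_homog d P G : biform d P G \is d.-homog.
Proof.
apply: rpred_sum => i _; apply: rpred_sum => j _; apply: dhomogZ.
by apply: bimonomial_homog; rewrite -ltnS.
Qed.

Lemma meval_biform d (P G : {poly K}) x y : (size P <= d.+1)%N -> (size G <= d.+1)%N ->
  (biform d P G).@[qr x y] = P.[x] * G.[y].
Proof.
move=> sP sG; rewrite (horner_coef_wide _ sP) (horner_coef_wide _ sG).
rewrite /biform raddf_sum mulr_suml; apply: eq_bigr => i _ /=.
rewrite raddf_sum mulr_sumr; apply: eq_bigr => j _ /=.
by rewrite mevalZ meval_bimonomial; ring.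
Qed.

(** The trace of a form of degree d has bidegree (d, d). Lagrange interpolation in x deals with the
    lines x = a j; what stays free is the product of all x - a j times a form of bidegree (d - t,
    d), and this corrects the values at the points. *)
Lemma quadric_trace d t (a : 'I_t -> K) I (xy : I -> K * K)
    (G : 'I_t -> {poly K}) (c : I -> K) :
  injective a -> (t <= d.+1)%N -> (forall i j, (xy i).1 != a j) ->
  (forall j, (size (G j) <= d.+1)%N) ->
  solvable_on (@anymx K (d.+1 - t) d.+1) (fun i M => bieval (xy i) M) ->
  exists h, [/\ h \is d.-homog, forall j s, h.@[qr (a j) s] = (G j).[s]
    & forall i, h.@[qr (xy i).1 (xy i).2] = c i].
Proof.
move=> ia td off sG sol.
pose l j := \prod_(k | k != j) ('X - (a k)%:P).
pose L := \prod_k ('X - (a k)%:P).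
have sL : size L = t.+1.
  by rewrite /L -big_enum size_prod_XsubC size_enum_ord.
have sl j : (size (l j) <= d.+1)%N.
  have ln0 : l j != 0 by apply/prodf_neq0 => k _; rewrite polyXsubC_eq0.
  move: sL; rewrite /L (bigD1 j) //= size_monicM ?monicXsubC // size_XsubC /=.
  by change ((size (l j)).+1 = t.+1 -> (size (l j) <= d.+1)%N); case=> ->.
have lj j k : (l j).[a k] = (j == k)%:R * (l j).[a j].
  have [->|ne] := eqVneq j k; first by rewrite mul1r.
  rewrite mul0r /l horner_prod (bigD1 k) /=; last by rewrite eq_sym.
  by rewrite !hornerE subrr mul0r.
have l0 j : (l j).[a j] != 0.
  rewrite /l horner_prod; apply/prodf_neq0 => k ne.
  by rewrite !hornerE subr_eq0 (inj_eq ia) eq_sym.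
have La j : L.[a j] = 0.
  by rewrite /L horner_prod (bigD1 j) //= !hornerE subrr mul0r.
have L0 i : L.[(xy i).1] != 0.
  by rewrite /L horner_prod; apply/prodf_neq0 => k _; rewrite !hornerE subr_eq0.
pose h1 := \sum_j biform d ((l j).[a j]^-1 *: l j) (G j).
have sl' j : (size ((l j).[a j]^-1 *: l j) <= d.+1)%N.
  exact: leq_trans (size_scale_leq _ _) (sl j).
have e1 x y : h1.@[qr x y] = \sum_j (l j).[a j]^-1 * (l j).[x] * (G j).[y].
  rewrite raddf_sum; apply: eq_bigr => j _ /=.
  by rewrite meval_biform // hornerZ.
have [M [_ hM]] := sol (fun i => (c i - h1.@[qr (xy i).1 (xy i).2]) / L.[(xy i).1]).
pose h2 := \sum_i \sum_j M i j *: biform d (L * 'X^i) ('X^j).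
have e2 x y : h2.@[qr x y] = L.[x] * bieval (x, y) M.
  rewrite raddf_sum /bieval mulr_sumr; apply: eq_bigr => i _ /=.
  rewrite raddf_sum mulr_sumr; apply: eq_bigr => j _ /=.
  rewrite mevalZ meval_biform ?size_polyXn ?ltn_ord //.
    by rewrite hornerM !hornerXn; ring.
  apply: leq_trans (size_polyMleq _ _) _; rewrite sL size_polyXn /=.
  by have := ltn_ord i; lia.
exists (h1 + h2); split=> [|j s|i]; rewrite ?mevalD ?e1 ?e2.
- apply: rpredD; first by apply: rpred_sum => j _; exact: biform_homog.
  apply: rpred_sum => i _; apply: rpred_sum => j _; apply: dhomogZ.
  exact: biform_homog.
- rewrite La mul0r addr0 (bigD1 j) //= mulVf // mul1r big1 ?addr0 // => k ne.
  by rewrite (lj k j) (negPf ne) mul0r mulr0 mul0r.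
- have := hM i; rewrite -surjective_pairing => ->.
  by rewrite -e1 mulrC divfK // addrC subrK.
Qed.

(* The binary form of which G is the dehomogenization at (1, 0), (0, 1) is
   dehomogenized at (1, 0), (1, 1) instead. *)
Lemma reparametrize d (G : {poly K}) : (size G <= d.+1)%N ->
  exists g : {poly K}, (size g <= d.+1)%N /\
    forall s, 1 + s != 0 -> (1 + s) ^+ d * g.[s / (1 + s)] = G.[s].
Proof.
move=> sG; exists (\sum_(k < d.+1) G`_k *: ('X^k * (1 - 'X) ^+ (d - k))); split.
  apply: (leq_trans (size_sum _ _ _)); apply/bigmax_leqP => k _.
  apply: (leq_trans (size_scale_leq _ _)).
  apply: (leq_trans (size_polyMleq _ _)); rewrite size_polyXn /=.
  have s1 : (size (1 - 'X : {poly K})%R <= 2)%N.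
    by rewrite (leq_trans (size_polyD _ _)) // size_polyN size_polyX size_poly1.
  apply: (leq_trans (leq_add (leqnn _) (size_poly_exp_leq _ _))).
  have := ltn_ord k; move: s1; case: (size _) => [|[|[|//]]] _ /= hk;
    rewrite ?mul0n ?mul1n; lia.
move=> s ns; rewrite horner_sum mulr_sumr (horner_coef_wide _ sG).
apply: eq_bigr => k _; rewrite hornerZ hornerM !horner_exp hornerD hornerN !hornerX hornerC.
have -> : 1 - s / (1 + s) = (1 + s)^-1 by field.
have -> : (1 + s) ^+ d = (1 + s) ^+ k * (1 + s) ^+ (d - k).
  by rewrite -exprD subnKC // -ltnS.
rewrite exprMn !exprVn mulrCA; congr (_ * _).
move: (expf_neq0 k ns) (expf_neq0 (d - k) ns).
move: ((1 + s) ^+ k) ((1 + s) ^+ (d - k)) (s ^+ k) => A B C hA hB.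
by field; rewrite ?hA ?hB.
Qed.

(** Values on a line x = a are prescribed in the coordinate y, whereas [lf] uses the parameter
    attached to two points of the line; the two differ by the projective change of variable of
    [reparametrize]. *)
Lemma lf_xline_at d (a e : K) (G : {poly K}) : (size G <= d.+1)%N ->
  exists g : {poly K}, (size g <= d.+1)%N /\
    forall h, h \is d.-homog -> (forall s, h.@[qr a s] = g.[s]) ->
    lf (qr a e) (qr a (e + 1)) h = G.
Proof.
move=> sG; have [g [sg hg]] := reparametrize sG; exists (g \Po ('X - e%:P)); split.
  by apply: leq_trans (size_comp_poly_leq _ _) _; rewrite size_XsubC muln1; lia.
move=> h hh eh; apply: (@poly_ext_off _ _ _ (1 + 'X)) => [|s].
  apply/eqP => /(congr1 (fun p : {poly K} => p.[0])).
  by rewrite hornerD hornerX hornerC horner0 addr0 => /eqP; rewrite oner_eq0.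
rewrite hornerD hornerX hornerC => ns.
have -> : (lf (qr a e) (qr a (e + 1)) h).[s] =
    h.@[fun i => (1 + s) * qr a (e + s / (1 + s)) i].
  rewrite lf_horner; congr (h.@[_]); apply: funext.
  by case=> [[|[|[|[|//]]]] lt]; rewrite /qr /=; field.
rewrite (meval_homogZ _ _ hh) eh horner_comp hornerXsubC addrAC subrr add0r.
exact: hg.
Qed.

Lemma lf_xline d (a : K) (G : {poly K}) : (size G <= d.+1)%N ->
  exists g : {poly K}, (size g <= d.+1)%N /\
    forall h, h \is d.-homog -> (forall s, h.@[qr a s] = g.[s]) ->
    lf (qr a 0) (qr a 1) h = G.
Proof.
by move=> sG; have := lf_xline_at a 0 sG; rewrite add0r.
Qed.

(* Pairs of points of the quadric span lines; the second index of p selects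
   the endpoint and the last one the coordinate. *)
Definition qpt (J : Type) (p : J * bool * bool -> K) (jb : J * bool) : K * K :=
  (p (jb, false), p (jb, true)).

Definition qvec (xy : K * K) : 'I_4 -> K := qr xy.1 xy.2.

Definition qlines_solvable d (J I : Type) (p : J * bool * bool -> K)
    (pts : I -> K * K) :=
  config_solvable d (fun j => qvec (qpt p (j, false)))
    (fun j => qvec (qpt p (j, true))) (fun i => qvec (pts i)).

Lemma qlines_solvableP d (J I : Type) (p : J * bool * bool -> K)
    (pts : I -> K * K) :
  qlines_solvable d p pts <-> forall (G : J -> {poly K}) (c : I -> K),
    (forall j, (size (G j) <= d.+1)%N) ->
    exists f, [/\ f \is d.-homog,
      forall j, lf (qvec (qpt p (j, false))) (qvec (qpt p (j, true))) f = G j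
      & forall i, f.@[qvec (pts i)] = c i].
Proof. exact: config_solvableP. Qed.

Lemma poly_along_qvec T (x y : (T -> K) -> K) l : poly_along x -> poly_along y ->
  poly_along (fun p => qvec (x p, y p) l).
Proof.
move=> hx hy; case: l => [[|[|[|[|//]]]] lt]; rewrite /qvec /qr /=.
- exact: poly_along_const.
- exact: hx.
- exact: hy.
- exact: poly_alongM.
Qed.

Lemma qlines_open_along d T (J I : finType) (q : (T -> K) -> J * bool * bool -> K)
    (pts : I -> K * K) :
  (forall jbb, poly_along (fun p => q p jbb)) ->
  line_open (fun p => qlines_solvable d (q p) pts).
Proof.
move=> hq; apply: config_open => i l; last exact: poly_along_const.
  by apply: poly_along_qvec.
by apply: poly_along_qvec.
Qed.

Lemma qlines_open d (J I : finType) (pts : I -> K * K) :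
  line_open (fun p : J * bool * bool -> K => qlines_solvable d p pts).
Proof. by apply: qlines_open_along => jbb; exact: poly_along_coord. Qed.

End QuadricStep.

Section QuadricInduction.
Variable K : numFieldType.

Lemma functional_family_eq T (V : lmodType K) I
    (phi psi : (T -> K) -> I -> V -> K) :
  (forall p i f, phi p i f = psi p i f) ->
  functional_family phi -> functional_family psi.
Proof.
move=> e h p0 p1; have [F [lF eF]] := h p0 p1; exists F.
by split=> // s i f; rewrite -e eF.
Qed.

Lemma bieval_finite_points A B (I Y : finType) (phi : I -> 'M[K]_(A, B) -> K) :
  (forall i : I, scalar (phi i)) -> (#|I| + #|Y| <= A * B)%N ->
  solvable_on (@anymx K A B) phi -> exists xy : Y -> K * K,
  solvable_on (@anymx K A B) (fun s M =>
    match s with inl i => phi i M | inr j => bieval (xy j) M end).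
Proof.
move=> sphi le s; have [xy h] := bieval_points sphi le s.
exists (xy \o enum_rank); move: h.
apply: (@solvable_reindex _ _ _ _ _ _ _
  (fun s : I + Y => match s with inl i => inl i | inr y => inr (enum_rank y) end)
  (fun s : I + 'I_#|Y| => match s with inl i => inl i | inr y => inr (enum_val y) end)).
  by case=> // y; rewrite enum_rankK.
by case.
Qed.

Lemma qlines_cancel d (J J' I : Type) (p : J * bool * bool -> K) (pts : I -> K * K)
    (h : J' -> J) (h' : J -> option J') :
  pcancel h h' -> qlines_solvable d p pts ->
  qlines_solvable d (fun jbb => p (h jbb.1.1, jbb.1.2, jbb.2)) pts.
Proof.
move=> hK /qlines_solvableP s; apply/qlines_solvableP => G c sG.
have [|f [hf e1 e2]] := s (fun j => if h' j is Some j' then G j' else 0) c.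
  by move=> j; case: (h' j) => [j'|]; rewrite ?size_poly0.
by exists f; split=> // j; have := e1 (h j); rewrite hK.
Qed.

Lemma qlines_card d (J : finType) (I : Type) (p : J * bool * bool -> K)
    (pts : I -> K * K) k :
  (k <= #|J|)%N -> qlines_solvable d p pts ->
  exists p' : 'I_k * bool * bool -> K, qlines_solvable d p' pts.
Proof.
move=> le s; exists (fun jbb => p (enum_val (widen_ord le jbb.1.1), jbb.1.2, jbb.2)).
apply: (@qlines_cancel _ _ _ _ _ _ (fun i => enum_val (widen_ord le i))
  (fun j => insub (enum_rank j : nat))) s => i.
by rewrite enum_valK /= valK.
Qed.

Definition slope_gap (J : Type) (p : J * bool * bool -> K) j : K :=
  (p (j, false, false) - p (j, true, false)) * (p (j, false, true) - p (j, true, true)).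

Lemma slope_gap_open (J : finType) :
  line_open (fun p : J * bool * bool -> K => forall j, slope_gap p j != 0).
Proof.
apply: line_open_forall => j; apply: line_open_neq0; apply: poly_alongM;
  apply: poly_alongD; try apply: poly_alongN; exact: poly_along_coord.
Qed.

Lemma slope_gap_exists (J : Type) :
  exists p : J * bool * bool -> K, forall j, slope_gap p j != 0.
Proof.
exists (fun jbb : J * bool * bool => (jbb.1.2 : nat)%:R) => j.
by rewrite /slope_gap /= !sub0r mulrNN mulr1 oner_eq0.
Qed.

(** When [h] is right at both ends of a line, the extreme coefficients of the remaining error
    vanish, so the error is X times a polynomial of size at most d + 1. The quadric restricts to
    [slope_gap] times X, which makes [G'] the quotient. *)
Lemma add_quadric d (J : Type) (p : J * bool * bool -> K) (h : {mpoly K[4]})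
    (G : J -> {poly K}) :
  (forall j, slope_gap p j != 0) -> h \is d.+2.-homog ->
  (forall j, (size (G j) <= d.+3)%N) ->
  (forall j, h.@[qvec (qpt p (j, false))] = (G j)`_0) ->
  (forall j, h.@[qvec (qpt p (j, true))] = (G j)`_d.+2) ->
  exists G' : J -> {poly K}, (forall j, (size (G' j) <= d.+1)%N) /\
    forall g, (forall j, lf (qvec (qpt p (j, false))) (qvec (qpt p (j, true))) g = G' j) ->
    forall j, lf (qvec (qpt p (j, false))) (qvec (qpt p (j, true))) (quadric K * g + h) = G j.
Proof.
move=> gap hh sG h0 h1.
pose r j := G j - lf (qvec (qpt p (j, false))) (qvec (qpt p (j, true))) h.
exists (fun j => (slope_gap p j)^-1 *: \poly_(i < d.+1) (r j)`_i.+1); split.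
  by move=> j; apply: leq_trans (size_scale_leq _ _) (size_poly _ _).
move=> g hg j; rewrite rmorphD rmorphM /= hg lf_quadric -/(slope_gap p j).
rewrite -scalerAl -scalerAr scalerA mulfV // scale1r.
rewrite -[RHS](subrK (lf (qvec (qpt p (j, false))) (qvec (qpt p (j, true))) h)).
congr (_ + _); rewrite -/(r j).
apply/polyP => i; rewrite coefXM; case: i => [|i] /=.
  by rewrite coefB lf_coef0 h0 subrr.
rewrite coef_poly; case: ltnP => // le.
move: le; rewrite leq_eqVlt => /orP [/eqP <-|lt].
  by rewrite coefB (lf_coef_top _ _ hh) h1 subrr.
rewrite nth_default // (leq_trans (size_polyD _ _)) // geq_max size_polyN.
by rewrite (leq_trans (sG j)) ?(leq_trans (size_lf _ _ hh)).
Qed.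

(** The residual problem sees only the k transversal lines, in degree d. On the quadric each of
    these leaves its two endpoints, whence the term k * 2, and the t lines of the ruling use up
    degree t in x. The last clause records that the ruling lines start on y = 0, as the degree 4
    case requires. *)
Lemma quadric_step d k t (I : finType) (pts : I -> K * K) :
  (exists p : 'I_k * bool * bool -> K, qlines_solvable d p (of_void (K * K))) ->
  (t <= d.+3)%N ->
  solvable_on (@anymx K (d.+3 - t) d.+3) (fun i M => bieval (pts i) M) ->
  (#|I| + k * 2 <= (d.+3 - t) * d.+3)%N ->
  exists p : ('I_k + 'I_t) * bool * bool -> K, qlines_solvable d.+2 p pts /\
    forall j b, p (inr j, b, true) = (b : nat)%:R.
Proof.
move=> ex1 td sI card.
pose C3 (p : 'I_k * bool * bool -> K) :=
  solvable_on (@anymx K (d.+3 - t) d.+3) (fun (s : I + ('I_k * bool)) M =>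
    match s with inl i => bieval (pts i) M | inr jb => bieval (qpt p jb) M end).
have o3 : line_open C3.
  apply: line_open_solvable; first by split.
  apply: functional_family_sum.
    apply: (functional_family_eq _ (@bieval_family K (d.+3 - t) d.+3 _ I
      (fun _ i => (pts i).1) (fun _ i => (pts i).2)
      (fun i => poly_along_const _) (fun i => poly_along_const _))).
    by move=> p i M; rewrite -surjective_pairing.
  apply: (@bieval_family K _ _ _ _ (fun p jb => p (jb, false)) (fun p jb => p (jb, true)));
    by move=> i; exact: poly_along_coord.
(* Residual problem, transversality and trace are solved at unrelated positions; openness gives a
   position good for all three. *)
have [p [[p1 p2] p3]] : exists p : 'I_k * bool * bool -> K,
    (qlines_solvable d p (of_void (K * K)) /\ forall j, slope_gap p j != 0) /\ C3 p.
  apply: line_open_meet => //.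
  - by apply: line_openI; [exact: qlines_open|exact: slope_gap_open].
  - by apply: line_open_meet => //;
      [exact: qlines_open|exact: slope_gap_open|exact: slope_gap_exists].
  have [|xy h] := @bieval_finite_points (d.+3 - t) d.+3 I ('I_k * bool)%type _
      (fun i => @bieval_scalar K _ _ (pts i)) _ sI.
    by rewrite card_prod card_ord card_bool.
  exists (fun jbb => if jbb.2 then (xy jbb.1).2 else (xy jbb.1).1).
  move=> c.
  have [M [M1 hM]] := h c; exists M; split; first by [].
  case=> [i|jb]; first exact: (hM (inl i)).
  by have := hM (inr jb); rewrite /qpt /= -surjective_pairing.
have [a [ia ha]] := exists_fresh ([seq (pts i).1 | i <- enum I]
  ++ [seq (qpt p jb).1 | jb <- enum {: 'I_k * bool}]) t.
exists (fun sbb : ('I_k + 'I_t) * bool * bool => match sbb.1.1 with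
  | inl j => p (j, sbb.1.2, sbb.2)
  | inr j => if sbb.2 then (sbb.1.2 : nat)%:R else a j end).
split; last by [].
apply/qlines_solvableP => G c sG.
have [g hg] := boolp.choice (fun j => lf_xline (a j) (sG (inr j))).
pose xy (s : I + ('I_k * bool)) :=
  match s with inl i => pts i | inr jb => qpt p jb end.
have [|||h [hh h1 h2]] := @quadric_trace K d.+2 t a _ xy g (fun s => match s with
  | inl i => c i | inr (j, b) => (G (inl j))`_(if b then d.+2 else 0%N) end) ia td.
- move=> s j; apply: contraNneq (ha j) => <-; rewrite mem_cat.
  case: s => [i|jb] /=; first by apply/orP; left; apply/mapP; exists i; rewrite ?mem_enum.
  by apply/orP; right; apply/mapP; exists jb; rewrite ?mem_enum.
- by move=> j; case: (hg j).
- move=> c'; have [M [M1 hM]] := p3 c'; exists M; split; first by [].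
  by move=> s; rewrite -hM; case: s.
have [|||G' [sG' hG']] := add_quadric (G := fun j => G (inl j)) p2 hh.
- by move=> j; exact: sG.
- by move=> j; exact: (h2 (inr (j, false))).
- by move=> j; exact: (h2 (inr (j, true))).
move/qlines_solvableP: p1 => /(_ G' (of_void _) sG') [q [hq q1 _]].
exists (quadric K * q + h); split=> [|[j|j]|i].
- apply: rpredD => //; rewrite -[d.+2]/(2 + d)%N.
  by apply: dhomogM => //; exact: quadric_homog.
- exact: hG'.
- have := (hg j).2 (quadric K * q + h); apply.
    apply: rpredD => //; rewrite -[d.+2]/(2 + d)%N.
    by apply: dhomogM => //; exact: quadric_homog.
  by move=> s; rewrite mevalD mevalM quadric_qr mul0r add0r h1.
- by rewrite mevalD mevalM quadric_qr mul0r add0r (h2 (inl i)).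
Qed.

Definition qlines d k :=
  exists p : 'I_k * bool * bool -> K, qlines_solvable d p (of_void (K * K)).

Lemma qlines_leq d k k' : (k' <= k)%N -> qlines d k -> qlines d k'.
Proof. by move=> le [p hp]; apply: qlines_card hp; rewrite card_ord. Qed.

Lemma qlines_step d k t :
  qlines d k -> (t <= d.+3)%N -> (k * 2 <= (d.+3 - t) * d.+3)%N ->
  qlines d.+2 (k + t).
Proof.
move=> h td le; have [||p [hp _]] := quadric_step h td (pts := of_void (K * K)).
- by move=> c; exists 0; split=> // -[].
- by rewrite card_void.
by apply: qlines_card hp; rewrite card_sum !card_ord.
Qed.

End QuadricInduction.

(** * Grids of lines on the quadric and their deformation *)

Section GridStep.
Variable K : numFieldType.

Lemma poly_eq_on (p q : {poly K}) n (r : seq K) :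
  (size p <= n)%N -> (size q <= n)%N -> uniq r -> (n <= size r)%N ->
  (forall x, x \in r -> p.[x] = q.[x]) -> p = q.
Proof.
move=> sp sq ur nr e; apply/eqP; rewrite -subr_eq0; apply/negPn/negP => ne.
have : (size r < size (p - q)%R)%N.
  apply: max_poly_roots => //; apply/allP => x xr.
  by rewrite rootE !hornerE e // subrr.
rewrite ltnNge (leq_trans _ nr) // (leq_trans (size_polyD _ _)) //.
by rewrite geq_max size_polyN sp.
Qed.

Lemma lagrange_basis t (a : 'I_t -> K) : injective a ->
  exists l : 'I_t -> {poly K}, (forall j, (size (l j) <= t)%N) /\
    forall j k, (l j).[a k] = (j == k)%:R.
Proof.
move=> ia; pose l j := \prod_(k | k != j) ('X - (a k)%:P).
have l0 j : (l j).[a j] != 0.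
  rewrite /l horner_prod; apply/prodf_neq0 => k ne.
  by rewrite !hornerE subr_eq0 (inj_eq ia) eq_sym.
exists (fun j => (l j).[a j]^-1 *: l j); split=> [j|j k].
  apply: leq_trans (size_scale_leq _ _) _.
  have ln0 : l j != 0 by apply/prodf_neq0 => k _; rewrite polyXsubC_eq0.
  have : size (\prod_k ('X - (a k)%:P)) = t.+1.
    by rewrite -big_enum size_prod_XsubC size_enum_ord.
  rewrite (bigD1 j) //= size_monicM ?monicXsubC // size_XsubC /=.
  by change ((size (l j)).+1 = t.+1 -> (size (l j) <= t)%N); case=> ->.
rewrite hornerZ; have [->|ne] := eqVneq j k; first by rewrite mulVf.
have -> : (l j).[a k] = 0; last by rewrite mulr0.
rewrite /l horner_prod (bigD1 k) /=; last by rewrite eq_sym.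
by rewrite hornerXsubC subrr mul0r.
Qed.

Lemma outer_matrix m1 m2 (P G : {poly K}) : (size P <= m1)%N -> (size G <= m2)%N ->
  exists M : 'M[K]_(m1, m2), forall xy, bieval xy M = P.[xy.1] * G.[xy.2].
Proof.
move=> sP sG; exists (\matrix_(i, j) (P`_i * G`_j)) => xy.
rewrite (horner_coef_wide _ sP) (horner_coef_wide _ sG) mulr_suml.
apply: eq_bigr => i _; rewrite mulr_sumr; apply: eq_bigr => j _.
by rewrite mxE; ring.
Qed.

Lemma bievalD m1 m2 xy (M M' : 'M[K]_(m1, m2)) :
  bieval xy (M + M') = bieval xy M + bieval xy M'.
Proof. by have := bieval_scalar xy 1 M M'; rewrite scale1r mul1r. Qed.

Lemma bieval_sum m1 m2 xy (J : finType) (c : J -> K) (M : J -> 'M[K]_(m1, m2)) :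
  bieval xy (\sum_j c j *: M j) = \sum_j c j * bieval xy (M j).
Proof. exact: scalar_sum (bieval_scalar xy). Qed.

Lemma grid_solvable A B m1 m2 (a : 'I_A -> K) (b : 'I_B -> K) :
  injective a -> injective b -> (A <= m1)%N -> (B <= m2)%N ->
  solvable_on (@anymx K m1 m2) (fun (ij : 'I_A * 'I_B) M => bieval (a ij.1, b ij.2) M).
Proof.
move=> ia ib l1 l2 c.
have [la [sa ea]] := lagrange_basis ia; have [lb [sb eb]] := lagrange_basis ib.
have [M hM] := boolp.choice (fun ij : 'I_A * 'I_B =>
  outer_matrix (leq_trans (sa ij.1) l1) (leq_trans (sb ij.2) l2)).
exists (\sum_ij c ij *: M ij); split=> // -[i j].
rewrite bieval_sum (bigD1 (i, j)) //= hM /= ea eb !eqxx !mulr1 big1 ?addr0 //.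
move=> -[i' j'] /=; rewrite -pair_eqE /pair_eq hM /= ea eb => /nandP [] /negPf ->.
  by rewrite mul0r mulr0.
by rewrite !mulr0.
Qed.

(** The grid is fitted first. The other points are then corrected by multiples of the product of the
    y - b j, which vanish on the grid and leave m2 - B coefficients in y. *)
Lemma grid_points_solvable B m1 m2 (a : 'I_m1 -> K) (b : 'I_B -> K)
    (I : Type) (xy : I -> K * K) :
  injective a -> injective b -> (B <= m2)%N -> (forall i j, (xy i).2 != b j) ->
  solvable_on (@anymx K m1 (m2 - B)) (fun i M => bieval (xy i) M) ->
  solvable_on (@anymx K m1 m2) (fun (s : 'I_m1 * 'I_B + I) M =>
    match s with inl ij => bieval (a ij.1, b ij.2) M | inr i => bieval (xy i) M end).
Proof.
move=> ia ib l2 off sI c.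
have [M1 [_ h1]] := grid_solvable ia ib (leqnn _) l2 (c \o inl).
pose L := \prod_j ('X - (b j)%:P).
have sL : size L = B.+1 by rewrite /L -big_enum size_prod_XsubC size_enum_ord.
have L0 i : L.[(xy i).2] != 0.
  by rewrite horner_prod; apply/prodf_neq0 => j _; rewrite !hornerE subr_eq0.
have Lb j : L.[b j] = 0 by rewrite horner_prod (bigD1 j) //= !hornerE subrr mul0r.
have [M2 [t2 h2]] := sI (fun i => (c (inr i) - bieval (xy i) M1) / L.[(xy i).2]).
have s1 (i : 'I_m1) : (size ('X^i : {poly K}) <= m1)%N by rewrite size_polyXn.
have s2 (j : 'I_(m2 - B)) : (size (L * 'X^j)%R <= m2)%N.
  apply: leq_trans (size_polyMleq _ _) _; rewrite sL size_polyXn /=.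
  by have := ltn_ord j; lia.
have [N hN] := boolp.choice (fun ij : 'I_m1 * 'I_(m2 - B) =>
  outer_matrix (s1 ij.1) (s2 ij.2)).
pose M3 := \sum_ij M2 ij.1 ij.2 *: N ij.
have e3 p : bieval p M3 = L.[p.2] * bieval p M2.
  rewrite bieval_sum /bieval pair_big /= mulr_sumr; apply: eq_bigr => -[i j] _ /=.
  by rewrite -/(bieval p _) hN hornerM !hornerXn; ring.
exists (M1 + M3); split=> // -[ij|i]; rewrite bievalD e3 /=.
  by rewrite Lb mul0r addr0 h1.
by rewrite h2 mulrC divfK // addrC subrK.
Qed.

(** A line y = b is tilted into the line from [qr 0 b] to [qr 1 (b + s)]; its point over x then
    moves by s x times this vector. *)
Definition normal_dir : 'I_4 -> K := fun i => [:: 0; 0; 1; 1]`_i.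
Definition xline_dir (a : K) : 'I_4 -> K := fun i => [:: 0; 0; 1; a]`_i.

Lemma lf_quadric_normal a b :
  lf (qr a b) (fun i => a * normal_dir i) (quadric K) = (a * (1 - a)) *: 'X.
Proof.
by apply: poly_ext => s; rewrite lf_horner meval_quadric /qr /normal_dir /= hornerZ hornerX; ring.
Qed.

Lemma meval_xline (a s : K) (f : {mpoly K[4]}) :
  (lf (qr a 0) (xline_dir a) f).[s] = f.@[qr a s].
Proof.
rewrite lf_horner; congr (f.@[_]); apply: funext.
by case=> [[|[|[|[|//]]]] lt]; rewrite /qr /xline_dir /=; ring.
Qed.

Lemma meval_tilted (b s x : K) d (f : {mpoly K[4]}) : f \is d.-homog -> 1 - x != 0 ->
  (lf (qr x b) (fun i => x * normal_dir i) f).[s] =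
  (1 - x) ^+ d * (lf (qr 0 b) (qr 1 (b + s)) f).[x / (1 - x)].
Proof.
move=> hf nx; rewrite !lf_horner -(meval_homogZ _ _ hf); congr (f.@[_]).
apply: funext.
by case=> [[|[|[|[|//]]]] lt]; rewrite /qr /normal_dir /=; field.
Qed.

End GridStep.

Section GridDegeneration.
Variable K : numFieldType.

(* A lines x = a and B lines y = b on the quadric meet in A B points; moving the
   lines y = b off the quadric, each crossing leaves in the limit a simple
   point on the residual scheme. *)
Lemma grid_step d k A B (a : 'I_A -> K) (b : 'I_B -> K) :
  injective a -> injective b -> (forall i, a i != 0) -> (forall i, 1 - a i != 0) ->
  (A <= d.+3)%N -> (B <= d.+3)%N ->
  (exists p : 'I_k * bool * bool -> K,
     qlines_solvable d p (fun ij : 'I_A * 'I_B => (a ij.1, b ij.2))) ->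
  (k * 2 <= (d.+3 - A) * (d.+3 - B))%N -> qlines K d.+2 (k + A + B).
Proof.
move=> ia ib a0 a1 Ad Bd ex1 card.
pose gr (ij : 'I_A * 'I_B) := (a ij.1, b ij.2).
pose C3 (p : 'I_k * bool * bool -> K) :=
  solvable_on (@anymx K (d.+3 - A) (d.+3 - B)) (fun jb M => bieval (qpt p jb) M).
pose C4 (p : 'I_k * bool * bool -> K) := forall jb,
  (forall i, (qpt p jb).1 - a i != 0) /\ (forall i, (qpt p jb).2 - b i != 0).
have o3 : line_open C3.
  apply: line_open_solvable; first by split.
  apply: (@bieval_family K _ _ _ _ (fun p jb => p (jb, false)) (fun p jb => p (jb, true)));
    by move=> i; exact: poly_along_coord.
have o4 : line_open C4.
  apply: line_open_forall => jb; apply: line_openI; apply: line_open_forall => i;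
  apply: line_open_neq0; (apply: poly_alongD; last exact: poly_along_const);
  exact: poly_along_coord.
have [p [[[p1 p2] p3] p4]] : exists p : 'I_k * bool * bool -> K,
    ((qlines_solvable d p gr /\ forall j, slope_gap p j != 0) /\ C3 p) /\ C4 p.
  have o1 := @qlines_open K d 'I_k ('I_A * 'I_B)%type gr.
  have o2 := @slope_gap_open K 'I_k.
  apply: line_open_meet => //; first by do 2![apply: line_openI => //].
    apply: line_open_meet => //; first exact: line_openI.
      by apply: line_open_meet => //; exact: slope_gap_exists.
    have [|||xy h] := @bieval_finite_points K (d.+3 - A) (d.+3 - B) void ('I_k * bool)%type
        (fun v => match v with end).
    - by case.
    - by rewrite card_void card_prod card_ord card_bool.
    - by move=> c; exists 0; split=> // -[].
    exists (fun jbb => if jbb.2 then (xy jbb.1).2 else (xy jbb.1).1) => c.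
    have [M [M1 hM]] := h (fun s => match s with inl v => match v with end | inr i => c i end).
    exists M; split; first by [].
    by move=> jb; rewrite -[RHS](hM (inr jb)) /qpt /= -surjective_pairing.
  have [f [_ hf]] := exists_fresh (codom a ++ codom b) 1.
  exists (fun _ => f ord0) => jb; split=> i; rewrite subr_eq0 /qpt /=;
    apply: contraNneq (hf ord0) => ->; rewrite mem_cat codom_f ?orbT //.
(* The values [a] and [xi] together give the d + 3 points on which each tilted line is tested. *)
have [xi [ixi hxi]] := exists_fresh (1 :: codom a) (d.+3 - A).
have xia i j : xi i != a j.
  by apply: contraNneq (hxi i) => ->; rewrite inE codom_f orbT.
have xi1 i : 1 - xi i != 0.
  rewrite subr_eq0 eq_sym; apply: contraNneq (hxi i) => ->; exact: mem_head.
pose idx := ((('I_k * 'I_d.+3) + ('I_A * 'I_d.+3)) +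
  (('I_(d.+3 - A) * 'I_B) + ('I_A * 'I_B)))%type.
(* At a crossing the value for s = 0 is already fixed by the line x = a i, so the last block uses
   the difference quotient in s, with [drop_poly 1] as division by s. Its limit contains the
   residual form with the factor a (1 - a), hence the hypotheses that a and 1 - a be nonzero. *)
pose Phi (s : idx) (f : {mpoly K[4]}) : {poly K} := match s with
  | inl (inl jk) => ((lf (qvec (qpt p (jk.1, false))) (qvec (qpt p (jk.1, true))) f)`_jk.2)%:P
  | inl (inr jk) => ((lf (qr (a jk.1) 0) (xline_dir (a jk.1)) f)`_jk.2)%:P
  | inr (inl ij) => lf (qr (xi ij.1) (b ij.2)) (fun l => xi ij.1 * normal_dir K l) f
  | inr (inr ij) =>
      drop_poly 1 (lf (qr (a ij.1) (b ij.2)) (fun l => a ij.1 * normal_dir K l) f)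
  end.
have lPhi s : linear (Phi s).
  case: s => [[jk|jk]|[ij|ij]] c f g /=.
  - by rewrite lf_linear coefD coefZ polyCD polyCM mul_polyC.
  - by rewrite lf_linear coefD coefZ polyCD polyCM mul_polyC.
  - by rewrite lf_linear.
  - by rewrite lf_linear linearD linearZ.
have hQ g : g \is d.-homog -> quadric K * g \is d.+2.-homog.
  by move=> hg; rewrite -[d.+2]/(2 + d)%N; apply: dhomogM => //; exact: quadric_homog.
have s0 : solvable_on (@forms K 4 d.+2) (fun s f => (Phi s f).[0]).
  move=> c.
  pose gx i : {poly K} := \poly_(m < d.+3) c (inl (inr (i, inord m))).
  have gxe i (m : 'I_d.+3) : (gx i)`_m = c (inl (inr (i, m))).
    by rewrite coef_poly ltn_ord; congr (c (inl (inr (_, _)))); apply: val_inj; rewrite /= inordK.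
  pose gl j : {poly K} := \poly_(m < d.+3) c (inl (inl (j, inord m))).
  have gle j (m : 'I_d.+3) : (gl j)`_m = c (inl (inl (j, m))).
    by rewrite coef_poly ltn_ord; congr (c (inl (inl (_, _)))); apply: val_inj; rewrite /= inordK.
  pose pts (s : 'I_(d.+3 - A) * 'I_B + ('I_k * bool)) := match s with
    | inl ij => (xi ij.1, b ij.2) | inr jb => qpt p jb end.
  have [|||h [hh h1 h2]] := @quadric_trace K d.+2 A a _ pts gx (fun s => match s with
    | inl ij => c (inr (inl ij))
    | inr (j, e) => (gl j)`_(if e then d.+2 else 0%N) end) ia Ad.
  - case=> [ij|jb] j /=; first exact: xia.
    by have [h _] := p4 jb; rewrite -subr_eq0; exact: h.
  - by move=> i; exact: size_poly.
  - have := @grid_points_solvable K B (d.+3 - A) d.+3 xi b _ (qpt p) ixi ib Bd.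
    move=> h c'; have [||M [M1 hM]] := h _ _ c'; first by
      move=> jb j; have [_ h'] := p4 jb; rewrite -subr_eq0; exact: h'.
      exact: p3.
    by exists M; split; [by []|move=> s; rewrite -hM; case: s].
  have [|||G' [sG' hG']] := add_quadric (G := gl) p2 hh.
  - by move=> j; exact: size_poly.
  - by move=> j; exact: (h2 (inr (j, false))).
  - by move=> j; exact: (h2 (inr (j, true))).
  move/qlines_solvableP: p1 => /(_ G' (fun ij => (c (inr (inr ij)) -
      (lf (qr (a ij.1) (b ij.2)) (fun l => a ij.1 * normal_dir K l) h)`_1) /
      (a ij.1 * (1 - a ij.1))) sG') [g [hg q1 q2]].
  have onQ x y : (quadric K * g + h).@[qr x y] = h.@[qr x y].
    by rewrite mevalD mevalM quadric_qr mul0r add0r.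
  exists (quadric K * g + h); split; first by apply: rpredD => //; exact: hQ.
  case=> [[[j m]|[i m]]|[ij|ij]] /=.
  - by rewrite hornerC hG' // gle.
  - rewrite hornerC -gxe.
    have -> // : lf (qr (a i) 0) (xline_dir (a i)) (quadric K * g + h) = gx i.
    by apply: poly_ext => s; rewrite meval_xline onQ h1.
  - rewrite horner_coef0 lf_coef0 onQ; exact: (h2 (inl ij)).
  - rewrite horner_coef0 coef_drop_poly add0n rmorphD rmorphM /= lf_quadric_normal.
    rewrite coefD -scalerAl coefZ coefXM /= lf_coef0 (q2 ij) mulrC divfK ?subrK //.
    by rewrite mulf_neq0.
have [q [q0 hq]] := solvable_poly_open (@forms_subspace K 4 d.+2) lPhi s0.
(* Besides the roots of [q] the value 0 is avoided, because prescribed difference quotients are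
   divided by s. *)
have [s] : exists s, (q * 'X).[s] != 0.
  by apply: exists_nonroot; rewrite mulf_neq0 ?polyX_eq0.
rewrite hornerM hornerX mulf_eq0 negb_or => /andP [qs s1].
move/(_ s qs): hq => hq.
pose p' (jbb : ('I_k + 'I_A + 'I_B) * bool * bool) : K := match jbb.1.1 with
  | inl (inl j) => p (j, jbb.1.2, jbb.2)
  | inl (inr i) => if jbb.2 then (jbb.1.2 : nat)%:R else a i
  | inr j => if jbb.2 then b j + (jbb.1.2 : nat)%:R * s else (jbb.1.2 : nat)%:R end.
apply: (@qlines_card K _ _ _ p'); first by rewrite !card_sum !card_ord.
apply/qlines_solvableP => G c sG.
have [g hg] := boolp.choice (fun i => lf_xline (a i) (sG (inl (inr i)))).
pose v x j := (1 - x) ^+ d.+2 * (G (inr j)).[x / (1 - x)].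
have [f [hf ef]] := hq (fun e : idx => match e with
  | inl (inl jk) => (G (inl (inl jk.1)))`_jk.2
  | inl (inr ik) => (g ik.1)`_ik.2
  | inr (inl ij) => v (xi ij.1) ij.2
  | inr (inr ij) => (v (a ij.1) ij.2 - (g ij.1).[b ij.2]) / s end).
have fx i : lf (qr (a i) 0) (xline_dir (a i)) f = g i.
  apply/polyP => m; have [lt|le] := ltnP m d.+3.
    by have := ef (inl (inr (i, Ordinal lt))); rewrite /= hornerC.
  rewrite !nth_default // (leq_trans _ le) // ?(size_lf _ _ hf) //.
  by case: (hg i).
exists f; split=> // -[[j|i]|j].
- apply/polyP => m; have [lt|le] := ltnP m d.+3.
    by have := ef (inl (inl (j, Ordinal lt))); rewrite /= hornerC.
  by rewrite !nth_default // (leq_trans _ le) // (size_lf _ _ hf).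
- by apply: (hg i).2 => // y; rewrite -fx meval_xline.
have ax x : 1 - x != 0 ->
    (lf (qr x (b j)) (fun l => x * normal_dir K l) f).[s] = v x j ->
    (lf (qr 0 (b j)) (qr 1 (b j + s)) f).[x / (1 - x)] = (G (inr j)).[x / (1 - x)].
  by move=> nx; rewrite (meval_tilted _ _ hf nx) => /mulfI; apply; rewrite expf_neq0.
rewrite /qvec /qpt /p' /= mul0r mul1r addr0.
apply: (@poly_eq_on _ _ _ d.+3 [seq x / (1 - x) | x <- codom a ++ codom xi]).
- exact: size_lf.
- exact: sG.
- rewrite map_inj_in_uniq.
    have ua : uniq (codom a) by rewrite map_inj_uniq ?enum_uniq.
    have ux : uniq (codom xi) by rewrite map_inj_uniq ?enum_uniq.
    rewrite cat_uniq ua ux /= andbT.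
    by apply/hasPn => x /codomP [i ->]; apply/negP => /codomP [i' e];
      have := xia i i'; rewrite e eqxx.
  have mem x : x \in codom a ++ codom xi -> 1 - x != 0.
    by rewrite mem_cat => /orP [] /codomP [i ->].
  move=> x y /mem nx /mem ny /(congr1 (fun z => z * (1 - x) * (1 - y))).
  rewrite divfK // mulrAC divfK // => e.
  by apply/eqP; rewrite -subr_eq0; apply/eqP; rewrite -(subrr (x * (1 - y))) {2}e; ring.
- by rewrite size_map size_cat !size_codom !card_ord subnKC.
move=> y /mapP [x]; rewrite mem_cat => /orP [] /codomP [i ->] ->.
  apply: ax => //; have := ef (inr (inr (i, j))); rewrite /= => e.
  set P := lf _ _ f in e *.
  have -> : P = (P`_0)%:P + drop_poly 1 P * 'X.
    by rewrite -[LHS](poly_take_drop 1) expr1; congr (_ + _); apply/polyP => -[|m];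
      rewrite coef_take_poly coefC.
  rewrite hornerD hornerM hornerC hornerX e divfK // /P lf_coef0.
  by rewrite -meval_xline fx addrC subrK.
by apply: ax => //; exact: (ef (inr (inl (i, j)))).
Qed.

End GridDegeneration.

(** * The exceptional degree 4 in P^3 *)

Section SevenLines.
Variable K : numFieldType.

(** The points can be kept off y = 0: a nonzero polynomial in the second coordinate stays nonzero
    after multiplication by that coordinate. *)
Lemma bieval_points_off A B (I Y : finType) (phi : I -> 'M[K]_(A, B) -> K) :
  (forall i : I, scalar (phi i)) -> (#|I| + #|Y| <= A * B)%N ->
  solvable_on (@anymx K A B) phi -> exists xy : Y -> K * K,
  (forall y, (xy y).2 != 0) /\
  solvable_on (@anymx K A B) (fun s M =>
    match s with inl i => phi i M | inr j => bieval (xy j) M end).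
Proof.
move=> sphi le s; pose U := {xy : K * K | xy.2 != 0}.
have [||y h] := @solvable_points _ _ I ('I_A * 'I_B)%type U (@anymx K A B) phi
  (fun u => bieval (val u)) #|Y| (@anymx_subspace K A B) sphi
  (fun u => bieval_scalar (val u)) _ (@anymx_free K A B) _ s.
- move=> M M1 _ M0; have [[x y] hxy] := bieval_neq0 M1 M0.
  pose P := \sum_j (\sum_i M i j * x ^+ i) *: 'X^j : {poly K}.
  have eP z : P.[z] = bieval (x, z) M.
    rewrite /P horner_sum /bieval exchange_big; apply: eq_bigr => j _ /=.
    rewrite hornerZ hornerXn mulr_suml; apply: eq_bigr => i _.
    by rewrite mulrA.
  have [z] : exists z, (P * 'X).[z] != 0.
    apply: exists_nonroot; rewrite mulf_neq0 ?polyX_eq0 //.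
    by apply: contraNneq hxy => e; rewrite -eP e horner0.
  rewrite hornerM hornerX eP mulf_eq0 negb_or => /andP [h1 h2].
  by exists (exist _ (x, z) h2).
- by rewrite card_prod !card_ord.
exists (fun i => val (y (enum_rank i))); split; first by move=> i; exact: (valP (y _)).
move: h; apply: (@solvable_reindex _ _ _ _ _ _ _
  (fun s : I + Y => match s with inl i => inl i | inr y => inr (enum_rank y) end)
  (fun s : I + 'I_#|Y| => match s with inl i => inl i | inr y => inr (enum_val y) end)).
  by case=> // i; rewrite enum_rankK.
by case.
Qed.

Lemma lagrange_eval t (a : 'I_t -> K) (l : 'I_t -> {poly K}) (P : {poly K}) x :
  injective a -> (forall j, (size (l j) <= t)%N) ->
  (forall j k, (l j).[a k] = (j == k)%:R) -> (size P <= t)%N ->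
  P.[x] = \sum_j (l j).[x] * P.[a j].
Proof.
move=> ia sl el sP.
have {1}-> : P = \sum_j P.[a j] *: l j.
  apply: (@poly_eq_on _ _ _ t (codom a)) => //.
  - apply: leq_trans (size_sum _ _ _) _; apply/bigmax_leqP => j _.
    exact: leq_trans (size_scale_leq _ _) (sl j).
  - by rewrite map_inj_uniq ?enum_uniq.
  - by rewrite size_codom card_ord.
  move=> y /codomP [k ->]; rewrite horner_sum (bigD1 k) //= hornerZ el eqxx mulr1.
  rewrite big1 ?addr0 // => j ne; rewrite hornerZ el.
  by case: eqP ne => [->|_ _]; rewrite ?eqxx ?mulr0.
by rewrite horner_sum; apply: eq_bigr => j _; rewrite hornerZ mulrC.
Qed.

(** The line x = 0 is moved to the line from [qr 0 1] to [qr s 2]; its point over y moves by s (y -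
    1) times this vector. With base points y = 1 and y = 2 the factor (y - 1) (2 - y) is nonzero at
    y = 0. *)
Definition tilt_dir : 'I_4 -> K := fun i => [:: 0; 1; 0; 2]`_i.
Definition yline_dir : 'I_4 -> K := fun i => [:: 0; 1; 0; 0]`_i.

Lemma lf_quadric_tilt y : lf (qr 0 y) (fun i => (y - 1) * tilt_dir i) (quadric K) =
  ((y - 1) * (2 - y)) *: 'X.
Proof.
by apply: poly_ext => s; rewrite lf_horner meval_quadric /qr /tilt_dir /= hornerZ hornerX; ring.
Qed.

Lemma meval_tilt (y s : K) d (f : {mpoly K[4]}) : f \is d.-homog -> 2 - y != 0 ->
  (lf (qr 0 y) (fun i => (y - 1) * tilt_dir i) f).[s] =
  (2 - y) ^+ d * (lf (qr 0 1) (qr s 2) f).[(y - 1) / (2 - y)].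
Proof.
move=> hf ny; rewrite !lf_horner -(meval_homogZ _ _ hf); congr (f.@[_]).
apply: funext.
by case=> [[|[|[|[|//]]]] lt]; rewrite /qr /tilt_dir /=; field.
Qed.

Lemma meval_yline (x : K) (f : {mpoly K[4]}) :
  (lf (qr 0 0) yline_dir f).[x] = f.@[qr x 0].
Proof.
rewrite lf_horner; congr (f.@[_]); apply: funext.
by case=> [[|[|[|[|//]]]] lt]; rewrite /qr /yline_dir /=; ring.
Qed.

Local Notation J := ('I_1 + 'I_2)%type.

(* Two of the three transversal lines are constrained to start on y = 0. *)
Definition start_on_axis (p : J * bool * bool -> K) (jbb : J * bool * bool) : K :=
  if jbb is (inr _, false, true) then 0 else p jbb.

Lemma start_on_axis_poly jbb : poly_along (fun p => start_on_axis p jbb).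
Proof.
case: jbb => [[[i|j] [] []]] /=; try exact: poly_along_coord.
exact: poly_along_const.
Qed.

Definition axis_point (u : 'I_1 * 'I_1) : K * K := (0, 0).

(* The trace on the quadric, after removal of three lines x = a j. *)
Definition seven_lines_trace (z : 'I_4 -> K) (p : J * bool * bool -> K) :=
  solvable_on (@anymx K 2 5) (fun (s : J * bool + 'I_4) M =>
    match s with
    | inl jb => bieval (qpt (start_on_axis p) jb) M
    | inr c => bieval (0, z c) M
    end).

(** The two starting points lie on y = 0, which splits off as a factor. The other eight points, four
    on x = 0 and four general ones, fill the remaining space of dimension 2 times 4. *)
Lemma seven_lines_trace_exists (z : 'I_4 -> K) : injective z -> (forall c, z c != 0) ->
  exists p, seven_lines_trace z p.
Proof.
move=> iz z0.
have i1 : injective (fun _ : 'I_1 => 0 : K) by move=> i j _; rewrite !ord1.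
have [|xy [xy0 hxy]] := @bieval_points_off 2 4 ('I_1 * 'I_4)%type
    ('I_1 * bool + 'I_2)%type _ (fun ij => @bieval_scalar K _ _ (0, z ij.2)) _
    (@grid_solvable K 1 4 2 4 _ _ i1 iz isT isT).
  by rewrite !card_prod card_sum card_prod !card_ord card_bool.
have [a [ia _]] := @exists_fresh K [::] 2.
pose pts (s : 'I_1 * 'I_4 + ('I_1 * bool + 'I_2)) :=
  match s with inl ij => (0, z ij.2) | inr o => xy o end.
have off i (j : 'I_1) : (pts i).2 != 0.
  by case: i => [ij|o]; [exact: z0|exact: xy0].
have solp : solvable_on (@anymx K 2 (5 - 1)) (fun i M => bieval (pts i) M).
  by move=> c; have [M [M1 hM]] := hxy c; exists M; split; [by []|move=> s; rewrite -hM; case: s].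
have h := @grid_points_solvable K 1 2 5 a (fun _ => 0) _ pts ia i1 isT off solp.
exists (fun jbb => match jbb with
  | (inl i, b, e) => if e then (xy (inl (i, b))).2 else (xy (inl (i, b))).1
  | (inr j, true, e) => if e then (xy (inr j)).2 else (xy (inr j)).1
  | (inr j, false, e) => a j end).
move: h; apply: (@solvable_reindex _ _ _ _ _ _ _
  (fun s : J * bool + 'I_4 => match s with
   | inl (inl i, b) => inr (inr (inl (i, b)))
   | inl (inr j, true) => inr (inr (inr j))
   | inl (inr j, false) => inl (j, ord0)
   | inr c => inr (inl (ord0, c)) end)
  (fun s => match s with
   | inr (inr (inl ib)) => inl (inl ib.1, ib.2)
   | inr (inr (inr j)) => inl (inr j, true)
   | inl jo => inl (inr jo.1, false)
   | inr (inl oc) => inr oc.2 end)).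
  by case=> [[[i|j] []]|c].
by case=> [[[i|j] []]|c] M _ //=; rewrite /qpt /= -surjective_pairing.
Qed.

(* One of the five conditions of the last line x = 0 is already satisfied by
   the sections of the trace: they have degree 4 on y = 0 and vanish at five of
   its points.  When that line leaves the quadric, this condition passes to the
   residual scheme. *)
Lemma seven_lines : qlines K 4 7.
Proof.
have [z [iz hz]] := @exists_fresh K [:: 0; 2] 4.
have z0 c : z c != 0 by apply: contraNneq (hz c) => ->; rewrite !inE eqxx.
have z2 c : 2 - z c != 0.
  by rewrite subr_eq0; apply: contraNneq (hz c) => <-; rewrite !inE eqxx orbT.
pose D1 (p : J * bool * bool -> K) := qlines_solvable 2 (start_on_axis p) axis_point.
pose D2 (p : J * bool * bool -> K) := forall j, slope_gap (start_on_axis p) j != 0.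
pose D4 (p : J * bool * bool -> K) :=
  start_on_axis p (inr ord0, false, false) - start_on_axis p (inr ord_max, false, false) != 0.
have pa jbb := start_on_axis_poly jbb.
have o1 : line_open D1 by exact: qlines_open_along.
have o2 : line_open D2.
  apply: line_open_forall => j; apply: line_open_neq0; apply: poly_alongM;
    by apply: poly_alongD => //; exact: poly_alongN.
have o3 : line_open (seven_lines_trace z).
  apply: line_open_solvable; first by split.
  apply: functional_family_sum.
    exact: (@bieval_family K _ _ _ _ (fun p jb => start_on_axis p (jb, false))
      (fun p jb => start_on_axis p (jb, true))).
  apply: (@bieval_family K _ _ _ _ (fun p c => 0) (fun p c => z c)) => c;
    exact: poly_along_const.
have o4 : line_open D4.
  by apply: line_open_neq0; apply: poly_alongD => //; exact: poly_alongN.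
(* In degree 2 one transversal line, two lines of the ruling and the point (0, 0) give 3 + 6 + 1
   conditions, which exhaust the 10 coefficients. *)
have e1 : exists p, D1 p.
  have i1 : injective (fun _ : 'I_1 => 0 : K) by move=> i j _; rewrite !ord1.
  have [||||p [hp h0]] := @quadric_step K 0 1 2 _ axis_point.
  - exists (fun _ => 0); apply/qlines_solvableP => G c sG.
    exists ((G ord0)`_0)%:MP; split; [|move=> j|by case].
      by rewrite -[_%:MP]mulr1 mul_mpolyC; apply: dhomogZ; exact: dhomog1.
    by rewrite ord1 lfC [in RHS](size1_polyC (sG ord0)).
  - by [].
  - exact: (@grid_solvable K 1 1 1 3 _ _ i1 i1 isT isT).
  - by rewrite card_prod !card_ord.
  exists p; rewrite /D1; have -> // : start_on_axis p = p.
  by apply: funext => -[[[i|j] [] []]] //=; rewrite h0.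
have e2 : exists p, D2 p.
  exists (fun jbb : J * bool * bool => (jbb.1.2 : nat)%:R).
  by case=> [i|j]; rewrite /slope_gap /= !sub0r mulrNN mulr1 oner_eq0.
have e4 : exists p, D4 p.
  exists (fun jbb : J * bool * bool => if jbb.1.1 is inr j then (j : nat)%:R else 0).
  by rewrite /D4 /= sub0r oppr_eq0 oner_eq0.
have [p [[[p1 p2] p3] p4]] :
    exists p, ((D1 p /\ D2 p) /\ seven_lines_trace z p) /\ D4 p.
  apply: line_open_meet => //; first by do 2![apply: line_openI => //].
  apply: line_open_meet => //; [exact: line_openI|exact: line_open_meet|].
  exact: seven_lines_trace_exists.
pose P := start_on_axis p.
have [a [ia ha]] := @exists_fresh K (0 :: [seq (qpt P jb).1 | jb <- enum {: J * bool}]) 3.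
have a0 j : 0 != a j by apply: contraNneq (ha j) => <-; exact: mem_head.
have aP jb j : (qpt P jb).1 != a j.
  apply: contraNneq (ha j) => <-; rewrite inE; apply/orP; right.
  by apply/mapP; exists jb; rewrite ?mem_enum.
(* Five points of y = 0: one on each line x = a j and the two starting points. They determine a form
   of degree 4 on that axis. *)
pose xi (i : 'I_(3 + 2)) := match split i with inl j => a j | inr j => P (inr j, false, false) end.
have ixi : injective xi.
  move=> i i'; rewrite /xi -{2}(splitK i) -{2}(splitK i').
  case: (split i) => [j|j]; case: (split i') => [j'|j'].
  - by move/ia => ->.
  - by move=> e; move/eqP: (aP (inr j', false) j) => ne; case: ne; exact: esym e.
  - by move=> e; move/eqP: (aP (inr j, false) j') => ne; case: ne; exact: e.
  have ord2 (k : 'I_2) : k = ord0 \/ k = ord_max.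
    by case: k => [[|[|//]] lk]; [left|right]; apply: val_inj.
  have p4' : P (inr ord0, false, false) <> P (inr ord_max, false, false).
    by move=> e; move: p4; rewrite /D4 -/P e subrr eqxx.
  by case: (ord2 j) => ->; case: (ord2 j') => -> // e; case: p4'.
have [l [sl el]] := lagrange_basis ixi.
have axis f : f \is 4.-homog -> f.@[qr 0 0] = \sum_(j < 3) (l (lshift 2 j)).[0] * f.@[qr (a j) 0]
    + \sum_(j < 2) (l (rshift 3 j)).[0] * f.@[qvec (qpt P (inr j, false))].
  move=> hf; rewrite -meval_yline (lagrange_eval _ ixi sl el (size_lf _ _ hf)).
  rewrite big_split_ord /=; congr (_ + _); apply: eq_bigr => j _; rewrite meval_yline /xi.
    by rewrite (unsplitK (inl j : 'I_3 + 'I_2)).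
  by rewrite (unsplitK (inr j : 'I_3 + 'I_2)) /qvec /qpt.
pose idx := ((J * 'I_5 + 'I_3 * 'I_5) + ('I_4 + unit))%type.
pose Phi (s : idx) (f : {mpoly K[4]}) : {poly K} := match s with
  | inl (inl jk) => ((lf (qvec (qpt P (jk.1, false))) (qvec (qpt P (jk.1, true))) f)`_jk.2)%:P
  | inl (inr jk) => ((lf (qr (a jk.1) 0) (xline_dir (a jk.1)) f)`_jk.2)%:P
  | inr (inl c) => lf (qr 0 (z c)) (fun i => (z c - 1) * tilt_dir i) f
  | inr (inr _) => drop_poly 1 (lf (qr 0 0) (fun i => (0 - 1) * tilt_dir i) f)
  end.
have lPhi s : linear (Phi s).
  case: s => [[jk|jk]|[c|u]] b f g /=.
  - by rewrite lf_linear coefD coefZ polyCD polyCM mul_polyC.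
  - by rewrite lf_linear coefD coefZ polyCD polyCM mul_polyC.
  - by rewrite lf_linear.
  - by rewrite lf_linear linearD linearZ.
have hQ g : g \is 2.-homog -> quadric K * g \is 4.-homog.
  by move=> hg; rewrite -[4%N]/(2 + 2)%N; apply: dhomogM => //; exact: quadric_homog.
have s0 : solvable_on (@forms K 4 4) (fun s f => (Phi s f).[0]).
  move=> c.
  pose gx i : {poly K} := \poly_(m < 5) c (inl (inr (i, inord m))).
  have gxe i (m : 'I_5) : (gx i)`_m = c (inl (inr (i, m))).
    by rewrite coef_poly ltn_ord; congr (c (inl (inr (_, _)))); apply: val_inj; rewrite /= inordK.
  pose gl j : {poly K} := \poly_(m < 5) c (inl (inl (j, inord m))).
  have gle j (m : 'I_5) : (gl j)`_m = c (inl (inl (j, m))).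
    by rewrite coef_poly ltn_ord; congr (c (inl (inl (_, _)))); apply: val_inj; rewrite /= inordK.
  pose pts (s : J * bool + 'I_4) := match s with
    | inl jb => qpt P jb | inr m => (0, z m) end.
  have [|||h [hh h1 h2]] := @quadric_trace K 4 3 a _ pts gx (fun s => match s with
    | inl (j, e) => (gl j)`_(if e then 4%N else 0%N)
    | inr m => c (inr (inl m)) end) ia isT.
  - by case=> [jb|m] j; [exact: aP|exact: a0].
  - by move=> i; exact: size_poly.
  - move=> c'; have [M [M1 hM]] := p3 c'.
    by exists M; split; [by []|move=> s; rewrite -hM; case: s].
  have [|||G' [sG' hG']] := @add_quadric K 2 _ P h gl p2 hh.
  - by move=> j; exact: size_poly.
  - by move=> j; exact: (h2 (inl (j, false))).
  - by move=> j; exact: (h2 (inl (j, true))).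
  move/qlines_solvableP: p1 => /(_ G' (fun _ => (c (inr (inr tt)) -
      (lf (qr 0 0) (fun i => (0 - 1) * tilt_dir i) h)`_1) / ((0 - 1) * (2 - 0))) sG') [g [hg q1 q2]].
  have onQ x y : (quadric K * g + h).@[qr x y] = h.@[qr x y].
    by rewrite mevalD mevalM quadric_qr mul0r add0r.
  exists (quadric K * g + h); split; first by apply: rpredD => //; exact: hQ.
  case=> [[[j m]|[i m]]|[m|[]]] /=.
  - by rewrite hornerC hG' // gle.
  - rewrite hornerC -gxe.
    have -> // : lf (qr (a i) 0) (xline_dir (a i)) (quadric K * g + h) = gx i.
    by apply: poly_ext => s; rewrite meval_xline onQ h1.
  - rewrite horner_coef0 lf_coef0 onQ; exact: (h2 (inr m)).
  - rewrite horner_coef0 coef_drop_poly add0n rmorphD rmorphM /= lf_quadric_tilt.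
    rewrite coefD -scalerAl coefZ coefXM /= lf_coef0 (q2 (ord0, ord0)) mulrC divfK ?subrK //.
    by rewrite sub0r subr0 mulN1r oppr_eq0 pnatr_eq0.
have [q [q0 hq]] := solvable_poly_open (@forms_subspace K 4 4) lPhi s0.
have [s] : exists s, (q * 'X).[s] != 0.
  by apply: exists_nonroot; rewrite mulf_neq0 ?polyX_eq0.
rewrite hornerM hornerX mulf_eq0 negb_or => /andP [qs s1].
move/(_ s qs): hq => hq.
pose p' (jbb : (J + 'I_3 + 'I_1) * bool * bool) : K := match jbb.1.1 with
  | inl (inl j) => P (j, jbb.1.2, jbb.2)
  | inl (inr i) => if jbb.2 then (jbb.1.2 : nat)%:R else a i
  | inr _ => if jbb.2 then 1 + (jbb.1.2 : nat)%:R else (jbb.1.2 : nat)%:R * s end.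
apply: (@qlines_card K _ _ _ p'); first by rewrite !card_sum !card_ord.
apply/qlines_solvableP => G c sG.
have [g hg] := boolp.choice (fun i => lf_xline (a i) (sG (inl (inr i)))).
pose v y := (2 - y) ^+ 4 * (G (inr ord0)).[(y - 1) / (2 - y)].
(* The value at (0, 0) that is forced by the lines through the five points of the axis. *)
pose w := \sum_(j < 3) (l (lshift 2 j)).[0] * (g j).[0]
    + \sum_(j < 2) (l (rshift 3 j)).[0] * (G (inl (inl (inr j))))`_0.
have [f [hf ef]] := hq (fun e : idx => match e with
  | inl (inl jk) => (G (inl (inl jk.1)))`_jk.2
  | inl (inr ik) => (g ik.1)`_ik.2
  | inr (inl m) => v (z m)
  | inr (inr _) => (v 0 - w) / s end).
have fx i : lf (qr (a i) 0) (xline_dir (a i)) f = g i.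
  apply/polyP => m; have [lt|le] := ltnP m 5.
    by have := ef (inl (inr (i, Ordinal lt))); rewrite /= hornerC.
  rewrite !nth_default // (leq_trans _ le) // ?(size_lf _ _ hf) //.
  by case: (hg i).
have fp j : lf (qvec (qpt P (j, false))) (qvec (qpt P (j, true))) f = G (inl (inl j)).
  apply/polyP => m; have [lt|le] := ltnP m 5.
    by have := ef (inl (inl (j, Ordinal lt))); rewrite /= hornerC.
  by rewrite !nth_default // (leq_trans _ le) // (size_lf _ _ hf).
exists f; split=> // -[[j|i]|j].
- exact: fp.
- by apply: (hg i).2 => // y; rewrite -fx meval_xline.
have ax y : 2 - y != 0 ->
    (lf (qr 0 y) (fun i => (y - 1) * tilt_dir i) f).[s] = v y ->
    (lf (qr 0 1) (qr s 2) f).[(y - 1) / (2 - y)] = (G (inr ord0)).[(y - 1) / (2 - y)].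
  by move=> ny; rewrite (meval_tilt _ hf ny) => /mulfI; apply; rewrite expf_neq0.
rewrite ord1 /qvec /qpt /p' /= mul0r mul1r addr0.
have n2 : 2 - 0 != 0 :> K by rewrite subr0 pnatr_eq0.
apply: (@poly_eq_on _ _ _ 5 [seq (y - 1) / (2 - y) | y <- 0 :: codom z]).
- exact: size_lf.
- exact: sG.
- rewrite map_inj_in_uniq.
    rewrite cons_uniq map_inj_uniq ?enum_uniq // andbT.
    by apply/negP => /codomP [m e]; have := z0 m; rewrite -e eqxx.
  have mem y : y \in 0 :: codom z -> 2 - y != 0.
    by rewrite inE => /orP [/eqP -> //|/codomP [m ->]].
  move=> x y /mem nx /mem ny /(congr1 (fun t => t * (2 - x) * (2 - y))).
  rewrite divfK // mulrAC divfK // => e.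
  by apply/eqP; rewrite -subr_eq0; apply/eqP; rewrite -(subrr ((x - 1) * (2 - y))) {2}e; ring.
- by rewrite size_map /= size_codom card_ord.
move=> y /mapP [x]; rewrite inE => /orP [/eqP ->|/codomP [m ->]] ->; last first.
  by apply: ax => //; exact: (ef (inr (inl m))).
apply: ax => //; have := ef (inr (inr tt)); rewrite /= => e.
set R := lf _ _ f in e *.
have -> : R = (R`_0)%:P + drop_poly 1 R * 'X.
  by rewrite -[LHS](poly_take_drop 1) expr1; congr (_ + _); apply/polyP => -[|m];
    rewrite coef_take_poly coefC.
rewrite hornerD hornerM hornerC hornerX e divfK // /R lf_coef0 axis //.
suff -> : \sum_(j < 3) (l (lshift 2 j)).[0] * f.@[qr (a j) 0]
    + \sum_(j < 2) (l (rshift 3 j)).[0] * f.@[qvec (qpt P (inr j, false))] = w.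
  by rewrite addrC subrK.
congr (_ + _); apply: eq_bigr => i _; first by rewrite -meval_xline fx.
by rewrite -fp lf_coef0.
Qed.

End SevenLines.

(** * The maximal number of independent lines in P^3 *)

Section LinesInSpace.
Variable K : numFieldType.

Lemma qlines_ruling d t : (t <= d.+1)%N -> qlines K d t.
Proof.
move=> td; have [a [ia _]] := @exists_fresh K [::] t.
exists (fun jbb : 'I_t * bool * bool => if jbb.2 then (jbb.1.2 : nat)%:R else a jbb.1.1).
apply/qlines_solvableP => G c sG.
have [g hg] := boolp.choice (fun j => lf_xline (a j) (sG j)).
have [|||h [hh h1 _]] := @quadric_trace K d t a void (of_void _) g (of_void _) ia td.
- by case.
- by move=> j; case: (hg j).
- by move=> c'; exists 0; split=> // -[].
by exists h; split=> // j; exact: (hg j).2.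
Qed.

(** In degree 3 f + 5 the x + 2 f + 1 lines leave exactly 10 (f + 2) coefficients free, which is the
    number of crossings of a grid of 5 by 2 f + 4 lines. The counts on the quadric are then
    equalities in both steps. *)
Lemma qlines_mod1 f x : (2 * x = (f + 2) * (3 * f + 5))%N ->
  qlines K (3 * f + 3) x -> qlines K (3 * f + 3).+4 (x + 4 * f + 10).
Proof.
move=> ex h.
have [a [ia ha]] := @exists_fresh K [:: 0; 1] 5.
have [b [ib _]] := @exists_fresh K [::] (2 * f + 4).
have a0 i : a i != 0 by apply: contraNneq (ha i) => ->; rewrite !inE eqxx.
have a1 i : 1 - a i != 0.
  by rewrite subr_eq0; apply: contraNneq (ha i) => <-; rewrite !inE eqxx orbT.
have [|||p [hp _]] := @quadric_step K (3 * f + 3) x (2 * f + 1) _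
  (fun ij : 'I_5 * 'I_(2 * f + 4) => (a ij.1, b ij.2)) h.
- by lia.
- by apply: grid_solvable => //; lia.
- by rewrite card_prod !card_ord; nia.
have hp' := qlines_card (k := (x + (2 * f + 1))%N) _ hp.
have -> : (x + 4 * f + 10 = x + (2 * f + 1) + 5 + (2 * f + 4))%N by lia.
apply: (@grid_step K _ _ _ _ a b ia ib a0 a1); [lia|lia| |nia].
by apply: hp'; rewrite card_sum !card_ord.
Qed.

(** With d = 3 e - 2 the number x is (d + 2) (d + 3) / 6, the largest possible number of lines in
    that degree. *)
Lemma half_pentagonal e : exists x, (2 * x = e * (3 * e + 1))%N.
Proof.
elim: e => [|e [x hx]]; first by exists 0%N.
by exists (x + 3 * e + 2)%N; nia.
Qed.

(** For d divisible by 3 the step from d - 2 fits exactly, and for d congruent to 2 the bound is no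
    integer and leaves room. For d congruent to 1 the bound is an integer but the one for d - 2 is
    not, so a double step from d - 4 is taken; it starts at d = 7. *)
Theorem qlines_exist d k : (6 * k <= (d + 2) * (d + 3))%N -> qlines K d k.
Proof.
elim/ltn_ind: d k => d IH k hk.
have [d1|d1] := leqP d 1.
  by apply: qlines_ruling; case: d d1 hk {IH} => [|[|//]] _ hk; lia.
have [d4|d4] := eqVneq d 4.
  by subst d; apply: qlines_leq (seven_lines K); lia.
have ed := divn_eq d 3; have := ltn_pmod d (isT : (0 < 3)%N).
set e := (d %/ 3)%N in ed *; case: (d %% 3)%N ed => [|[|[|//]]] ed _.
- have [x hx] := half_pentagonal e.
  have -> : d = (d - 2).+2 by lia.
  apply: (@qlines_leq _ _ (x + (2 * e + 1))); first by nia.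
  by apply: qlines_step; [apply: IH; nia|lia|nia].
- have e2 : (2 <= e)%N by lia.
  have [y hy] := half_pentagonal e.
  have ef : e = (e - 2).+2 by lia.
  set f := (e - 2)%N in ef *.
  have -> : d = (3 * f + 3).+4 by lia.
  apply: (@qlines_leq _ _ (y - e + 4 * f + 10)); first by nia.
  by apply: qlines_mod1; [nia|apply: IH; nia].
have [y hy] := half_pentagonal e.
have -> : d = (d - 2).+2 by lia.
apply: (@qlines_leq _ _ (y + 2 * e + 1 + (2 * e + 2))); first by nia.
by apply: qlines_step; [apply: IH; nia|lia|nia].
Qed.

End LinesInSpace.

(** * Degeneration to a hyperplane *)

Section Hyperplane.
Variable K : numFieldType.

Section Coordinates.
Variable N : nat.

Definition ext (x : 'I_N -> K) (t : K) : 'I_N.+1 -> K :=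
  fun i => if unlift ord_max i is Some j then x j else t.

Definition lastvar : {mpoly K[N.+1]} := 'X_ord_max.

Definition widen (h : {mpoly K[N]}) : {mpoly K[N.+1]} :=
  mmap (@mpolyC N.+1 K) (fun j => 'X_(lift ord_max j)) h.

HB.instance Definition _ := GRing.RMorphism.copy widen
  (mmap (@mpolyC N.+1 K) (fun j => 'X_(lift ord_max j) : {mpoly K[N.+1]})).

Lemma ext_max x t : ext x t ord_max = t.
Proof. by rewrite /ext unlift_none. Qed.

Lemma ext_lift x t j : ext x t (lift ord_max j) = x j.
Proof. by rewrite /ext liftK. Qed.

Lemma ext_surj (x : 'I_N.+1 -> K) : ext (fun j => x (lift ord_max j)) (x ord_max) = x.
Proof. by apply: funext => i; rewrite /ext; case: unliftP => [j ->|->]. Qed.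

Lemma widenX j : widen 'X_j = 'X_(lift ord_max j).
Proof. by rewrite /widen mmapX mmap1U. Qed.

Lemma widenZ c h : widen (c *: h) = c *: widen h.
Proof. by rewrite /widen mmapZ mul_mpolyC. Qed.

Lemma lf_widen x y t s h : lf (ext x t) (ext y s) (widen h) = lf x y h.
Proof.
pose F : {rmorphism _ -> _} := lf (ext x t) (ext y s) \o widen.
apply: (@mpoly_morph_eq _ _ _ F (lf x y)) => [c|i] /=.
  by rewrite /widen mmapC !lfC.
by rewrite widenX !lfX !ext_lift.
Qed.

Lemma meval_widen x t h : (widen h).@[ext x t] = h.@[x].
Proof. by rewrite -!(lf_coef0 _ (fun=> 0)) -[fun=> 0]ext_surj lf_widen. Qed.

Lemma lf_lastvar x y t s : lf (ext x t) (ext y s) lastvar = t%:P + s%:P * 'X.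
Proof. by rewrite lfX !ext_max. Qed.

Lemma lf_const (x : 'I_N -> K) h : lf x (fun=> 0) h = (h.@[x])%:P.
Proof.
apply: poly_ext => s; rewrite lf_horner hornerC; congr (h.@[_]).
by apply: funext => i; rewrite mulr0 addr0.
Qed.

Lemma widen_homog d h : h \is d.-homog -> widen h \is d.-homog.
Proof.
move=> hh; rewrite /widen /mmap big_seq; apply: rpred_sum => m ms.
rewrite mul_mpolyC; apply: dhomogZ; rewrite -(dhomogP _ _ _ hh m ms) /= mdegE /mmap1.
elim/big_rec2: _ => [|i a b _ IH]; first exact: dhomog1.
by apply: dhomogM => //; exact: mpolyX_homog.
Qed.

Lemma lastvar_homog d g : g \is d.-homog -> lastvar * g \is d.+1.-homog.
Proof.
by move=> hg; rewrite -[d.+1]/(1 + d)%N; apply: dhomogM => //; rewrite dhomogX /= mdeg1.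
Qed.

Lemma hyperplane_decomposition d (f : {mpoly K[N.+1]}) : f \is d.+1.-homog ->
  exists g h, [/\ g \is d.-homog, h \is d.+1.-homog & f = lastvar * g + widen h].
Proof.
move=> hf; rewrite [f]mpolyE big_seq.
apply: (big_ind (fun q => exists g h,
    [/\ g \is d.-homog, h \is d.+1.-homog & q = lastvar * g + widen h])).
- by exists 0, 0; rewrite !dhomog0 mulr0 rmorph0 addr0.
- move=> _ _ [g [h [hg hh ->]]] [g' [h' [hg' hh' ->]]]; exists (g + g'), (h + h').
  by rewrite !rpredD // mulrDr rmorphD /= addrACA.
move=> m ms; have hm := dhomogP _ _ _ hf m ms.
have [m0|m0] := posnP (m ord_max).
  exists 0, (f@_m *: 'X_[[multinom m (lift ord_max j) | j < N]]); split.
  - exact: dhomog0.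
  - apply: dhomogZ; rewrite dhomogX -hm /= !mdegE big_ord_recr /= m0 addn0.
    apply/eqP; apply: eq_bigr => j _; rewrite mnmE; congr (m _).
    by apply: val_inj; rewrite /= /bump leqNgt ltn_ord.
  rewrite mulr0 add0r widenZ /widen mmapX.
  congr (_ *: _); rewrite mpolyXE_id (bigD1 ord_max) //= m0 expr0 mul1r /mmap1.
  rewrite [RHS](eq_bigr (fun j => 'X_(lift ord_max j) ^+ m (lift ord_max j))); last first.
    by move=> j _; rewrite mnmE.
  rewrite (reindex_omap (lift ord_max) (unlift ord_max)) /=; last first.
    by move=> i; case: unliftP => [j ->|-> /eqP].
  by apply: eq_bigl => j; rewrite liftK eqxx andbT eq_sym neq_lift.
have le : (U_(ord_max) <= m)%MM.
  by apply/mnm_lepP => i; rewrite mnm1E; case: eqP => // <-.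
have em := submK le.
exists (f@_m *: 'X_[(m - U_(ord_max))%MM]), 0; split.
- apply: dhomogZ; rewrite dhomogX /=; apply/eqP.
  by have := hm; rewrite /= -{1}em mdegD mdeg1 addn1 => -[].
- exact: dhomog0.
by rewrite rmorph0 addr0 -scalerAr; congr (_ *: _); rewrite /lastvar -mpolyXD addmC em.
Qed.

End Coordinates.

Definition no_points N : void -> 'I_N -> K := fun v => match v with end.

Definition general_lines n d k := exists u v : 'I_k -> 'I_n.+1 -> K,
  config_solvable d u v (@no_points n.+1).

Lemma config_cancel N d (J J' I I' : Type) (u v : J -> 'I_N -> K)
    (pts : I -> 'I_N -> K) (h : J' -> J) (h' : J -> option J')
    (l : I' -> I) (l' : I -> option I') :
  pcancel h h' -> pcancel l l' -> config_solvable d u v pts ->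
  config_solvable d (fun j => u (h j)) (fun j => v (h j)) (fun i => pts (l i)).
Proof.
move=> hK lK /config_solvableP s; apply/config_solvableP => G c sG.
have [|f [hf e1 e2]] := s (fun j => if h' j is Some j' then G j' else 0)
  (fun i => if l' i is Some i' then c i' else 0).
  by move=> j; case: (h' j) => [j'|]; rewrite ?size_poly0.
by exists f; split=> // [j|i]; [have := e1 (h j); rewrite hK|have := e2 (l i); rewrite lK].
Qed.

Lemma general_lines_card n d k (J : finType) (u v : J -> 'I_n.+1 -> K) :
  (k <= #|J|)%N -> config_solvable d u v (@no_points n.+1) -> general_lines n d k.
Proof.
move=> le s; exists (fun i => u (enum_val (widen_ord le i))),
  (fun i => v (enum_val (widen_ord le i))).
have := @config_cancel _ _ _ _ void void _ _ _ (fun i => enum_val (widen_ord le i))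
  (fun j => insub (enum_rank j : nat)) id Some _ (fun=> erefl) s.
by apply=> i; rewrite enum_valK /= valK.
Qed.

Lemma general_lines_fin n d k (J : finType) : (#|J| <= k)%N -> general_lines n d k ->
  exists u v : J -> 'I_n.+1 -> K, config_solvable d u v (@no_points n.+1).
Proof.
move=> le [u [v s]]; exists (fun j => u (widen_ord le (enum_rank j))),
  (fun j => v (widen_ord le (enum_rank j))).
have := @config_cancel _ _ _ _ void void _ _ _ (fun j => widen_ord le (enum_rank j))
  (fun i : 'I_k => omap enum_val (insub (i : nat) : option 'I_#|J|)) id Some _ (fun=> erefl) s.
by apply=> j; rewrite /= valK /= enum_rankK.
Qed.

Lemma general_lines_leq n d k k' : (k' <= k)%N -> general_lines n d k ->
  general_lines n d k'.
Proof. by move=> le [u [v s]]; apply: general_lines_card s; rewrite card_ord. Qed.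

(** Independence depends on the lines and not on the points chosen on them. Scalings, shifts and,
    later, swaps generate the changes of basis that are used. *)
Lemma config_scale N d (J I : Type) (u v : J -> 'I_N -> K) (pts : I -> 'I_N -> K)
    (c : J -> K) : (forall j, c j != 0) -> config_solvable d u v pts ->
  config_solvable d u (fun j i => c j * v j i) pts.
Proof.
move=> c0 /config_solvableP s; apply/config_solvableP => G b sG.
have [|f [hf e1 e2]] := s (fun j => G j \Po ((c j)^-1 *: 'X)) b.
  move=> j; apply: leq_trans (size_comp_poly_leq _ _) _.
  by rewrite size_scale ?invr_eq0 // size_polyX muln1; have := sG j; lia.
exists f; split=> // j; rewrite lf_scale e1 -comp_polyA comp_polyZ comp_polyX.
by rewrite scalerA mulVf // scale1r comp_polyXr.
Qed.

Lemma config_shift N d (J I : Type) (u v : J -> 'I_N -> K) (pts : I -> 'I_N -> K)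
    (c : J -> K) : config_solvable d u v pts ->
  config_solvable d (fun j i => u j i + c j * v j i) v pts.
Proof.
move=> /config_solvableP s; apply/config_solvableP => G b sG.
have [|f [hf e1 e2]] := s (fun j => G j \Po ('X - (c j)%:P)) b.
  move=> j; apply: leq_trans (size_comp_poly_leq _ _) _.
  by rewrite size_XsubC muln1; have := sG j; lia.
exists f; split=> // j; rewrite lf_shift e1 -comp_polyA rmorphB /= comp_polyX comp_polyC.
by rewrite addrK comp_polyXr.
Qed.

(* Every line is represented anew by its point on the hyperplane and a direction. *)
Lemma transverse_config n d (J I : finType) (u v : J -> 'I_n.+1 -> K)
    (pts : I -> 'I_n.+1 -> K) : config_solvable d u v pts ->
  (forall j, v j ord_max != 0) ->
  config_solvable d
    (fun j => ext (fun i => u j (lift ord_max i) -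
       u j ord_max / v j ord_max * v j (lift ord_max i)) 0)
    (fun j => ext (fun i => (v j ord_max)^-1 * v j (lift ord_max i)) 1) pts.
Proof.
move=> s v0; have vi j : (v j ord_max)^-1 != 0 by rewrite invr_eq0.
have := config_scale vi (config_shift (fun j => - (u j ord_max / v j ord_max)) s).
congr (config_solvable d _ _ _); apply: funext => j; apply: funext => i.
  rewrite /ext; case: unliftP => [l ->|->]; first by rewrite mulNr.
  by rewrite mulNr divfK // subrr.
by rewrite /ext; case: unliftP => [l ->|->] //; rewrite mulVf.
Qed.

Lemma general_transverse n d (J : finType) k : (#|J| <= k)%N -> general_lines n.+1 d k ->
  exists a b : J -> 'I_n.+1 -> K, config_solvable d (fun j => ext (a j) 0)
    (fun j => ext (b j) 1) (@no_points n.+2).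
Proof.
move=> le /(general_lines_fin le) [u [v s]].
pose C1 (p : J * bool * 'I_n.+2 -> K) := config_solvable d (fun j l => p (j, false, l))
  (fun j l => p (j, true, l)) (@no_points n.+2).
pose C2 (p : J * bool * 'I_n.+2 -> K) := forall j, p (j, true, ord_max) != 0.
have [p [p1 p2]] : exists p, C1 p /\ C2 p.
  apply: line_open_meet.
  - by apply: config_open => j l; [exact: poly_along_coord|exact: poly_along_coord|case: j].
  - by apply: line_open_forall => j; apply: line_open_neq0; exact: poly_along_coord.
  - by exists (fun jbl => if jbl.1.2 then v jbl.1.1 jbl.2 else u jbl.1.1 jbl.2).
  - by exists (fun=> 1) => j; exact: oner_neq0.
by eexists; eexists; exact: (transverse_config p1 p2).
Qed.

End Hyperplane.

(** * Points of a hyperplane and pairs of lines that meet *)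

Section HyperplaneDegeneration.
Variable K : numFieldType.

Lemma poly_along_ext T N (x : (T -> K) -> 'I_N -> K) t l :
  (forall j, poly_along (fun p => x p j)) -> poly_along (fun p => ext (x p) t l).
Proof.
move=> hx; rewrite /ext; case: unliftP => [j _|_]; first exact: hx.
exact: poly_along_const.
Qed.

(* Points of the hyperplane fail to impose conditions only on multiples of the
   last variable, so none of degree d may vanish on all the lines. *)
Lemma residual_config n d k2 w2 r w :
  let J := ('I_k2 + 'I_w2 + 'I_r)%type in
  general_lines K n.+1 d.+1 (k2 + w2 + r) -> general_lines K n.+1 d k2 ->
  (k2 * d.+1 + w2 = 'C(n.+1 + d, d))%N ->
  ((k2 + w2 + r) * d.+2 + w <= 'C(n.+1 + d.+1, d.+1))%N ->
  exists (a b : J -> 'I_n.+1 -> K) (y : 'I_w -> 'I_n.+1 -> K),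
    config_solvable d.+1 (fun j => ext (a j) 0) (fun j => ext (b j) 1)
      (fun i => ext (y i) 0).
Proof.
move=> J h1 h2 e2 le1.
pose A (p : J * bool * 'I_n.+1 -> K) j : 'I_n.+2 -> K := ext (fun l => p (j, false, l)) 0.
pose B (p : J * bool * 'I_n.+1 -> K) j : 'I_n.+2 -> K := ext (fun l => p (j, true, l)) 1.
pose C1 p := config_solvable d.+1 (A p) (B p) (@no_points K n.+2).
(* [k2] lines and one point on each of [w2] further lines exhaust degree d. The point is the
   direction [B], off the hyperplane, whose value is the top coefficient of the restriction. *)
pose C2 p := config_solvable d (fun i : 'I_k2 => A p (inl (inl i)))
  (fun i => B p (inl (inl i))) (fun i : 'I_w2 => B p (inl (inr i))).
have pA j l : poly_along (fun p => A p j l).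
  by apply: poly_along_ext => i; exact: poly_along_coord.
have pB j l : poly_along (fun p => B p j l).
  by apply: poly_along_ext => i; exact: poly_along_coord.
have [p [p1 p2]] : exists p, C1 p /\ C2 p.
  apply: line_open_meet.
  - by apply: config_open => // -[].
  - by apply: config_open.
  - have [|a [b s]] := @general_transverse K n d.+1 J _ _ h1.
      by rewrite !card_sum !card_ord.
    by exists (fun jbl => if jbl.1.2 then b jbl.1.1 jbl.2 else a jbl.1.1 jbl.2).
  have [|a [b s]] := @general_transverse K n d 'I_k2 _ _ h2; first by rewrite card_ord.
  have [||||c hc] := @solvable_points _ _ ('I_k2 * 'I_d.+1 + void)%type
      'I_('C(n.+1 + d, d)) ('I_n.+1 -> K) _ _ (fun c f => f.@[ext c 1]) w2
      (@forms_subspace K n.+2 d) _ _ _ (@forms_free K n.+1 d) _ s.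
  - by case=> [jk|[]]; exact: coef_lf_scalar.
  - by move=> c; exact: meval_scalar.
  - move=> f hf _ f0.
    (* The factor [lastvar] forces a point off the hyperplane, which can be scaled to last
       coordinate 1. *)
    have [x] : exists x, (f * lastvar K n.+1).@[x] != 0.
      apply: meval_neq0; rewrite mulf_neq0 //; apply/eqP => e.
      have := mevalXU (fun=> 1 : K) (@ord_max n.+1); rewrite -/(lastvar K n.+1) e meval0.
      by move/eqP; rewrite eq_sym oner_eq0.
    rewrite mevalM mevalXU mulf_eq0 negb_or => /andP [fx x0].
    exists (fun j => (x ord_max)^-1 * x (lift ord_max j)).
    have -> : ext (fun j => (x ord_max)^-1 * x (lift ord_max j)) 1 =
        (fun i => (x ord_max)^-1 * x i).
      by apply: funext => i; rewrite /ext; case: unliftP => [j ->|->] //; rewrite mulVf.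
    by rewrite (meval_homogZ _ _ hf) mulf_neq0 // expf_neq0 // invr_eq0.
  - by rewrite card_sum card_prod card_void !card_ord addn0 e2.
  exists (fun jbl => match jbl with
    | (inl (inl i), b', l) => if b' then b i l else a i l
    | (inl (inr i), _, l) => c i l
    | (inr _, _, _) => 0 end).
  refine (@solvable_reindex _ _ ('I_k2 * 'I_d.+1 + void + 'I_w2)%type
    ('I_k2 * 'I_d.+1 + 'I_w2)%type _ _ _
    (fun s => match s with inl jk => inl (inl jk) | inr i => inr i end)
    (fun s => match s with
      | inl (inl jk) => inl jk | inl (inr v) => match v with end | inr i => inr i end)
    _ _ hc); first by case.
  by case.
have inj g : g \is d.-homog -> (forall j, lf (A p j) (B p j) g = 0) -> g = 0.
  move=> hg z.
  apply: (@solvable_inj _ _ ('I_k2 * 'I_d.+1 + 'I_w2)%type 'I_('C(n.+1 + d, d)) _ _ g _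
    (@forms_spanned K n.+1 d) _ p2 hg).
  - by case=> [jk|i]; [exact: coef_lf_scalar|exact: meval_scalar].
  - by rewrite card_sum card_prod !card_ord e2.
  case=> [jk|i]; first by rewrite z coef0.
  by rewrite -(lf_coef_top (A p (inl (inr i))) _ hg) z coef0.
have [||||y hy] := @solvable_points _ _ (J * 'I_d.+2 + void)%type
    'I_('C(n.+1 + d.+1, d.+1)) ('I_n.+1 -> K) _ _ (fun c f => f.@[ext c 0]) w
    (@forms_subspace K n.+2 d.+1) _ _ _ (@forms_free K n.+1 d.+1) _ p1.
- by case=> [jk|[]]; exact: coef_lf_scalar.
- by move=> c; exact: meval_scalar.
- move=> f hf z f0; apply: contrapT => /forallNP hH.
  have zf j : lf (A p j) (B p j) f = 0.
    apply/polyP => k; rewrite coef0; have [lt|le] := ltnP k d.+2.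
      exact: (z (inl (j, Ordinal lt))).
    by rewrite nth_default // (leq_trans (size_lf _ _ hf)).
  have [g [h [hg hh ef]]] := hyperplane_decomposition hf.
  have h0 : h = 0.
    apply/eqP/negPn/negP => /meval_neq0 [x hx]; apply: (hH x).
    by rewrite ef mevalD mevalM mevalXU ext_max mul0r add0r meval_widen.
  have g0 : g = 0.
    apply: inj => // j; have := zf j.
    rewrite ef h0 rmorph0 addr0 rmorphM /= lf_lastvar add0r mul1r => /eqP.
    by rewrite mulf_eq0 polyX_eq0 => /eqP.
  by move: f0; rewrite ef h0 g0 mulr0 rmorph0 addr0 eqxx.
- by rewrite card_sum card_prod card_void !card_sum !card_ord addn0.
exists (fun j l => p (j, false, l)), (fun j l => p (j, true, l)), y.
refine (@solvable_reindex _ _ (J * 'I_d.+2 + void + 'I_w)%type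
  (J * 'I_d.+2 + 'I_w)%type _ _ _
  (fun s => match s with inl jk => inl (inl jk) | inr i => inr i end)
  (fun s => match s with
    | inl (inl jk) => inl jk | inl (inr v) => match v with end | inr i => inr i end)
  _ _ hy); first by case.
by case.
Qed.

(* Pairs of lines through y i, other lines and points: the common value at y i
   counts once. *)
Definition cross_solvable N D (W R I : Type) (y z z' : W -> 'I_N -> K)
    (u v : R -> 'I_N -> K) (pts : I -> 'I_N -> K) :=
  solvable_on (@forms K N D)
    (fun (s : (W * 'I_D.+1 + W * 'I_D) + (R * 'I_D.+1 + I)) f => match s with
    | inl (inl ik) => (lf (y ik.1) (z ik.1) f)`_ik.2
    | inl (inr ik) => (lf (y ik.1) (z' ik.1) f)`_ik.2.+1
    | inr (inl jk) => (lf (u jk.1) (v jk.1) f)`_jk.2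
    | inr (inr i) => f.@[pts i]
    end).

Lemma cross_solvableP N D (W R I : Type) (y z z' : W -> 'I_N -> K)
    (u v : R -> 'I_N -> K) (pts : I -> 'I_N -> K) :
  cross_solvable D y z z' u v pts <->
  forall (G G' : W -> {poly K}) (H : R -> {poly K}) (c : I -> K),
    (forall i, (size (G i) <= D.+1)%N) -> (forall i, (size (G' i) <= D.+1)%N) ->
    (forall j, (size (H j) <= D.+1)%N) -> (forall i, (G i)`_0 = (G' i)`_0) ->
    exists f, [/\ f \is D.-homog, forall i, lf (y i) (z i) f = G i,
      forall i, lf (y i) (z' i) f = G' i, forall j, lf (u j) (v j) f = H j
      & forall i, f.@[pts i] = c i].
Proof.
split=> h.
  move=> G G' H c sG sG' sH e0; have [f [hf e]] := h (fun s => match s with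
    | inl (inl ik) => (G ik.1)`_ik.2 | inl (inr ik) => (G' ik.1)`_ik.2.+1
    | inr (inl jk) => (H jk.1)`_jk.2 | inr (inr i) => c i end).
  have ext_eq (P Q : {poly K}) : (size P <= D.+1)%N -> (size Q <= D.+1)%N ->
      (forall k : 'I_D.+1, P`_k = Q`_k) -> P = Q.
    move=> sP sQ eq; apply/polyP => k.
    have [lt|le] := ltnP k D.+1; first exact: (eq (Ordinal lt)).
    by rewrite !nth_default // (leq_trans _ le).
  have eG i : lf (y i) (z i) f = G i.
    by apply: ext_eq => // [|k]; [exact: size_lf|exact: (e (inl (inl (i, k))))].
  exists f; split=> // [i|j|i]; last exact: (e (inr (inr i))).
    apply: ext_eq => // [|[[|k] lt]]; first exact: size_lf.
      by rewrite /= lf_coef0 -(lf_coef0 _ (z i)) eG e0.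
    exact: (e (inl (inr (i, Ordinal (lt : (k < D)%N))))).
  by apply: ext_eq => // [|k]; [exact: size_lf|exact: (e (inr (inl (j, k))))].
move=> c; have [||||f [hf e1 e2 e3 e4]] := h
    (fun i => \poly_(k < D.+1) c (inl (inl (i, inord k))))
    (* The constant term is the shared value at [y i], stored with the first line of the pair; for k
       <= D the default 0 is never reached. *)
    (fun i => \poly_(k < D.+1) if k is k'.+1 then
       (if insub k' is Some k'' then c (inl (inr (i, k''))) else 0)
       else c (inl (inl (i, ord0))))
    (fun j => \poly_(k < D.+1) c (inr (inl (j, inord k)))) (fun i => c (inr (inr i))).
- by move=> i; exact: size_poly.
- by move=> i; exact: size_poly.
- by move=> i; exact: size_poly.
- by move=> i; rewrite !coef_poly /=; congr (c (inl (inl (_, _)))); apply: val_inj; rewrite /= inordK.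
exists f; split=> // -[[[i k]|[i k]]|[[j k]|i]] //=.
- by rewrite e1 coef_poly ltn_ord; congr (c (inl (inl (_, _)))); apply: val_inj; rewrite /= inordK.
- by rewrite e2 coef_poly ltnS ltn_ord /= valK.
- by rewrite e3 coef_poly ltn_ord; congr (c (inr (inl (_, _)))); apply: val_inj; rewrite /= inordK.
Qed.

Lemma cross_open T N D (W R I : finType) (y z z' : (T -> K) -> W -> 'I_N -> K)
    (u v : (T -> K) -> R -> 'I_N -> K) (pts : (T -> K) -> I -> 'I_N -> K) :
  (forall i l, poly_along (fun p => y p i l)) ->
  (forall i l, poly_along (fun p => z p i l)) ->
  (forall i l, poly_along (fun p => z' p i l)) ->
  (forall i l, poly_along (fun p => u p i l)) ->
  (forall i l, poly_along (fun p => v p i l)) ->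
  (forall i l, poly_along (fun p => pts p i l)) ->
  line_open (fun p => cross_solvable D (y p) (z p) (z' p) (u p) (v p) (pts p)).
Proof.
move=> hy hz hz' hu hv hp; apply: line_open_solvable; first exact: forms_subspace.
apply: functional_family_sum; apply: functional_family_sum.
- by apply: (@coef_lf_family K T _ _ (fun p (jk : W * 'I_D.+1) => y p jk.1)
    (fun p (jk : W * 'I_D.+1) => z p jk.1) (fun jk => jk.2)).
- by apply: (@coef_lf_family K T _ _ (fun p (jk : W * 'I_D) => y p jk.1)
    (fun p (jk : W * 'I_D) => z' p jk.1) (fun jk => jk.2.+1)).
- by apply: (@coef_lf_family K T _ _ (fun p (jk : R * 'I_D.+1) => u p jk.1)
    (fun p (jk : R * 'I_D.+1) => v p jk.1) (fun jk => jk.2)).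
exact: (@meval_family K T _ _ pts).
Qed.

End HyperplaneDegeneration.

Section Sundials.
Variable K : numFieldType.

Lemma poly_eq_coefs D (P Q : {poly K}) : (size P <= D.+1)%N -> (size Q <= D.+1)%N ->
  (forall k : 'I_D.+1, P`_k = Q`_k) -> P = Q.
Proof.
move=> sP sQ eq; apply/polyP => k.
have [lt|le] := ltnP k D.+1; first exact: (eq (Ordinal lt)).
by rewrite !nth_default // (leq_trans _ le).
Qed.

Lemma lf_hyperplane n (x y : 'I_n.+1 -> K) g h :
  lf (ext x 0) (ext y 0) (lastvar K n.+1 * g + widen h) = lf x y h.
Proof.
by rewrite rmorphD rmorphM /= lf_lastvar polyC0 mul0r addr0 mul0r add0r lf_widen.
Qed.

Lemma lf_transverse n (x y : 'I_n.+1 -> K) g h :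
  lf (ext x 0) (ext y 1) (lastvar K n.+1 * g + widen h) =
  'X * lf (ext x 0) (ext y 1) g + lf x y h.
Proof. by rewrite rmorphD rmorphM /= lf_lastvar add0r mul1r lf_widen. Qed.

(* Pulling apart, along the last coordinate, two lines of the hyperplane that
   meet at y leaves in the limit the condition that the residual form vanish at y. *)
Lemma delta_step n d w (R J : finType) :
  (exists (a b : J -> 'I_n.+1 -> K) (y : 'I_w -> 'I_n.+1 -> K),
    config_solvable d (fun j => ext (a j) 0) (fun j => ext (b j) 1)
      (fun i => ext (y i) 0)) ->
  (exists (y z z' : 'I_w -> 'I_n.+1 -> K) (u v : R -> 'I_n.+1 -> K)
     (pts : J -> 'I_n.+1 -> K), cross_solvable d.+1 y z z' u v pts) ->
  general_lines K n.+1 d.+1 (w + w + (#|R| + #|J|)).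
Proof.
move=> [a1 [b1 [y1 s1]]] [y2 [z2 [z2' [u2 [v2 [a2 s2]]]]]].
pose T := ((J * bool + ('I_w * option bool + R * bool)) * 'I_n.+1)%type.
pose a (p : T -> K) j l := p (inl (j, false), l).
pose b (p : T -> K) j l := p (inl (j, true), l).
pose y (p : T -> K) i l := p (inr (inl (i, None)), l).
pose z (p : T -> K) i l := p (inr (inl (i, Some false)), l).
pose z' (p : T -> K) i l := p (inr (inl (i, Some true)), l).
pose u (p : T -> K) i l := p (inr (inr (i, false)), l).
pose v (p : T -> K) i l := p (inr (inr (i, true)), l).
pose C1 p := config_solvable d (fun j => ext (a p j) 0) (fun j => ext (b p j) 1)
      (fun i => ext (y p i) 0).
pose C2 p := cross_solvable d.+1 (y p) (z p) (z' p) (u p) (v p) (a p).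
have [p [p1 p2]] : exists p, C1 p /\ C2 p.
  have pc t : poly_along (fun p : T -> K => p t) by exact: poly_along_coord.
  apply: line_open_meet.
  - by apply: config_open => j l; apply: poly_along_ext => i; exact: pc.
  - by apply: cross_open => j l; exact: pc.
  - by exists (fun t => match t with
      | (inl (j, e), l) => if e then b1 j l else a1 j l
      | (inr (inl (i, _)), l) => y1 i l
      | (inr (inr _), _) => 0 end).
  by exists (fun t => match t with
      | (inl (j, _), l) => a2 j l
      | (inr (inl (i, None)), l) => y2 i l
      | (inr (inl (i, Some e)), l) => if e then z2' i l else z2 i l
      | (inr (inr (i, e)), l) => if e then v2 i l else u2 i l end).
pose eN : 'I_n.+2 -> K := ext (fun=> 0) 1.
(* The second line of each pair is translated by s along the last coordinate, while the first stays
   in the hyperplane. *)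
pose U i : 'I_n.+2 -> {poly K} :=
  fun l => if unlift ord_max l is Some l' then (y p i l')%:P else 'X.
pose V i : 'I_n.+2 -> {poly K} := fun l => (ext (z' p i) 0 l)%:P.
have eU i s : (fun l => (U i l).[s]) = ext (y p i) s.
  by apply: funext => l; rewrite /U /ext; case: unlift => [l'|]; rewrite ?hornerC ?hornerX.
have eV i s : (fun l => (V i l).[s]) = ext (z' p i) 0.
  by apply: funext => l; rewrite /V hornerC.
pose idx := (('I_w * 'I_d.+2 + 'I_w * 'I_d.+1) +
  (R * 'I_d.+2 + J * 'I_d.+2) + 'I_w)%type.
(* The constant coefficient of the translated line is replaced by a difference quotient at [y i],
   which for s = 0 becomes the value of the residual form. *)
pose Phi (s : idx) (f : {mpoly K[n.+2]}) : {poly K} := match s with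
  | inl (inl (inl ik)) => ((lf (ext (y p ik.1) 0) (ext (z p ik.1) 0) f)`_ik.2)%:P
  | inl (inl (inr ik)) => (lfP (U ik.1) (V ik.1) f)`_ik.2.+1
  | inl (inr (inl jk)) => ((lf (ext (u p jk.1) 0) (ext (v p jk.1) 0) f)`_jk.2)%:P
  | inl (inr (inr jk)) => ((lf (ext (a p jk.1) 0) (ext (b p jk.1) 1) f)`_jk.2)%:P
  | inr i => drop_poly 1 (lf (ext (y p i) 0) eN f)
  end.
have lPhi s : linear (Phi s).
  case: s => [[[ik|ik]|[jk|jk]]|i] c f g /=.
  - by rewrite lf_linear coefD coefZ polyCD polyCM mul_polyC.
  - exact: lfP_linear.
  - by rewrite lf_linear coefD coefZ polyCD polyCM mul_polyC.
  - by rewrite lf_linear coefD coefZ polyCD polyCM mul_polyC.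
  - by rewrite lf_linear linearD linearZ.
have s0 : solvable_on (@forms K n.+2 d.+1) (fun s f => (Phi s f).[0]).
  move=> c.
  have [h [hh eh]] := p2 (fun s => match s with
    | inl ss => c (inl (inl ss)) | inr (inl jk) => c (inl (inr (inl jk)))
    | inr (inr j) => c (inl (inr (inr (j, ord0)))) end).
  have [g [hg eg]] := p1 (fun s => match s with
    | inl jk => c (inl (inr (inr (jk.1, lift ord0 jk.2)))) - (lf (a p jk.1) (b p jk.1) h)`_jk.2.+1
    | inr i => c (inr i) end).
  exists (lastvar K n.+1 * g + widen h); split.
    by apply: rpredD; [exact: lastvar_homog|exact: widen_homog].
  case=> [[[[i k]|[i k]]|[[j k]|[j k]]]|i] /=.
  - by rewrite hornerC lf_hyperplane (eh (inl (inl (i, k)))).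
  - by rewrite lfP_horner eU eV lf_hyperplane (eh (inl (inr (i, k)))).
  - by rewrite hornerC lf_hyperplane (eh (inr (inl (j, k)))).
  - rewrite hornerC lf_transverse coefD coefXM.
    case: (unliftP ord0 k) => [k'|] ->; last by rewrite /= add0r lf_coef0 (eh (inr (inr j))).
    by rewrite [_ == _]/= -[nat_of_ord (lift _ _)]/(k'.+1) (eg (inl (j, k'))) subrK.
  - rewrite horner_coef0 coef_drop_poly add0n rmorphD rmorphM /= lf_lastvar add0r mul1r.
    rewrite /eN lf_widen lf_const coefD coefXM coefC addr0 /= lf_coef0.
    exact: (eg (inr i)).
have [q [q0 hq]] := solvable_poly_open (@forms_subspace K n.+2 d.+1) lPhi s0.
have [s] : exists s, (q * 'X).[s] != 0.
  by apply: exists_nonroot; rewrite mulf_neq0 ?polyX_eq0.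
rewrite hornerM hornerX mulf_eq0 negb_or => /andP [qs sn0].
move/(_ s qs): hq => hq.
apply: (@general_lines_card K _ _ _ (('I_w + 'I_w) + (R + J))%type
  (fun t => match t with
    | inl (inl i) => ext (y p i) 0 | inl (inr i) => ext (y p i) s
    | inr (inl j) => ext (u p j) 0 | inr (inr j) => ext (a p j) 0 end)
  (fun t => match t with
    | inl (inl i) => ext (z p i) 0 | inl (inr i) => ext (z' p i) 0
    | inr (inl j) => ext (v p j) 0 | inr (inr j) => ext (b p j) 1 end)).
  by rewrite !card_sum !card_ord.
apply/config_solvableP => G c sG.
have [f [hf ef]] := hq (fun t => match t with
  | inl (inl (inl ik)) => (G (inl (inl ik.1)))`_ik.2
  | inl (inl (inr ik)) => (G (inl (inr ik.1)))`_ik.2.+1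
  | inl (inr (inl jk)) => (G (inr (inl jk.1)))`_jk.2
  | inl (inr (inr jk)) => (G (inr (inr jk.1)))`_jk.2
  | inr i => ((G (inl (inr i)))`_0 - (G (inl (inl i)))`_0) / s end).
have e1 i : lf (ext (y p i) 0) (ext (z p i) 0) f = G (inl (inl i)).
  apply: (@poly_eq_coefs d.+1) => // [|k]; first exact: size_lf.
  by have := ef (inl (inl (inl (i, k)))); rewrite /= hornerC.
exists f; split=> // -[[i|i]|[j|j]].
- exact: e1.
- apply: (@poly_eq_coefs d.+1) => // [|[[|k] lt]]; first exact: size_lf.
    rewrite /= lf_coef0.
    have -> : f.@[ext (y p i) s] = (lf (ext (y p i) 0) eN f).[s].
      rewrite lf_horner; congr (f.@[_]); apply: funext => l; rewrite /eN /ext.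
      by case: unlift => [l'|]; rewrite ?mulr0 ?addr0 // mulr1 add0r.
    have := ef (inr i); rewrite /= => e; set F := lf _ _ f in e *.
    have -> : F = (F`_0)%:P + drop_poly 1 F * 'X.
      by rewrite -[LHS](poly_take_drop 1) expr1; congr (_ + _); apply/polyP => -[|m];
        rewrite coef_take_poly coefC.
    rewrite hornerD hornerM hornerC hornerX e divfK // /F lf_coef0.
    by rewrite -(lf_coef0 _ (ext (z p i) 0)) e1 addrC subrK.
  by have := ef (inl (inl (inr (i, Ordinal (lt : (k < d.+1)%N))))); rewrite /= lfP_horner eU eV.
- apply: (@poly_eq_coefs d.+1) => // [|k]; first exact: size_lf.
  by have := ef (inl (inr (inl (j, k)))); rewrite /= hornerC.
apply: (@poly_eq_coefs d.+1) => // [|k]; first exact: size_lf.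
by have := ef (inl (inr (inr (j, k)))); rewrite /= hornerC.
Qed.

End Sundials.

(** * Construction of crossing pairs *)

Section CrossingLines.
Variable K : numFieldType.

Lemma cross_points n D (W R J : finType) (y z z' : W -> 'I_n.+1 -> K)
    (u v : R -> 'I_n.+1 -> K) :
  cross_solvable D y z z' u v (@no_points K n.+1) ->
  (#|W| * D.+1 + #|W| * D + #|R| * D.+1 + #|J| <= 'C(n + D, D))%N ->
  exists pts : J -> 'I_n.+1 -> K, cross_solvable D y z z' u v pts.
Proof.
move=> s le.
have [||||pts hp] := @solvable_points _ _ (W * 'I_D.+1 + W * 'I_D + (R * 'I_D.+1 + void))%type
    'I_('C(n + D, D)) ('I_n.+1 -> K) _ _ (fun c f => f.@[c]) #|J|
    (@forms_subspace K n.+1 D) _ _ _ (@forms_free K n D) _ s.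
- by case=> [[ik|ik]|[jk|[]]]; exact: coef_lf_scalar.
- by move=> c; exact: meval_scalar.
- by move=> f _ _; exact: meval_neq0.
- by rewrite !card_sum !card_prod card_void !card_ord addn0.
exists (fun j => pts (enum_rank j)).
refine (@solvable_reindex _ _ ((W * 'I_D.+1 + W * 'I_D + (R * 'I_D.+1 + void)) + 'I_#|J|)%type
  (W * 'I_D.+1 + W * 'I_D + (R * 'I_D.+1 + J))%type _ _ _
  (fun s => match s with inl ss => inl (inl ss) | inr (inl jk) => inl (inr (inl jk))
     | inr (inr j) => inr (enum_rank j) end)
  (fun s => match s with inl (inl ss) => inl ss | inl (inr (inl jk)) => inr (inl jk)
     | inl (inr (inr v)) => match v with end | inr i => inr (inr (enum_val i)) end)
  _ _ hp).
  by case=> [|[]] // j; rewrite enum_rankK.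
by case=> [|[]].
Qed.

Lemma config_points n D (L J : finType) (u v : L -> 'I_n.+1 -> K) :
  config_solvable D u v (@no_points K n.+1) ->
  (#|L| * D.+1 + #|J| <= 'C(n + D, D))%N ->
  exists pts : J -> 'I_n.+1 -> K, config_solvable D u v pts.
Proof.
move=> s le.
have [||||pts hp] := @solvable_points _ _ (L * 'I_D.+1 + void)%type
    'I_('C(n + D, D)) ('I_n.+1 -> K) _ _ (fun c f => f.@[c]) #|J|
    (@forms_subspace K n.+1 D) _ _ _ (@forms_free K n D) _ s.
- by case=> [jk|[]]; exact: coef_lf_scalar.
- by move=> c; exact: meval_scalar.
- by move=> f _ _; exact: meval_neq0.
- by rewrite !card_sum !card_prod card_void !card_ord addn0.
exists (fun j => pts (enum_rank j)).
refine (@solvable_reindex _ _ (L * 'I_D.+1 + void + 'I_#|J|)%type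
  (L * 'I_D.+1 + J)%type _ _ _
  (fun s => match s with inl jk => inl (inl jk) | inr j => inr (enum_rank j) end)
  (fun s => match s with inl (inl jk) => inl jk
     | inl (inr v) => match v with end | inr i => inr (enum_val i) end)
  _ _ hp).
  by case=> // j; rewrite enum_rankK.
by case.
Qed.

Definition cross_lines n D w r :=
  exists (R : finType) (y z z' : 'I_w -> 'I_n.+1 -> K) (u v : R -> 'I_n.+1 -> K),
    #|R| = r /\ cross_solvable D y z z' u v (@no_points K n.+1).

Lemma cross_lines0 n D r : general_lines K n D r -> cross_lines n D 0 r.
Proof.
move=> [u [v s]]; exists 'I_r.
have e : 'I_0 -> 'I_n.+1 -> K by case.
exists e, e, e, u, v; split; first by rewrite card_ord.
apply/cross_solvableP => G G' H c _ _ sH _.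
by move/config_solvableP: s => /(_ H c sH) [f [hf e1 e2]]; exists f; split=> // -[].
Qed.

(* Transversal lines starting on lines of the hyperplane. *)
Lemma hyperplane_cross n d w k t :
  general_lines K n.+1 d (w + k) -> general_lines K n d.+1 (w + t) ->
  ((w + t) * d.+2 + k <= 'C(n + d.+1, d.+1))%N ->
  cross_lines n.+1 d.+1 w (t + k).
Proof.
move=> h1 h2 le.
pose J := ('I_w + 'I_k)%type; pose L := ('I_w + 'I_t)%type.
pose T := ((J * bool + (L + 'I_t)) * 'I_n.+1)%type.
pose a (p : T -> K) j l := p (inl (j, false), l).
pose b (p : T -> K) j l := p (inl (j, true), l).
pose z (p : T -> K) i l := p (inr (inl i), l).
pose x (p : T -> K) (i : L) l :=
  match i with inl i => p (inl (inl i, false), l) | inr i => p (inr (inr i), l) end.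
pose C1 p := config_solvable d (fun j => ext (a p j) 0) (fun j => ext (b p j) 1)
  (@no_points K n.+2).
pose C2 p := config_solvable d.+1 (x p) (z p) (fun j => a p (inr j)).
have [p [p1 p2]] : exists p, C1 p /\ C2 p.
  have pc s : poly_along (fun p : T -> K => p s) by exact: poly_along_coord.
  apply: line_open_meet.
  - by apply: config_open => j l; [apply: poly_along_ext => i|apply: poly_along_ext => i|case: j];
      exact: pc.
  - by apply: config_open => [[j|j] l|j l|j l]; exact: pc.
  - have [|a1 [b1 s1]] := @general_transverse K n d J _ _ h1.
      by rewrite card_sum !card_ord.
    by exists (fun s => match s with
      | (inl (j, e), l) => if e then b1 j l else a1 j l | _ => 0 end).
  have [|x1 [z1 s1]] := @general_lines_fin K n d.+1 _ L _ h2.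
    by rewrite card_sum !card_ord.
  have [|pt s2] := @config_points n d.+1 L 'I_k _ _ s1.
    by rewrite card_sum !card_ord.
  pose p0 (s : T) : K := match s with
    | (inl (inl i, _), l) => x1 (inl i) l
    | (inl (inr j, _), l) => pt j l
    | (inr (inl i), l) => z1 i l
    | (inr (inr i), l) => x1 (inr i) l end.
  have ex : x p0 = x1 by apply: funext => -[].
  by exists p0; rewrite /C2 ex; exact: s2.
exists ('I_t + 'I_k)%type, (fun i => ext (a p (inl i)) 0), (fun i => ext (z p (inl i)) 0),
  (fun i => ext (b p (inl i)) 1),
  (fun s => match s with inl i => ext (x p (inr i)) 0 | inr j => ext (a p (inr j)) 0 end),
  (fun s => match s with inl i => ext (z p (inr i)) 0 | inr j => ext (b p (inr j)) 1 end).
split; first by rewrite card_sum !card_ord.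
apply/cross_solvableP => G G' H c sG sG' sH e0.
move/config_solvableP: p2 => /(_ (fun s => match s with
  | inl i => G i | inr i => H (inl i) end) (fun j => (H (inr j))`_0)) [|h [hh h2' h3]].
  by case.
pose tgt (j : J) := match j with inl i => G' i | inr j => H (inr j) end.
have [g [hg eg]] := p1 (fun s => match s with
  | inl jk => (tgt jk.1 - lf (a p jk.1) (b p jk.1) h)`_jk.2.+1
  | inr v => match v with end end).
have lift0 j : h.@[a p j] = (tgt j)`_0.
  case: j => [i|j]; last exact: h3.
  by rewrite /= -e0 -(h2' (inl i)) lf_coef0.
have fJ j : lf (ext (a p j) 0) (ext (b p j) 1) (lastvar K n.+1 * g + widen h) = tgt j.
  have st : (size (tgt j) <= d.+2)%N by case: j => [i|j]; [exact: sG'|exact: sH].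
  have hf : lastvar K n.+1 * g + widen h \is d.+1.-homog.
    by apply: rpredD; [exact: lastvar_homog|exact: widen_homog].
  apply: (@poly_eq_coefs K d.+1) => // [|[[|k'] lt]]; first exact: size_lf.
    by rewrite lf_transverse coefD coefXM /= add0r lf_coef0 lift0.
  rewrite lf_transverse coefD coefXM /=.
  by have := eg (inl (j, Ordinal (lt : (k' < d.+1)%N))); rewrite /= => ->; rewrite coefB subrK.
exists (lastvar K n.+1 * g + widen h); split.
- by apply: rpredD; [exact: lastvar_homog|exact: widen_homog].
- by move=> i; rewrite lf_hyperplane (h2' (inl i)).
- by move=> i; rewrite (fJ (inl i)).
- by case=> [i|j]; [rewrite lf_hyperplane (h2' (inr i))|rewrite (fJ (inr j))].
by case.
Qed.

End CrossingLines.

Section QuadricCross.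
Variable K : numFieldType.

(* Lines x = const of the quadric through endpoints of transversal lines. *)
Lemma quadric_cross d w k t :
  qlines K d (w + k) -> (w + t <= d.+3)%N ->
  (w + k * 2 <= (d.+3 - (w + t)) * d.+3)%N -> cross_lines K 3 d.+2 w (t + k).
Proof.
move=> h1 td card.
pose J := ('I_w + 'I_k)%type; pose T := (J * bool * bool)%type.
pose Y := ('I_w + 'I_k * bool)%type.
(* The first endpoint of each of the [w] lines is omitted from the trace points, because the ruling
   line through it already fixes the value there. *)
pose e (s : Y) : J * bool := match s with inl i => (inl i, true) | inr jb => (inr jb.1, jb.2) end.
pose C1 (p : T -> K) := qlines_solvable d p (of_void (K * K)).
pose C2 (p : T -> K) := forall j, slope_gap p j != 0.
pose C3 (p : T -> K) := solvable_on (@anymx K (d.+3 - (w + t)) d.+3)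
  (fun s M => bieval (qpt p (e s)) M).
pose C4 (p : T -> K) := forall i : 'I_w, (forall i', i != i' ->
  (qpt p (inl i, false)).1 - (qpt p (inl i', false)).1 != 0) /\
  (forall s, (qpt p (inl i, false)).1 - (qpt p (e s)).1 != 0).
have pc (s : T) : poly_along (fun p : T -> K => p s) by exact: poly_along_coord.
have o3 : line_open C3.
  apply: line_open_solvable; first by split.
  by apply: (@bieval_family K _ _ _ _ (fun p s => p (e s, false)) (fun p s => p (e s, true)))
    => s; exact: pc.
have o4 : line_open C4.
  apply: line_open_forall => i; apply: line_openI; apply: line_open_forall => s.
    by apply: line_open_impl; apply: line_open_neq0; apply: poly_alongD; [|apply: poly_alongN];
      exact: pc.
  by apply: line_open_neq0; apply: poly_alongD; [|apply: poly_alongN]; exact: pc.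
have [p [[[p1 p2] p3] p4]] : exists p, ((C1 p /\ C2 p) /\ C3 p) /\ C4 p.
  have o1 : line_open C1 by exact: qlines_open.
  have o2 : line_open C2 by exact: slope_gap_open.
  apply: line_open_meet => //; first by do 2![apply: line_openI => //].
    apply: line_open_meet => //; first exact: line_openI.
      apply: line_open_meet => //; last exact: slope_gap_exists.
      move: h1 => [q hq]; exists (fun jbb => match jbb with
        | (inl i, b, b') => q (lshift k i, b, b') | (inr j, b, b') => q (rshift w j, b, b') end).
      have := @qlines_cancel K d _ J void q _ (fun j => unsplit j) (fun i => Some (split i)) _ hq.
      move=> /(_ (fun j => congr1 Some (unsplitK j))) s.
      have -> // : (fun jbb => match jbb with
        | (inl i, b, b') => q (lshift k i, b, b')
        | (inr j, b, b') => q (rshift w j, b, b') end) =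
        (fun jbb => q (unsplit jbb.1.1, jbb.1.2, jbb.2)) by apply: funext => -[[[i|j] b] b'].
    have [|||xy h] := @bieval_finite_points K (d.+3 - (w + t)) d.+3 void Y
      (fun v => match v with end).
    - by case.
    - by rewrite card_void card_sum card_prod !card_ord card_bool.
    - by move=> c; exists 0; split=> // -[].
    exists (fun jbb => match jbb with
      | (inl i, b, b') => if b' then (xy (inl i)).2 else (xy (inl i)).1
      | (inr j, b, b') => if b' then (xy (inr (j, b))).2 else (xy (inr (j, b))).1 end).
    move=> c; have [M [M1 hM]] := h (fun s => match s with inl v => match v with end | inr i => c i end).
    exists M; split; first by [].
    by case=> [i|[j b]]; rewrite -[RHS](hM (inr _)) /qpt /= -surjective_pairing.
  have [f [If _]] := @exists_fresh K [::] #|{: J * bool}|.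
  exists (fun jbb => f (enum_rank jbb.1)) => i; split.
    move=> i' ne; rewrite subr_eq0 /qpt /=; apply: contraNneq ne => /If /enum_rank_inj [->].
    exact: eqxx.
  by case=> [i'|[j b]]; rewrite subr_eq0 /qpt /=; apply/eqP => /If /enum_rank_inj.
pose al i := (qpt p (inl i, false)).1.
have [be [ib hbe]] := @exists_fresh K [seq (qpt p jb).1 | jb <- enum {: J * bool}] t.
have bep jb j : (qpt p jb).1 != be j.
  by apply: contraNneq (hbe j) => <-; apply/mapP; exists jb; rewrite ?mem_enum.
pose a (i : 'I_(w + t)) := match split i with inl i => al i | inr j => be j end.
have al_neq i i' : i != i' -> al i != al i'.
  by move=> ne; have [h _] := p4 i; rewrite -subr_eq0; exact: h.
have ia : injective a.
  move=> i i'; rewrite /a -{2}(splitK i) -{2}(splitK i').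
  case: (split i) => [j|j]; case: (split i') => [j'|j'].
  - by move=> /eqP ee; congr (unsplit (inl _)); apply/eqP; apply: contraTT ee; exact: al_neq.
  - by move=> /eqP ee; have := bep (inl j, false) j'; rewrite -/(al j) ee.
  - by move=> /esym/eqP ee; have := bep (inl j', false) j; rewrite -/(al j') ee.
  - by move/ib => ->.
exists ('I_t + 'I_k)%type, (fun i => qvec (qpt p (inl i, false))),
  (fun i => xline_dir (al i)), (fun i => qvec (qpt p (inl i, true))),
  (fun s => match s with inl i => qr (be i) 0 | inr j => qvec (qpt p (inr j, false)) end),
  (fun s => match s with inl i => xline_dir (be i) | inr j => qvec (qpt p (inr j, true)) end).
split; first by rewrite card_sum !card_ord.
apply/cross_solvableP => G G' H c sG sG' sH e0.
pose tgt (j : J) := match j with inl i => G' i | inr j => H (inr j) end.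
have st j : (size (tgt j) <= d.+3)%N by case: j => [i|j]; [exact: sG'|exact: sH].
(* The ruling line of a pair starts at the common endpoint; composing with a shift returns to the
   coordinate y. *)
pose gx (i : 'I_(w + t)) := match split i with
  | inl i => G i \Po ('X - ((qpt p (inl i, false)).2)%:P) | inr j => H (inl j) end.
have [|||h [hh h1' h2]] := @quadric_trace K d.+2 (w + t) a _ (fun s => qpt p (e s)) gx (fun s =>
  (tgt (e s).1)`_(if (e s).2 then d.+2 else 0%N)) ia td.
- move=> s i; rewrite /a; case: (split i) => [i'|j]; last exact: bep.
  by rewrite eq_sym -subr_eq0; have [_] := p4 i'; apply.
- move=> i; rewrite /gx; case: (split i) => [i'|j]; last exact: sH.
  by rewrite (leq_trans (size_comp_poly_leq _ _)) // size_XsubC muln1; have := sG i'; lia.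
- exact: p3.
have hT i s : h.@[qr (al i) s] = (G i).[s - (qpt p (inl i, false)).2].
  have := h1' (lshift t i) s.
  by rewrite /a /gx (unsplitK (inl i : 'I_w + 'I_t)) horner_comp hornerXsubC.
have hB j s : h.@[qr (be j) s] = (H (inl j)).[s].
  by have := h1' (rshift w j) s; rewrite /a /gx (unsplitK (inr j : 'I_w + 'I_t)).
have [||F' [sF' hF']] := @add_quadric K d _ p h tgt p2 hh st.
- case=> [i|j]; last exact: (h2 (inr (j, false))).
  by rewrite /qvec -/(al i) hT subrr horner_coef0 e0.
- by case=> [i|j]; [exact: (h2 (inl i))|exact: (h2 (inr (j, true)))].
move/qlines_solvableP: p1 => /(_ F' (of_void _) sF') [g [hg q1 _]].
have onQ x y : (quadric K * g + h).@[qr x y] = h.@[qr x y].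
  by rewrite mevalD mevalM quadric_qr mul0r add0r.
exists (quadric K * g + h); split.
- apply: rpredD => //; rewrite -[d.+2]/(2 + d)%N.
  by apply: dhomogM => //; exact: quadric_homog.
- move=> i; apply: poly_ext => s; rewrite lf_horner.
  have -> : (fun l => qvec (qpt p (inl i, false)) l + s * xline_dir (al i) l) =
      qr (al i) ((qpt p (inl i, false)).2 + s).
    apply: funext; case=> [[|[|[|[|//]]]] lt]; rewrite /qvec /qr /xline_dir /= -/(al i) ?mulr0 ?addr0 ?mulr1 //.
    by rewrite mulrDr [s * _]mulrC.
  by rewrite onQ hT addrAC subrr add0r.
- by move=> i; rewrite (hF' g q1 (inl i)).
- case=> [i|j]; last by rewrite (hF' g q1 (inr j)).
  by apply: poly_ext => s; rewrite meval_xline onQ hB.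
by case.
Qed.

End QuadricCross.

(** * Numerical splitting and induction on the dimension *)

Section Counting.
Local Open Scope nat_scope.

Lemma bin2_mul s : 2 * 'C(s, 2) = s * (s - 1).
Proof.
by have := bin_ffact s 2; rewrite -[2`!]/2 mulnC => ->; rewrite !ffactnS ffactn0; nia.
Qed.

Lemma bin3_mul s : 6 * 'C(s, 3) = s * (s - 1) * (s - 2).
Proof.
by have := bin_ffact s 3; rewrite -[3`!]/6 mulnC => ->; rewrite !ffactnS ffactn0; nia.
Qed.

(** The bound is ['C(a + b, 2)], attained at a = 2 and b = 2 and propagated inward by Pascal's
    rule. *)
Lemma bin_ge_quadratic a b : 2 <= a -> 2 <= b ->
  (a + b) * (a + b - 1) <= 2 * 'C(a + b, a).
Proof.
have [s hs] := ubnP (a + b); elim: s a b hs => // s IH a b hs ha hb.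
have [->|na] := eqVneq a 2; first by rewrite bin2_mul.
have [->|nb] := eqVneq b 2.
  have -> : 'C(a + 2, a) = 'C(a + 2, 2) by rewrite -[RHS]bin_sub ?leq_addl // addnK.
  by rewrite bin2_mul.
case: a b hs ha hb na nb => // a [|b] // hs ha hb na nb.
rewrite addSn binS.
have := IH a b.+1; have := IH a.+1 b; rewrite addSnnS => /(_ _ _ _) h1 /(_ _ _ _) h2.
have {}h1 := h1 ltac:(lia) ltac:(lia) ltac:(lia).
have {}h2 := h2 ltac:(lia) ltac:(lia) ltac:(lia).
by move: h1 h2; nia.
Qed.

Lemma bin_ge_cubic a b : 3 <= a -> 3 <= b ->
  (a + b) * (a + b - 1) * (a + b - 2) <= 6 * 'C(a + b, a).
Proof.
have [s hs] := ubnP (a + b); elim: s a b hs => // s IH a b hs ha hb.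
have [->|na] := eqVneq a 3; first by rewrite bin3_mul.
have [->|nb] := eqVneq b 3.
  have -> : 'C(a + 3, a) = 'C(a + 3, 3) by rewrite -[RHS]bin_sub ?leq_addl // addnK.
  by rewrite bin3_mul.
case: a b hs ha hb na nb => // a [|b] // hs ha hb na nb.
rewrite addSn binS.
have := IH a b.+1; have := IH a.+1 b; rewrite addSnnS => /(_ _ _ _) h1 /(_ _ _ _) h2.
have {}h1 := h1 ltac:(lia) ltac:(lia) ltac:(lia).
have {}h2 := h2 ltac:(lia) ltac:(lia) ltac:(lia).
set S := a + b.+1 in h1 h2 *; have S6 : 6 <= S.+1 by rewrite /S; lia.
have -> : S.+1 * (S.+1 - 1) * (S.+1 - 2) = S * (S - 1) * S.+1 by nia.
apply: (@leq_trans (2 * (S * (S - 1) * (S - 2)))); last by lia.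
by rewrite [2 * _]mulnCA leq_mul2l; apply/orP; right; lia.
Qed.

Definition max_lines N d := 'C(N + d, d) %/ d.+1.
Definition waste N d := 'C(N + d, d) %% d.+1.

Lemma max_lines_waste N d : max_lines N d * d.+1 + waste N d = 'C(N + d, d).
Proof. by rewrite -divn_eq. Qed.

Lemma leq_max_lines N d m : (m * d.+1 <= 'C(N + d, d)) = (m <= max_lines N d).
Proof. by rewrite leq_divRL. Qed.

(** Division of ['C(n.+1 + d, d)] by d + 1 and of ['C(n.+1 + d, n)] by n + 1 give the same rational
    number, so the quotients agree and the remainders are proportional. This turns the waste into a
    remainder [rho] bounded independently of d. *)
Lemma max_lines_spec n d : exists rho, [/\ rho <= n,
  n.+1 * max_lines n.+1 d + rho = 'C(n.+1 + d, n) & n.+1 * waste n.+1 d = d.+1 * rho].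
Proof.
have e : n.+1 * 'C(n.+1 + d, d) = d.+1 * 'C(n.+1 + d, n).
  have -> : 'C(n.+1 + d, d) = 'C(n.+1 + d, n.+1) by rewrite -[RHS]bin_sub ?leq_addr // addKn.
  rewrite mul_bin_left.
  by congr (_ * _); lia.
have h1 := divn_eq 'C(n.+1 + d, n) n.+1; have h2 := max_lines_waste n.+1 d.
have l1 := ltn_pmod 'C(n.+1 + d, n) (ltn0Sn n).
have l2 : waste n.+1 d < d.+1 by exact: ltn_pmod.
exists ('C(n.+1 + d, n) %% n.+1); move: e h1 h2 l1 l2.
move: ('C(n.+1 + d, n)) ('C(n.+1 + d, d)) => A C.
move: (A %/ n.+1) (A %% n.+1) (max_lines n.+1 d) (waste n.+1 d) => q r M W e h1 h2 l1 l2.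
have e2 : n.+1 * d.+1 * M + n.+1 * W = n.+1 * d.+1 * q + d.+1 * r by nia.
have b1 : n.+1 * W < n.+1 * d.+1 by rewrite ltn_pmul2l.
have b2 : d.+1 * r < n.+1 * d.+1 by rewrite mulnC ltn_pmul2r.
have Mq : M = q.
  case: (ltngtP M q) => // lt.
    have : n.+1 * d.+1 * M.+1 <= n.+1 * d.+1 * q by rewrite leq_mul2l lt orbT.
    by rewrite mulnS; lia.
  have : n.+1 * d.+1 * q.+1 <= n.+1 * d.+1 * M by rewrite leq_mul2l lt orbT.
  by rewrite mulnS; lia.
by split; [lia|rewrite Mq; lia|rewrite Mq in e2; lia].
Qed.

End Counting.

Section Splitting.
Local Open Scope nat_scope.

Lemma max_lines_step n d : exists rho rho', [/\ rho <= n.+1, rho' <= n.+1,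
  n.+2 * waste n.+2 d = d.+1 * rho &
  n.+2 * max_lines n.+2 d.+1 + rho' =
  n.+2 * max_lines n.+2 d + rho + 'C(n.+2 + d, n)].
Proof.
have [rho [h1 h2 h3]] := max_lines_spec n.+1 d.
have [rho' [h1' h2' h3']] := max_lines_spec n.+1 d.+1.
by exists rho, rho'; split=> //; rewrite h2 h2' addnS binS.
Qed.

(** The lines to be placed in P^3 are 2 w lines in crossing pairs, t more of the ruling and k more
    transversals; the bounds are those of [quadric_cross]. The choice is greedy: transversals up to
    [f], their maximal number in degree d - 1, and only the excess on the quadric. *)
Lemma quadric_split d : 1 <= d -> 0 < waste 4 d ->
  exists k t, [/\ 2 * waste 4 d + t + k = max_lines 4 d.+1 - max_lines 4 d,
    6 * (waste 4 d + k) <= (d + 1) * (d + 2), waste 4 d + t <= d.+2 &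
    waste 4 d + k * 2 <= (d.+2 - (waste 4 d + t)) * d.+2].
Proof.
move=> d1 w0; have [rho [rho' [h1 h2 h3 h4]]] := max_lines_step 2 d.
have := bin2_mul (4 + d); move: h3 h4 w0.
move: ('C(_, _)) (waste 4 d) (max_lines 4 d.+1) (max_lines 4 d) => B w M' M.
move=> hw hM w0 hB; set t := M' - M.
have MM' : M <= M' by lia.
have ht1 : 4 * t <= B + rho by rewrite /t; lia.
have ht2 : B + rho < 4 * (t + 1) by rewrite /t; lia.
have q0 : 5 * d <= d * d + 6.
  have [h|h] := leqP d 2; first by case: d h {hw hM w0 hB ht1 ht2 h1 h2 d1 B} => [|[|[|]]].
  have [u ->] : exists u, d = u + 3 by exists (d - 3); lia.
  by nia.
have hB' : 2 * B = d * d + 7 * d + 12 by rewrite hB; nia.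
have r3 x : rho * x <= 3 * x by apply: leq_mul => //; lia.
have tw : 2 * w <= t.
  by rewrite leqNgt; apply/negP => lt; have := r3 (4 * d + 2); lia.
have e4w : 4 * w = rho * d + rho by rewrite hw; lia.
have e4wd : 4 * (w * d) = rho * (d * d) + rho * d by rewrite mulnA e4w; lia.
have := r3 d; have := r3 (d * d) => r3dd r3d.
have kw : 6 * w <= (d + 1) * (d + 2).
  have [dle|dgt] := leqP d 2.
    by have [?|?] : d = 1 \/ d = 2 by [lia]; subst d; lia.
  have : 3 * d <= d * d by apply: leq_mul.
  by lia.
pose f := ((d + 1) * (d + 2)) %/ 6.
have ef := divn_eq ((d + 1) * (d + 2)) 6; have lf := ltn_pmod ((d + 1) * (d + 2)) (isT : 0 < 6).
rewrite -/f in ef; set g := _ %% _ in ef lf.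
have wf : w <= f by rewrite leq_divRL // mulnC.
have [le|lt] := leqP (t - w) f.
  exists (t - w - w), 0; split; [lia|lia|lia|].
  have [u hu] : exists u, d + 2 = w + u by exists (d + 2 - w); lia.
  have eu : w * (d + 2) + u * (d + 2) = (d + 2) * (d + 2) by rewrite -mulnDl -hu.
  have -> : (d.+2 - (w + 0)) * d.+2 = u * (d + 2) by congr (_ * _); lia.
  by lia.
exists (f - w), (t - f - w).
have tf : t - f <= d + 2.
  have [dle|] := leqP d 1; last by lia.
  by have e : d = 1 by [lia]; rewrite e in hB' ef *; lia.
split; [lia|lia|lia|].
have [u hu] : exists u, d + 2 = t - f + u by exists (d + 2 - (t - f)); lia.
have -> : (d.+2 - (w + (t - f - w))) * d.+2 = u * (d + 2) by congr (_ * _); lia.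
have eu : (t - f) * (d + 2) + u * (d + 2) = (d + 2) * (d + 2) by rewrite -mulnDl -hu.
have etf : (t - f) * (d + 2) + f * (d + 2) = t * (d + 2) by rewrite -mulnDl subnK //; lia.
have H2 : 8 * t * d <= (d * d + 7 * d + 12 + 2 * rho) * d by apply: leq_mul => //; lia.
have H3 : (d + 1) * (d + 2) * d <= (f * 6 + 5) * d by apply: leq_mul => //; lia.
by lia.
Qed.

Lemma cubic_bound_lines n d : 3 <= n -> 1 <= d ->
  n.+1 * (2 * d + 1) * 6 <= (n + d + 2) * (n + d + 1) * (n + d).
Proof.
move=> n3 d1; have [x ->] : exists x, n = x + 3 by exists (n - 3); lia.
by have [y ->] : exists y, d = y + 1 by [exists (d - 1); lia]; nia.
Qed.

Lemma cubic_bound_trace n d : 3 <= n -> 1 <= d ->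
  2 * (n.+1 * n.+1) + 2 * (n * n.+2 * d.+1) <= (n.+1 + d) * (n + d) * (n + d + 2).
Proof.
move=> n3 d1; have [x ->] : exists x, n = x + 3 by exists (n - 3); lia.
by have [y ->] : exists y, d = y + 1 by [exists (d - 1); lia]; nia.
Qed.

Lemma quadratic_bound n d : 3 <= n -> 1 <= d ->
  2 * (n.+1 * (d + 1)) <= (n.+1 + d) * (n + d).
Proof.
move=> n3 d1; have [x ->] : exists x, n = x + 3 by exists (n - 3); lia.
by have [y ->] : exists y, d = y + 1 by [exists (d - 1); lia]; nia.
Qed.

Lemma cubic_bound_degree d : 1 <= d ->
  9 * (1 + d + d * d) <= (d + 4) * (d + 3) * (d + 2).
Proof.
by move=> d1; have [y ->] : exists y, d = y + 1 by [exists (d - 1); lia]; nia.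
Qed.

Lemma quadratic_bound_base n E : 3 <= n -> (n + 2) * (n + 1) <= 2 * E -> 60 <= 6 * E.
Proof. by move=> n3; have [x ->] : exists x, n = x + 3 by [exists (n - 3); lia]; nia. Qed.

(** The greedy choice of [quadric_split] again. The pairs lie in P^(n+1), and the binomial counts
    forms of degree d + 1 on a hyperplane of it, where the w + t lines and the traces of the k
    remaining transversals have to fit. *)
Lemma hyperplane_split n d : 3 <= n -> 1 <= d ->
  exists k t, [/\ 2 * waste n.+2 d + t + k = max_lines n.+2 d.+1 - max_lines n.+2 d,
    waste n.+2 d + k <= max_lines n.+1 d &
    (waste n.+2 d + t) * d.+2 + k <= 'C(n.+1 + d, n)].
Proof.
move=> n3 d1; have [rho [rho' [h1 h2 h3 h4]]] := max_lines_step n d.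
have [r [hr h5 _]] := max_lines_spec n d.
have hB : 'C(n.+2 + d, n) = 'C(n.+1 + d, n) + 'C(n.+1 + d, n.-1).
  by case: n n3 {h1 h2 h3 h4 hr h5} => // n _; rewrite addSn binS.
have hF : d.+2 * 'C(n.+1 + d, n.-1) = n * 'C(n.+1 + d, n).
  by case: n n3 {h1 h2 h3 h4 hr h5 hB} => // n _; rewrite mul_bin_left; congr (_ * _); lia.
have E2 : (n.+1 + d) * (n + d) <= 2 * 'C(n.+1 + d, n).
  have := @bin_ge_quadratic n d.+1; rewrite addnS -addSn => h.
  by apply: leq_trans (h _ _); [rewrite leq_mul2l; apply/orP; right; lia|lia|lia].
have B3 : (n + d + 2) * (n + d + 1) * (n + d) <= 6 * 'C(n.+2 + d, n).
  have := @bin_ge_cubic n d.+2; rewrite !addnS -!addSn => h.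
  by apply: leq_trans (h _ _); [apply: leq_mul; [apply: leq_mul|]; lia|lia|lia].
have E3 : (d + 4) * (d + 3) * (d + 2) <= 6 * 'C(n.+1 + d, n).
  have [dle|dgt] := leqP d 1.
    have e : d = 1 by lia.
    subst d; apply: (@quadratic_bound_base n) => //; move: E2; rewrite !addn1; lia.
  have := @bin_ge_cubic n d.+1; rewrite addnS -addSn => h.
  by apply: leq_trans (h _ _); [apply: leq_mul; [apply: leq_mul|]; lia|lia|lia].
move: h3 h4 h5 hB hF E2 B3 E3.
move: ('C(n.+2 + d, n)) ('C(n.+1 + d, n)) ('C(n.+1 + d, n.-1)) => B E F.
move: (waste n.+2 d) (max_lines n.+2 d.+1) (max_lines n.+2 d) (max_lines n.+1 d) => w M' M mx.
move=> hw hM hE hB hF E2 B3 E3; set t := M' - M.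
have b1 : (n.+1) * (2 * d + 1) <= B.
  rewrite -(leq_pmul2r (isT : 0 < 6)) [B * 6]mulnC.
  exact: leq_trans (cubic_bound_lines n3 d1) B3.
have MM' : M <= M' by rewrite -(leq_pmul2l (isT : 0 < n.+2)); lia.
have ht : n.+2 * t + n.+2 * M = n.+2 * M' by rewrite -mulnDr subnK.
have rb z : rho * z <= n.+1 * z by rewrite leq_mul2r h1 orbT.
have tw : 2 * w <= t.
  rewrite -ltnS -(ltn_pmul2l (isT : 0 < n.+2)).
  have -> : n.+2 * (2 * w) = rho * (2 * d + 1) + rho by rewrite mulnCA hw; lia.
  by have := rb (2 * d + 1); lia.
have wm : w <= mx.
  rewrite -ltnS -(ltn_pmul2l (isT : 0 < n.+1)).
  have := leq_trans (quadratic_bound n3 d1) E2; move: (rb (d + 1)) hw hE hr; clear; lia.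
have ht1 : n.+2 * t <= E + F + rho by lia.
have [le|lt] := leqP (t - w) mx.
  exists (t - w - w), 0; split; [lia|lia|].
  suff : w * d + t <= E by lia.
  rewrite -(leq_pmul2l (isT : 0 < n.+2)).
  have -> : n.+2 * (w * d + t) = rho * (d * d + d) + n.+2 * t by rewrite mulnDr mulnA hw; lia.
  have := rb (d * d + d) => r1.
  have F3 : 3 * F <= n * E by rewrite -hF leq_mul2r; apply/orP; right; lia.
  have E4 : 3 * (1 + d + d * d) <= 2 * E.
    by have := leq_trans (cubic_bound_degree d1) E3; clear; lia.
  have := leq_mul (leqnn n.+1) E4; move: r1 F3 ht1 h1; clear; lia.
exists (mx - w), (t - mx - w); split; [lia|lia|].
suff : t * d.+2 <= E + w + mx * d.+1.
  have -> : w + (t - mx - w) = t - mx by lia.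
  have : (t - mx) * d.+2 + mx * d.+2 = t * d.+2 by rewrite -mulnDl subnK //; lia.
  by lia.
(* The factors n + 1 and n + 2 turn [mx] and [t] into binomials up to the small remainders [r] and
   [rho]. *)
rewrite -(leq_pmul2l (isT : 0 < n.+1)) -(leq_pmul2l (isT : 0 < n.+2)).
have l1 := leq_mul (leqnn (n.+1 * d.+2)) ht1.
have l2 : (n.+1 * d.+2) * F = n.+1 * (n * E) by rewrite -mulnA hF.
have l3 : n.+2 * (d.+1 * (n.+1 * mx)) + n.+2 * (d.+1 * r) = n.+2 * (d.+1 * E).
  by rewrite -!mulnDr hE.
have l4 : n.+2 * (d.+1 * r) <= n.+2 * (d.+1 * n) by rewrite !leq_mul2l hr !orbT.
have l5 := rb n.+1.
have l6 : n.+1 * (n.+2 * w) = n.+1 * (d.+1 * rho) by rewrite hw.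
have l7 : 2 * (n.+1 * n.+1) + 2 * (n * n.+2 * d.+1) <= 2 * (E * (n + d + 2)).
  rewrite [2 * (E * _)]mulnA; apply: leq_trans (leq_mul E2 (leqnn _)).
  exact: cubic_bound_trace.
move: l1 l2 l3 l4 l5 l6 l7; clear; lia.
Qed.

End Splitting.

(** * Induction on the dimension and the degree *)

Section LinesInProjectiveSpace.
Variable K : numFieldType.

Lemma general_lines_of_qlines d k : qlines K d k -> general_lines K 3 d k.
Proof.
move=> [p hp]; exists (fun j => qvec (qpt p (j, false))), (fun j => qvec (qpt p (j, true))).
have -> // : @no_points K 4 = (fun i => qvec (of_void (K * K) i)) by apply: funext => -[].
Qed.

Lemma general_lines_degree0 n m : (m <= 1)%N -> general_lines K n 0 m.
Proof.
move=> m1; exists (fun _ _ => 0), (fun _ _ => 0); apply/config_solvableP => G c sG.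
pose g := if insub 0%N is Some j then (G j)`_0 else 0.
exists g%:MP; split; [|move=> j|by case].
  by rewrite -[_%:MP]mulr1 mul_mpolyC; apply: dhomogZ; exact: dhomog1.
rewrite lfC [RHS](size1_polyC (sG j)) /g.
have -> : insub 0%N = Some j; last by [].
rewrite -[RHS]valK; congr insub; apply/esym/eqP; rewrite -leqn0 -ltnS.
exact: leq_trans (ltn_ord j) m1.
Qed.

Lemma cross_lines_exist n d : (3 <= n)%N ->
  (forall D m, (m * D.+1 <= 'C(n + D, D))%N -> general_lines K n D m) ->
  (3 < n -> forall D m, (m * D.+1 <= 'C(n.-1 + D, D))%N -> general_lines K n.-1 D m)%N ->
  (0 < waste n.+1 d)%N ->
  exists r, (2 * waste n.+1 d + r = max_lines n.+1 d.+1 - max_lines n.+1 d)%N /\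
    cross_lines K n d.+1 (waste n.+1 d) r.
Proof.
move=> n3 IHn IHp w0.
have d1 : (1 <= d)%N by case: d w0 => //; rewrite /waste modn1.
have [en|ngt] := eqVneq n 3.
  subst n; have [k [t [e h1 h2 h3]]] := quadric_split d1 w0.
  exists (t + k)%N; split; first by rewrite addnA.
  case: d d1 w0 e h1 h2 h3 => // d _ w0 e h1 h2 h3.
  apply: quadric_cross => //; apply: qlines_exist.
  have -> : (d + 2 = d.+1 + 1)%N by lia.
  by have -> : (d + 3 = d.+1 + 2)%N by lia.
case: n n3 IHn IHp w0 ngt => // n n3 IHn IHp w0 ngt.
have [|k [t [e h1 h2]]] := @hyperplane_split n d _ d1; first by lia.
exists (t + k)%N; split; first by rewrite addnA.
have eb : 'C(n + d.+1, d.+1) = 'C(n.+1 + d, n).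
  by rewrite addnS -addSn -[RHS]bin_sub; [congr 'C(_, _); lia|lia].
apply: hyperplane_cross.
- by apply: IHn; rewrite leq_max_lines.
- by apply: IHp; [lia|rewrite eb; lia].
- by rewrite eb.
Qed.

(** Used twice: to have at least as many lines in degree d + 1 as in degree d, and to find a
    separate line for each of the missing conditions in [residual_config]. *)
Lemma waste_bound n d : (3 <= n)%N ->
  (max_lines n.+1 d + waste n.+1 d <= max_lines n.+1 d.+1)%N.
Proof.
case: n => // n n3; have [rho [rho' [h1 h2 h3 h4]]] := max_lines_step n d.
have := @bin_ge_quadratic n d.+2; rewrite (_ : n + d.+2 = n.+2 + d)%N; last by lia.
move=> /(_ n3 isT) h; move: h3 h4 h.
move: ('C(_, _)) (waste _ _) (max_lines _ _) (max_lines _ _) => B w M' M h3 h4 h.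
rewrite -(leq_pmul2l (isT : (0 < n.+2)%N)) mulnDr h3.
have q : (2 * (d.+1 * n.+1) <= (n.+2 + d) * (n.+2 + d - 1))%N.
  by rewrite (_ : n.+2 + d - 1 = n.+1 + d)%N; [nia|lia].
have r1 : (d * rho <= d * n.+1)%N by rewrite leq_mul2l h1 orbT.
by move: h2 h4 h q r1; clear; lia.
Qed.

(** Of the M' lines, M cross the hyperplane; with the w points left by the crossing pairs they
    exhaust the residual degree. The other M' - M lines are specialized into the hyperplane. *)
Lemma general_lines_step n : (3 <= n)%N ->
  (forall D m, (m * D.+1 <= 'C(n + D, D))%N -> general_lines K n D m) ->
  (3 < n -> forall D m, (m * D.+1 <= 'C(n.-1 + D, D))%N -> general_lines K n.-1 D m)%N ->
  forall D m, (m * D.+1 <= 'C(n.+1 + D, D))%N -> general_lines K n.+1 D m.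
Proof.
move=> n3 IHn IHp; elim/ltn_ind => D IH m hm.
case: D IH hm => [|d] IH hm; first by apply: general_lines_degree0; rewrite bin0 muln1 in hm.
have mono := leq_trans (leq_addr _ _) (waste_bound d n3).
pose M := max_lines n.+1 d; pose M' := max_lines n.+1 d.+1; pose w := waste n.+1 d.
rewrite -/M -/M' in mono.
have eM : (M * d.+1 + w = 'C(n.+1 + d, d))%N by exact: max_lines_waste.
have eP : 'C(n.+1 + d.+1, d.+1) = ('C(n.+1 + d, d) + 'C(n + d.+1, d.+1))%N.
  by rewrite addnS binS addnC -addSnnS.
have leM' : (M' * d.+2 <= 'C(n.+1 + d.+1, d.+1))%N by rewrite leq_max_lines.
apply: (@general_lines_leq K _ _ M'); first by rewrite -leq_max_lines.
have gM : general_lines K n.+1 d M by apply: IH => //; rewrite leq_max_lines.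
have tM : (M' = M' - M + M)%N by rewrite subnK.
have eT : ((M' - M) * d.+2 + M <= 'C(n + d.+1, d.+1) + w)%N.
  have h : ((M' - M) * d.+2 + M * d.+2 = M' * d.+2)%N by rewrite -mulnDl -tM.
  by move: leM' eM eP h; rewrite [(M * d.+2)%N]mulnS; lia.
have [w0|w0] := posnP w.
  have trace : cross_lines K n d.+1 0 (M' - M).
    by apply: cross_lines0; apply: IHn; move: eT; rewrite w0; lia.
  have [R [y [z [z' [u [v [cR s]]]]]]] := trace.
  have -> : M' = (0 + 0 + (#|R| + #|'I_M|))%N by rewrite cR card_ord; lia.
  apply: delta_step.
    have [|a [b hab]] := @general_transverse K n d 'I_M _ _ gM; first by rewrite card_ord.
    have e0 : 'I_0 -> 'I_n.+1 -> K by case.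
    exists a, b, e0; apply/config_solvableP => G c sG.
    move/config_solvableP: hab => /(_ G (fun v => match v with end) sG) [f [hf e1 _]].
    by exists f; split=> // -[].
  have [|pts hp] := @cross_points K n d.+1 'I_0 R 'I_M y z z' u v s.
    by rewrite !card_ord !mul0n !add0n cR; move: eT; rewrite w0; lia.
  by exists y, z, z', u, v, pts.
have [r [er [R [y [z [z' [u [v [cR s]]]]]]]]] := cross_lines_exist n3 IHn IHp w0.
rewrite -/w -/M -/M' in er s *.
have er' : (2 * w + #|R| = M' - M)%N by rewrite cR.
have d1 : d = d.-1.+1.
  by case: (posnP d) => [d0|/prednK //]; move: w0; rewrite /w /waste d0 modn1.
pose M2 := max_lines n.+1 d.-1; pose w2 := waste n.+1 d.-1.
have M2le : (M2 + w2 <= M)%N by rewrite /M {1}d1; exact: waste_bound.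
(* Splitting of the M lines demanded by [residual_config]: [M2] lines and a point on each of [w2]
   others leave no form of degree d - 1. *)
pose J := ('I_M2 + 'I_w2 + 'I_(M - (M2 + w2)))%type.
have cJ : #|{: J}| = M by rewrite !card_sum !card_ord; lia.
have [|pts hp] := @cross_points K n d.+1 _ R J y z z' u v s.
  have h : ((M' - M) * d.+2 = w * 2 * d.+2 + #|R| * d.+2)%N by rewrite -er' mulnDl [(2 * w)%N]mulnC.
  by rewrite cJ card_ord; move: h eT; rewrite [(w * d.+2)%N]mulnS; lia.
have -> : M' = (w + w + (#|R| + #|{: J}|))%N by rewrite cJ; lia.
apply: delta_step; last by exists y, z, z', u, v, pts.
have e1 : (M2 * d + w2 = 'C(n.+1 + d.-1, d.-1))%N by rewrite {1}d1; exact: max_lines_waste.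
rewrite d1; apply: residual_config.
- by rewrite -d1 subnKC.
- by apply: IH; [lia|rewrite leq_max_lines].
- by rewrite -d1.
- by rewrite -d1 subnKC // eM.
Qed.

Theorem general_lines_exist n d m : (3 <= n)%N -> (m * d.+1 <= 'C(n + d, d))%N ->
  general_lines K n d m.
Proof.
elim/ltn_ind: n d m => n IH d m n3.
have [en|ngt] := eqVneq n 3.
  subst n => hm; apply: general_lines_of_qlines; apply: qlines_exist.
  have := bin3_mul (3 + d); have -> : 'C(3 + d, 3) = 'C(3 + d, d).
    by rewrite -[RHS]bin_sub ?leq_addl // addnK.
  move: hm; move: ('C(_, _)) => B h1 h2.
  rewrite -(leq_pmul2r (ltn0Sn d)); move: h1 h2.
  have -> : (3 + d - 1 = d + 2)%N by lia.
  by have -> : (3 + d - 2 = d.+1)%N by [lia]; lia.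
case: n n3 ngt IH => // n n3 ngt IH.
apply: general_lines_step; first by lia.
- by move=> D m' hm; apply: IH => //; lia.
- by move=> n4 D m' hm; apply: IH => //; lia.
Qed.

End LinesInProjectiveSpace.

(** * From special lines to independent coefficients *)

Section GraphForm.
Variable K : numFieldType.

(** Exchanging the two points exchanges the homogeneous parameters, which reverses the
    coefficients. *)
Lemma lf_swap N d (u v : 'I_N -> K) f : f \is d.-homog ->
  lf v u f = \poly_(k < d.+1) (lf u v f)`_(d - k).
Proof.
move=> hf; apply: (@poly_ext_off _ _ _ 'X) => [|s]; first by rewrite polyX_eq0.
rewrite hornerX => s0; rewrite horner_poly (reindex_inj rev_ord_inj) /=.
have -> : (lf v u f).[s] = s ^+ d * (lf u v f).[s^-1].
  rewrite !lf_horner -(meval_homogZ _ _ hf); congr (f.@[_]); apply: funext => i.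
  by rewrite mulrDr mulrA mulfV // mul1r addrC.
rewrite (horner_coef_wide _ (size_lf u v hf)) mulr_sumr; apply: eq_bigr => k _.
have kd : (k <= d)%N by rewrite -ltnS.
rewrite subSS subKn //= mulrCA; congr (_ * _).
by rewrite -{1}(subnK (leq_ord k)) exprD -mulrA -exprMn mulfV // expr1n mulr1.
Qed.

Lemma config_swap N d (J I : Type) (u v : J -> 'I_N -> K) (pts : I -> 'I_N -> K) :
  config_solvable d u v pts -> config_solvable d v u pts.
Proof.
move=> /config_solvableP s; apply/config_solvableP => G c sG.
have [|f [hf e1 e2]] := s (fun j => \poly_(k < d.+1) (G j)`_(d - k)) c.
  by move=> j; exact: size_poly.
exists f; split=> // j; rewrite (lf_swap (u j) _ hf) e1.
apply: (@poly_eq_coefs K d) => // k.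
by rewrite coef_poly ltn_ord coef_poly ltnS leq_subr subKn // -ltnS.
Qed.

Definition is_graph_frame q (u v : 'I_q.+3 -> K) :=
  [/\ u ord0 = 1, u (lift ord0 ord0) = 0, v ord0 = 0 & v (lift ord0 ord0) = 1].

(** A general line is a graph over its first two coordinates. The elimination on its two points uses
    shifts, swaps and scalings, which preserve independence. *)
Lemma general_graph_lines q d m : general_lines K q.+2 d m ->
  exists u v : 'I_m -> 'I_q.+3 -> K,
    config_solvable d u v (@no_points K q.+3) /\ forall i, is_graph_frame (u i) (v i).
Proof.
move=> [u [v s]]; pose i1 : 'I_q.+3 := lift ord0 ord0.
pose C1 (p : 'I_m * bool * 'I_q.+3 -> K) := config_solvable d
  (fun j l => p (j, false, l)) (fun j l => p (j, true, l)) (@no_points K q.+3).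
pose C2 (p : 'I_m * bool * 'I_q.+3 -> K) := forall j, p (j, true, i1) != 0.
pose C3 (p : 'I_m * bool * 'I_q.+3 -> K) := forall j,
  p (j, false, ord0) * p (j, true, i1) - p (j, false, i1) * p (j, true, ord0) != 0.
have pc t : poly_along (fun p : 'I_m * bool * 'I_q.+3 -> K => p t) by exact: poly_along_coord.
have o2 : line_open C2 by apply: line_open_forall => j; apply: line_open_neq0.
have o3 : line_open C3.
  apply: line_open_forall => j; apply: line_open_neq0; apply: poly_alongD.
    exact: poly_alongM.
  by apply: poly_alongN; exact: poly_alongM.
have [p [p1 [p2 p3]]] : exists p, C1 p /\ C2 p /\ C3 p.
  apply: line_open_meet; [|exact: line_openI| |].
  - by apply: config_open => j l //; case: j.
  - by exists (fun jbl => if jbl.1.2 then v jbl.1.1 jbl.2 else u jbl.1.1 jbl.2).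
  exists (fun jbl => if jbl.1.2 then (jbl.2 == i1)%:R else (jbl.2 == ord0)%:R).
  by split=> j; rewrite /= ?eqxx /= ?mulr1 ?mul0r ?subr0 ?oner_eq0.
pose U j l := p (j, false, l); pose V j l := p (j, true, l).
have s1 := config_shift (fun j => - (U j i1 / V j i1)) p1.
set U1 := (fun j i => _) in s1; rewrite -/(V _) in s1.
have U11 j : U1 j i1 = 0 by rewrite /U1 mulNr divfK ?subrr //; exact: p2.
have U10 j : U1 j ord0 != 0.
  have := p3 j; rewrite /U1 -/(U j i1) -/(V j i1) -/(U j ord0) -/(V j ord0).
  apply: contraNneq => e; have vi : V j i1 != 0 by exact: p2.
  have -> : U j ord0 * V j i1 - U j i1 * V j ord0 =
    (U j ord0 + - (U j i1 / V j i1) * V j ord0) * V j i1 by field.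
  by rewrite e mul0r.
have s2 := config_shift (fun j => - (V j ord0 / U1 j ord0)) (config_swap s1).
set V1 := (fun j i => _) in s2.
have V10 j : V1 j ord0 = 0 by rewrite /V1 mulNr divfK ?subrr.
have V11 j : V1 j i1 != 0 by rewrite /V1 U11 mulr0 addr0; exact: p2.
have s3 := config_scale (c := fun j => (U1 j ord0)^-1) _ s2.
have {}s3 := s3 (fun j => invr_neq0 (U10 j)).
have s4 := config_scale (c := fun j => (V1 j i1)^-1) _ (config_swap s3).
have {}s4 := s4 (fun j => invr_neq0 (V11 j)).
eexists; eexists; split; first exact: s4.
by move=> j; split; rewrite /= ?U11 ?V10 ?mulr0 ?mulVf.
Qed.

End GraphForm.

Section GenericLine.
Variable q : nat.

Section Adjugate.
Variable A : comNzRingType.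
Implicit Types M : 'M[A]_(q.+1, q.+3).

Definition tail_mx M := \matrix_(k, l) M k (lift ord0 (lift ord0 l)).

Definition frame_vec (x0 x1 : A) (y : 'I_q.+1 -> A) (i : 'I_q.+3) : A :=
  if unlift ord0 i is Some j then if unlift ord0 j is Some k then y k else x1 else x0.

(* Up to the factor det (tail_mx M), the solutions of M x = 0 starting with
   (1, 0) and (0, 1). *)
Definition ker_vec0 M : 'I_q.+3 -> A :=
  frame_vec (\det (tail_mx M)) 0 (fun k => - (\adj (tail_mx M) *m col ord0 M) k 0).
Definition ker_vec1 M : 'I_q.+3 -> A :=
  frame_vec 0 (\det (tail_mx M)) (fun k => - (\adj (tail_mx M) *m col (lift ord0 ord0) M) k 0).

(** Cramer's rule without division: the vectors are polynomial in the entries of M, so they also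
    make sense for a matrix of indeterminates. *)
Lemma ker_vec_scale M j x0 x1 (u : 'I_q.+3 -> A) :
  u ord0 = x0 -> u (lift ord0 ord0) = x1 ->
  col j M = x0 *: col ord0 M + x1 *: col (lift ord0 ord0) M ->
  (forall k, \sum_l M k l * u l = 0) ->
  frame_vec (\det (tail_mx M) * x0) (\det (tail_mx M) * x1)
    (fun k => - (\adj (tail_mx M) *m col j M) k 0) = (fun l => \det (tail_mx M) * u l).
Proof.
move=> u0 u1 ej z; apply: funext => i; rewrite /frame_vec.
case: unliftP => [i'|] ->; last by rewrite u0.
case: unliftP => [k|] ->; last by rewrite u1.
pose y := \col_l u (lift ord0 (lift ord0 l)).
have e : tail_mx M *m y = - col j M.
  apply/colP => k'; have := z k'; rewrite 2!big_ord_recl u0 u1 => h.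
  rewrite ej !mxE; apply/eqP; rewrite -addr_eq0. rewrite [X in X == 0]addrC -addrA ![_ * M _ _]mulrC.
  apply/eqP; apply: etrans h; congr (_ + (_ + _)).
  by apply: eq_bigr => l _; rewrite !mxE.
have := congr1 (fun B => (\adj (tail_mx M) *m B) k 0) e.
by rewrite mulmxA mul_adj_mx mul_scalar_mx mulmxN mxE [y _ _]mxE [RHS]mxE => ->.
Qed.

End Adjugate.

Lemma ker_vec0_map (A B : comNzRingType) (psi : {rmorphism A -> B}) M l :
  ker_vec0 (map_mx psi M) l = psi (ker_vec0 M l).
Proof.
rewrite /ker_vec0 /frame_vec.
have -> : tail_mx (map_mx psi M) = map_mx psi (tail_mx M).
  by apply/matrixP => i j; rewrite !mxE.
case: unlift => [j|]; last by rewrite det_map_mx.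
case: unlift => [k|]; last by rewrite rmorph0.
by rewrite -map_col -map_mx_adj -map_mxM mxE rmorphN.
Qed.

Lemma ker_vec1_map (A B : comNzRingType) (psi : {rmorphism A -> B}) M l :
  ker_vec1 (map_mx psi M) l = psi (ker_vec1 M l).
Proof.
rewrite /ker_vec1 /frame_vec.
have -> : tail_mx (map_mx psi M) = map_mx psi (tail_mx M).
  by apply/matrixP => i j; rewrite !mxE.
case: unlift => [j|]; last by rewrite rmorph0.
case: unlift => [k|]; last by rewrite det_map_mx.
by rewrite -map_col -map_mx_adj -map_mxM mxE rmorphN.
Qed.

Lemma ker_vec0E (A : comNzRingType) (M : 'M[A]_(q.+1, q.+3)) u :
  u ord0 = 1 -> u (lift ord0 ord0) = 0 -> (forall k, \sum_l M k l * u l = 0) ->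
  ker_vec0 M = (fun l => \det (tail_mx M) * u l).
Proof.
move=> u0 u1 z; rewrite -(ker_vec_scale (j := ord0) u0 u1 _ z) ?mulr1 ?mulr0 //.
by rewrite scale1r scale0r addr0.
Qed.

Lemma ker_vec1E (A : comNzRingType) (M : 'M[A]_(q.+1, q.+3)) u :
  u ord0 = 0 -> u (lift ord0 ord0) = 1 -> (forall k, \sum_l M k l * u l = 0) ->
  ker_vec1 M = (fun l => \det (tail_mx M) * u l).
Proof.
move=> u0 u1 z; rewrite -(ker_vec_scale (j := lift ord0 ord0) u0 u1 _ z) ?mulr1 ?mulr0 //.
by rewrite scale1r scale0r add0r.
Qed.

End GenericLine.

Section FrameVec.
Variables (A : comNzRingType) (q : nat) (x0 x1 : A) (y : 'I_q.+1 -> A).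

Lemma frame_vec0 : frame_vec x0 x1 y ord0 = x0.
Proof. by rewrite /frame_vec unlift_none. Qed.

Lemma frame_vec1 : frame_vec x0 x1 y (lift ord0 ord0) = x1.
Proof. by rewrite /frame_vec liftK unlift_none. Qed.

Lemma frame_vecS k : frame_vec x0 x1 y (lift ord0 (lift ord0 k)) = y k.
Proof. by rewrite /frame_vec !liftK. Qed.

End FrameVec.

(** * Transfer to algebraically independent coefficients *)

Section Transfer.

Lemma line_restr_eval N0 N (F : numFieldType) (iota : {rmorphism rat -> F})
    (psi : {rmorphism {mpoly rat[N0]} -> F}) (U V : 'I_N -> {mpoly rat[N0]}) f :
  (forall c, psi c%:MP = iota c) ->
  map_poly psi (line_restr (@mpolyC N0 rat) U V f) =
  lf (fun l => psi (U l)) (fun l => psi (V l)) (map_mpoly iota f).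
Proof.
move=> hpsi.
pose G1 : {rmorphism _ -> _} := map_poly psi \o line_restr (@mpolyC N0 rat) U V.
pose G2 : {rmorphism _ -> _} :=
  lf (fun l => psi (U l)) (fun l => psi (V l)) \o map_mpoly iota.
apply: (@mpoly_morph_eq _ _ _ G1 G2) => [c|i] /=.
  by rewrite line_restrC map_polyC map_mpolyC lfC /= hpsi.
rewrite line_restrX map_mpolyX lfX rmorphD rmorphM /= map_polyX.
by rewrite !map_polyC.
Qed.

Lemma map_mpoly_homog N (F : numFieldType) (iota : {rmorphism rat -> F}) d
    (f : {mpoly rat[N]}) : f \is d.-homog -> map_mpoly iota f \is d.-homog.
Proof.
move=> hf; apply/dhomogP => m; rewrite mcoeff_msupp mcoeff_map_mpoly => h.
apply: (dhomogP _ _ _ hf); rewrite mcoeff_msupp.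
by apply/eqP => e; move/eqP: h; apply; rewrite e; exact: rmorph0.
Qed.

(** The determinant is a rational polynomial in the coefficients that takes the value 1 at a matrix
    with identity tail, so it cannot vanish at independent values. *)
Lemma independent_tail_det (F : numFieldType) q m (a : 'I_m -> 'M[F]_(q.+1, q.+3)) :
  (forall p : {mpoly rat[#|{: 'I_m * 'I_q.+1 * 'I_q.+3}|]},
    mmap ratr (fun k => let t := enum_val k in a t.1.1 t.1.2 t.2) p = 0 -> p = 0) ->
  forall i, \det (tail_mx (a i)) != 0.
Proof.
move=> ind i; pose T := ('I_m * 'I_q.+1 * 'I_q.+3)%type.
pose X : 'M[{mpoly rat[#|{: T}|]}]_q.+1 := \matrix_(k, l) 'X_(enum_rank (i, k, lift ord0 (lift ord0 l))).
pose psi0 : {rmorphism {mpoly rat[#|{: T}|]} -> rat} :=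
  meval (fun k => let t : T := enum_val k in (lift ord0 (lift ord0 t.1.2) == t.2)%:R).
pose psi : {rmorphism {mpoly rat[#|{: T}|]} -> F} :=
  mmap ratr (fun k => let t := enum_val k in a t.1.1 t.1.2 t.2).
have -> : tail_mx (a i) = map_mx psi X.
  by apply/matrixP => k l; rewrite !mxE /psi /= mmapX mmap1U enum_rankK.
rewrite det_map_mx; apply/eqP => /ind e.
have : psi0 (\det X) = 1.
  rewrite -det_map_mx -[RHS](det1 _ q.+1); congr (\det _).
  apply/matrixP => k l; rewrite !mxE /psi0 /= mevalXU enum_rankK /=.
  by rewrite !(inj_eq lift_inj).
by rewrite e rmorph0 => /eqP; rewrite eq_sym oner_eq0.
Qed.

(* A nonzero determinant at special rational lines is a nonzero polynomial with
   rational coefficients, so it does not vanish at independent coefficients. *)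
Theorem generic_lines_solvable (F : numFieldType) q m d
    (a : 'I_m -> 'M[F]_(q.+1, q.+3)) (u v : 'I_m -> 'I_q.+3 -> F) :
  (1 <= q)%N -> (m * d.+1 <= 'C(q.+2 + d, d))%N ->
  (forall p : {mpoly rat[#|{: 'I_m * 'I_q.+1 * 'I_q.+3}|]},
    mmap ratr (fun k => let t := enum_val k in a t.1.1 t.1.2 t.2) p = 0 -> p = 0) ->
  (forall i, is_graph_frame (u i) (v i)) ->
  (forall i k, \sum_l a i k l * u i l = 0) -> (forall i k, \sum_l a i k l * v i l = 0) ->
  config_solvable d u v (@no_points F q.+3).
Proof.
move=> q1 hm ind fr zu zv.
have [u0 [v0 [s0 fr0]]] := general_graph_lines (@general_lines_exist rat q.+2 d m q1 hm).
pose T := ('I_m * 'I_q.+1 * 'I_q.+3)%type.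
(* Equations of the special lines with identity tail, so that [ker_vec0] and [ker_vec1] return
   exactly [u0] and [v0]. *)
pose M0 i : 'M[rat]_(q.+1, q.+3) := \matrix_(k, l)
  frame_vec (- u0 i (lift ord0 (lift ord0 k))) (- v0 i (lift ord0 (lift ord0 k)))
    (fun l' => (k == l')%:R) l.
have tailM0 i : tail_mx (M0 i) = 1%:M.
  by apply/matrixP => k l; rewrite !mxE frame_vecS.
have sumM0 i k (w : 'I_q.+3 -> rat) : \sum_l M0 i k l * w l =
    - u0 i (lift ord0 (lift ord0 k)) * w ord0 - v0 i (lift ord0 (lift ord0 k)) * w (lift ord0 ord0)
    + w (lift ord0 (lift ord0 k)).
  rewrite 2!big_ord_recl !mxE frame_vec0 frame_vec1 addrA !mulNr; congr (_ + _).
  rewrite (bigD1 k) //= mxE frame_vecS eqxx mul1r big1 ?addr0 //.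
  by move=> l ne; rewrite mxE frame_vecS eq_sym (negPf ne) mul0r.
have zu0 i k : \sum_l M0 i k l * u0 i l = 0.
  by have [e1 e2 _ _] := fr0 i; rewrite sumM0 e1 e2 mulr1 mulr0 subr0 addNr.
have zv0 i k : \sum_l M0 i k l * v0 i l = 0.
  by have [_ _ e1 e2] := fr0 i; rewrite sumM0 e1 e2 mulr1 mulr0 sub0r addNr.
have k0 i : ker_vec0 (M0 i) = u0 i.
  have [e1 e2 _ _] := fr0 i; rewrite (ker_vec0E e1 e2 (zu0 i)) tailM0 det1.
  by apply: funext => l; rewrite mul1r.
have k1 i : ker_vec1 (M0 i) = v0 i.
  have [_ _ e1 e2] := fr0 i; rewrite (ker_vec1E e1 e2 (zv0 i)) tailM0 det1.
  by apply: funext => l; rewrite mul1r.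
pose ga i : 'M[{mpoly rat[#|{: T}|]}]_(q.+1, q.+3) := \matrix_(k, l) 'X_(enum_rank (i, k, l)).
pose psi0 : {rmorphism {mpoly rat[#|{: T}|]} -> rat} :=
  meval (fun k => let t := enum_val k in M0 t.1.1 t.1.2 t.2).
pose psi : {rmorphism {mpoly rat[#|{: T}|]} -> F} :=
  mmap ratr (fun k => let t := enum_val k in a t.1.1 t.1.2 t.2).
have ga0 i : map_mx psi0 (ga i) = M0 i.
  by apply/matrixP => k l; rewrite 2!mxE /psi0 /= mevalXU enum_rankK.
have ga1 i : map_mx psi (ga i) = a i.
  by apply/matrixP => k l; rewrite 2!mxE /psi /= mmapX mmap1U enum_rankK.
have det0 := independent_tail_det ind.
have [f hf] := boolp.choice (fun jl : 'I_m * 'I_d.+1 => s0 (fun s => match s with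
  | inl ik => (jl == ik)%:R | inr w => match w with end end)).
(* Restrictions of the rational solutions [f] to the lines with indeterminate coefficients; the
   matrix specializes to the identity at [M0]. *)
pose MM := \matrix_(s, t < #|{: 'I_m * 'I_d.+1}|)
  (line_restr (@mpolyC #|{: T}| rat) (ker_vec0 (ga (enum_val t).1)) (ker_vec1 (ga (enum_val t).1))
    (f (enum_val s)))`_(enum_val t).2.
have MM0 : \det (map_mx psi0 MM) = 1.
  rewrite -[RHS](det1 _ #|{: 'I_m * 'I_d.+1}|); congr (\det _).
  apply/matrixP => s t; rewrite 2!mxE.
  rewrite -(coef_map psi0) /= (@line_restr_eval _ _ _ idfun psi0); last by move=> c /=; rewrite mevalC.
  have -> : map_mpoly idfun (f (enum_val s)) = f (enum_val s).
    by apply/mpolyP => mm; rewrite mcoeff_map_mpoly.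
  have -> : (fun l => psi0 (ker_vec0 (ga (enum_val t).1) l)) = u0 (enum_val t).1.
    by rewrite -k0 -ga0; apply: funext => l; rewrite ker_vec0_map.
  have -> : (fun l => psi0 (ker_vec1 (ga (enum_val t).1) l)) = v0 (enum_val t).1.
    by rewrite -k1 -ga0; apply: funext => l; rewrite ker_vec1_map.
  by rewrite ((hf (enum_val s)).2 (inl (enum_val t))) mxE (inj_eq enum_val_inj).
have Mne : \det (map_mx psi MM) != 0.
  rewrite det_map_mx; apply/eqP => /ind e; move: MM0; rewrite det_map_mx e rmorph0.
  by move/eqP; rewrite eq_sym oner_eq0.
have sd : config_solvable d (fun i l => \det (tail_mx (a i)) * u i l)
    (fun i l => \det (tail_mx (a i)) * v i l) (@no_points F q.+3).
  have h : solvable_on (@forms F q.+3 d) (fun (jk : 'I_m * 'I_d.+1) g =>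
      (lf (fun l => \det (tail_mx (a jk.1)) * u jk.1 l)
          (fun l => \det (tail_mx (a jk.1)) * v jk.1 l) g)`_jk.2).
    apply: (@solvable_of_det _ _ _ _ _ (fun jl => map_mpoly ratr (f jl))).
    - exact: forms_subspace.
    - by move=> jk; exact: coef_lf_scalar.
    - by move=> jl; apply: map_mpoly_homog; case: (hf jl).
    apply: contraNneq Mne => <-; apply/eqP; congr (\det _).
    apply/matrixP => s t; rewrite 2!mxE [RHS]mxE.
    rewrite -(coef_map psi) /= (@line_restr_eval _ _ _ ratr psi); last by move=> c /=; rewrite mmapC.
    have [e1 e2 e3 e4] := fr (enum_val t).1.
    have -> : (fun l => psi (ker_vec0 (ga (enum_val t).1) l)) =
        (fun l => \det (tail_mx (a (enum_val t).1)) * u (enum_val t).1 l).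
      rewrite -(ker_vec0E e1 e2 (zu _)).
      by rewrite -ga1; apply: funext => l; rewrite ker_vec0_map.
    have -> // : (fun l => psi (ker_vec1 (ga (enum_val t).1) l)) =
        (fun l => \det (tail_mx (a (enum_val t).1)) * v (enum_val t).1 l).
    rewrite -(ker_vec1E e3 e4 (zv _)).
    by rewrite -ga1; apply: funext => l; rewrite ker_vec1_map.
  move=> c; have [g [hg eg]] := h (fun jk => c (inl jk)).
  by exists g; split=> // -[jk|[]]; exact: eg.
(* The points produced by Cramer's rule carry the factor [\det (tail_mx (a i))], which is now scaled
   away on both points of each line. *)
have di i : (\det (tail_mx (a i)))^-1 != 0 by rewrite invr_eq0.
have := config_scale di (config_swap (config_scale di sd)) => /config_swap.
by congr (config_solvable d _ _ _); apply: funext => i; apply: funext => l;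
  rewrite mulrA mulVf ?mul1r.
Qed.

End Transfer.

(** * Koszul complexes as iterated mapping cones *)

(** All homological degrees at once: in the step to k' + 1 a pair (a, b) is a plus b times the new
    exterior generator. *)
Fixpoint koszul (N : zmodType) k : zmodType :=
  if k is k'.+1 then ((koszul N k' * koszul N k')%type : zmodType) else N.

Fixpoint kmap (N N' : zmodType) (f : N -> N') k : koszul N k -> koszul N' k :=
  match k return koszul N k -> koszul N' k with
  | 0 => f
  | k'.+1 => fun z => (kmap f z.1, kmap f z.2)
  end.

Fact kmap_is_zmod_morphism (N N' : zmodType) (f : {additive N -> N'}) k :
  zmod_morphism (@kmap N N' f k).
Proof.
elim: k => [|k IH] /=; first exact: raddfB.
by move=> [a b] [c d] /=; rewrite !IH.
Qed.

HB.instance Definition _ (N N' : zmodType) (f : {additive N -> N'}) k :=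
  GRing.isZmodMorphism.Build _ _ (@kmap N N' f k) (@kmap_is_zmod_morphism N N' f k).

Lemma kmap_eq (N N' : zmodType) (f g : N -> N') : f =1 g ->
  forall k, @kmap N N' f k =1 @kmap N N' g k.
Proof. by move=> e; elim=> [|k IH] //= z; rewrite !IH. Qed.

Lemma kmap_comp (N N' N'' : zmodType) (f : N' -> N'') (g : N -> N') k z :
  @kmap _ _ f k (@kmap _ _ g k z) = kmap (f \o g) z.
Proof. by elim: k z => //= k IH z; rewrite !IH. Qed.

Section Differential.
Variables (N : zmodType) (x : nat -> {additive N -> N}).

Fixpoint kdiff k : koszul N k -> koszul N k :=
  match k return koszul N k -> koszul N k with
  | 0 => fun _ => 0
  | k'.+1 => fun z => (kdiff z.1 + kmap (x k') z.2, - kdiff z.2)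
  end.

Fact kdiff_is_zmod_morphism k : zmod_morphism (@kdiff k).
Proof.
elim: k => [|k IH] /=; first by move=> a b; rewrite subr0.
move=> [a b] [c d] /=; rewrite !IH raddfB; congr (_, _); last by rewrite opprD.
by rewrite addrACA -opprD.
Qed.

HB.instance Definition _ k :=
  GRing.isZmodMorphism.Build _ _ (@kdiff k) (@kdiff_is_zmod_morphism k).

(* kgr D k i q is the part of the Koszul complex on x_0, ..., x_(k-1) of
   homological degree i whose coefficients have degree q, so the total internal
   degree is i + q. *)
Fixpoint kgr (D : int -> N -> Prop) k (i : nat) (q : int) : koszul N k -> Prop :=
  match k return koszul N k -> Prop with
  | 0 => fun z => if i is 0 then D q z else z = 0
  | k'.+1 => fun z => kgr D i q z.1 /\ (if i is i'.+1 then kgr D i' q z.2 else z.2 = 0)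
  end.

(** Vanishing of Koszul homology in homological degree i and internal degree i + q; since the
    differential keeps the internal degree, w has coefficients of degree q - 1. *)
Definition kexact (D : int -> N -> Prop) k i q :=
  forall z : koszul N k, kgr D i q z -> kdiff z = 0 ->
    exists w : koszul N k, kgr D i.+1 (q - 1) w /\ z = kdiff w.

Record graded_family (D : int -> N -> Prop) : Prop := GradedFamily {
  family0 : forall q, D q 0;
  familyB : forall q a b, D q a -> D q b -> D q (a - b);
  familyX : forall q k a, D q a -> D (q + 1) (x k a) }.

End Differential.

Lemma kdiff_kmap (N N' : zmodType) (x : nat -> {additive N -> N})
    (x' : nat -> {additive N' -> N'}) (f : {additive N -> N'}) k (z : koszul N k) :
  (forall j a, f (x j a) = x' j (f a)) -> kdiff x' (kmap f z) = kmap f (kdiff x z).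
Proof.
move=> fx; elim: k z => [|k IH] /= z; first by rewrite raddf0.
rewrite !IH raddfD raddfN; congr (_ + _, _); rewrite /= !kmap_comp.
exact: (kmap_eq (fun a => esym (fx k a))).
Qed.

Lemma kgr_kmap (N N' : zmodType) (D : int -> N -> Prop) (D' : int -> N' -> Prop)
    (f : {additive N -> N'}) q q' : (forall a, D q a -> D' q' (f a)) ->
  forall k i z, kgr D i q z -> kgr D' i q' (@kmap _ _ f k z).
Proof.
move=> fD; elim=> [|k IH] [|i] /= z //; first exact: fD.
- by move=> ->; rewrite raddf0.
- by move=> [h ->]; split; [exact: IH|exact: raddf0].
- by move=> [h h']; split; exact: IH.
Qed.

Lemma kgr_lift (N N' : zmodType) (D : int -> N -> Prop) (D' : int -> N' -> Prop)
    (f : {additive N -> N'}) q :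
  (forall b, D' q b -> exists2 a, D q a & b = f a) ->
  forall k i w, kgr D' i q w -> exists2 z, kgr D i q z & w = @kmap _ _ f k z.
Proof.
move=> fD; elim=> [|k IH] [|i] /= w.
- exact: fD.
- by move=> ->; exists 0; rewrite ?raddf0.
- by case: w => a b /= [/IH [a' h ->] ->]; exists (a', 0) => //=; congr (_, _); rewrite raddf0.
- case: w => a b /= [/IH [a' h ->] /IH [b' h' ->]].
  by exists (a', b').
Qed.

Section Graded.
Variables (N : zmodType) (x : nat -> {additive N -> N}) (D : int -> N -> Prop).
Hypothesis xC : forall j k a, x j (x k a) = x k (x j a).
Hypothesis fD : graded_family x D.

Lemma kgr0 k i q : kgr D i q (0 : koszul N k).
Proof. by elim: k i => [|k IH] [|i] //=; apply: family0 fD _. Qed.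

Lemma kgrB k i q (z w : koszul N k) : kgr D i q z -> kgr D i q w -> kgr D i q (z - w).
Proof.
elim: k i z w => [|k IH] [|i] /= z w; first exact: familyB fD _ _ _.
- by move=> -> ->; rewrite subr0.
- by move=> [h ->] [h' ->]; rewrite subr0; split=> //; exact: IH.
- by move=> [h1 h2] [h3 h4]; split; exact: IH.
Qed.

Lemma kgrN k i q (z : koszul N k) : kgr D i q z -> kgr D i q (- z).
Proof. by move=> h; rewrite -sub0r; apply: kgrB => //; exact: kgr0. Qed.

Lemma kgrD k i q (z w : koszul N k) : kgr D i q z -> kgr D i q w -> kgr D i q (z + w).
Proof. by move=> h h'; rewrite -[w]opprK; apply: kgrB => //; exact: kgrN. Qed.

Lemma kgrX k i q j (z : koszul N k) : kgr D i q z -> kgr D i (q + 1) (kmap (x j) z).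
Proof. by apply: kgr_kmap => a; exact: familyX fD _ _ _. Qed.

Lemma kdiff_degree0 k q (z : koszul N k) : kgr D 0 q z -> kdiff x z = 0.
Proof.
elim: k z => //= k IH [a b] /= [/IH -> ->].
by rewrite !raddf0 addr0.
Qed.

Lemma kgr_kdiff k i q (z : koszul N k) : kgr D i.+1 q z -> kgr D i (q + 1) (kdiff x z).
Proof.
elim: k i z => [|k IH] [|i] /= z //; first by move=> _; exact: family0 fD _.
  move=> [h1 h2]; split; first by apply: kgrD; [exact: IH|exact: kgrX].
  by rewrite (kdiff_degree0 h2) oppr0.
move=> [h1 h2]; split; first by apply: kgrD; [exact: IH|exact: kgrX].
by apply: kgrN; exact: IH.
Qed.

Lemma kdiff_xC j k (z : koszul N k) : kdiff x (kmap (x j) z) = kmap (x j) (kdiff x z).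
Proof. by apply: kdiff_kmap => *; exact: xC. Qed.

Lemma kdiffK k (z : koszul N k) : kdiff x (kdiff x z) = 0.
Proof.
elim: k z => [|k IH] //= -[a b] /=; congr (_, _); last by rewrite raddfN /= IH !oppr0.
by rewrite raddfD /= IH add0r kdiff_xC raddfN subrr.
Qed.

Lemma kgr_gt k i q (z : koszul N k) : (k < i)%N -> kgr D i q z -> z = 0.
Proof.
elim: k i z => [|k IH] [|i] //= [a b] ki [/= ha hb].
by rewrite (IH _ _ (ltnW ki) ha) (IH i _ _ hb).
Qed.

(** If the component b of a cycle is the boundary of c, then adding x_k c turns a into a cycle of
    the smaller complex. The hypothesis on b may use that x_k b is a boundary. *)
Lemma kexact_cone k i q :
  (forall b : koszul N k, forall a : koszul N k, (if i is i'.+1 then kgr D i' q b else b = 0) ->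
     kgr D i q a -> kdiff x b = 0 -> kdiff x a = - kmap (x k) b ->
     exists2 c, kgr D i (q - 1) c & b = kdiff x c) ->
  kexact x D k i q -> kexact x D k.+1 i q.
Proof.
move=> hb ex [a b] /= [ha kb] [ea eb].
have db : kdiff x b = 0 by apply/eqP; rewrite -oppr_eq0 eb.
have [c kc ec] := hb b a kb ha db (esym (addr0_eq (etrans (addrC _ _) ea))); subst b.
have [||e [ke ee]] := ex (a + kmap (x k) c).
- by apply: kgrD => //; rewrite -[q](subrK 1); exact: kgrX.
- by rewrite raddfD /= kdiff_xC.
exists (e, - c); rewrite /= -ee raddfN addrK raddfN opprK; split=> //.
by split=> //; exact: kgrN.
Qed.

Lemma kexact_coneS k i q : (forall i', (i' <= i)%N -> kexact x D k i' q) -> kexact x D k.+1 i q.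
Proof.
move=> ex; apply: kexact_cone; last exact: ex.
move=> b a; case: i ex => [|i] ex kb _ db _.
  by exists 0; [exact: kgr0|rewrite raddf0].
by have [|c [kc ec]] := ex i (leqnSn i) b kb; [|exists c].
Qed.

(** The second component of the differential is again, up to sign, the differential of a top
    element, so descending through the cones leaves only the action of x_0. *)
Lemma kdiff_top_inj k q (z : koszul N k.+1) :
  injective (x 0%N) -> kgr D k.+1 q z -> kdiff x z = 0 -> z = 0.
Proof.
move=> x0I; elim: k z => [|k IH].
  move=> [a b] /= [-> _] [+ _]; rewrite add0r -[RHS](raddf0 (x 0%N)).
  by move/x0I => ->.
pose P (a b : koszul N k.+1) := kgr D k.+2 q a -> kgr D k.+1 q b -> - kdiff x b = 0 -> (a, b) = 0.
have h a b : P a b.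
  move=> ha hb e; have db : kdiff x b = 0 by apply: oppr_inj; rewrite oppr0.
  by rewrite (IH b hb db) (@kgr_gt k.+1 k.+2 q a).
by move=> [a b] [ha hb] dz; exact: h ha hb (congr1 snd dz).
Qed.

End Graded.

Section ShortExactSequence.
Variables (B C : zmodType) (x : nat -> {additive B -> B}) (y : nat -> {additive C -> C}).
Variables (DB : int -> B -> Prop) (DC : int -> C -> Prop) (p : {additive B -> C}).
Hypothesis xC : forall j k a, x j (x k a) = x k (x j a).
Hypothesis px : forall j a, p (x j a) = y j (p a).
Hypothesis fB : graded_family x DB.
Hypothesis pD : forall q a, DB q a -> DC q (p a).

Definition kernel_family (q : int) (b : B) := DB q b /\ p b = 0.

Lemma kgr_kernelP k i q (z : koszul B k) :
  kgr kernel_family i q z <-> kgr DB i q z /\ kmap p z = 0.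
Proof.
elim: k i z => [|k IH] [|i] /= z; rewrite /kernel_family //.
- by split=> [->|[-> //]]; rewrite raddf0.
- split=> [[/IH [h e] e']|[[h e] [e1 _]]]; rewrite ?e' ?e ?raddf0 //.
  by split=> //; apply/IH.
- split=> [[/IH [h e] /IH [h' e']]|[[h h'] [e e']]]; first by rewrite e e'.
  by split; apply/IH.
Qed.

Lemma kernel_graded_family : graded_family x kernel_family.
Proof.
split=> [q|q a b [ha ea] [hb eb]|q k a [ha ea]].
- by split; [exact: family0 fB _|exact: raddf0].
- by split; [exact: familyB fB _ _ _ ha hb|rewrite raddfB ea eb subrr].
- by split; [exact: familyX fB _ _ _ ha|rewrite px ea raddf0].
Qed.

(* Injectivity of H_i(A)_q -> H_i(B)_q for a subfamily A of B. *)
Definition krel (DA : int -> B -> Prop) k i q :=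
  forall z : koszul B k, kgr DA i q z ->
    (exists w : koszul B k, kgr DB i.+1 (q - 1) w /\ z = kdiff x w) ->
    exists w : koszul B k, kgr DA i.+1 (q - 1) w /\ z = kdiff x w.

Lemma krel_kexact (DA : int -> B -> Prop) k i q : (forall q a, DA q a -> DB q a) ->
  krel DA k i q -> kexact x DB k i q -> kexact x DA k i q.
Proof.
move=> AB rel ex z hz dz; apply: (rel) => //; apply: ex => //.
have -> : z = kmap (@idfun B) z by elim: (k) (z) => //= k' IH [a b] /=; rewrite -!IH.
by apply: (@kgr_kmap B B DA DB idfun q q (AB q)).
Qed.

Lemma kexact_krel (DA : int -> B -> Prop) k i q :
  kexact x DA k i q -> krel DA k i q.
Proof. by move=> ex z hz [w [_ e]]; apply: ex => //; rewrite e kdiffK. Qed.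

Hypothesis pS : forall q c, DC q c -> exists2 b, DB q b & c = p b.

(** Part of the long exact sequence: the kernel of H_i(A) -> H_i(B) is the image of the connecting
    map from H_(i+1)(C). The next lemma is the converse, when H_(i+1)(B) vanishes. *)
Lemma kernel_krel k i q : kexact y DC k i.+1 (q - 1) -> krel kernel_family k i q.
Proof.
move=> ex z /kgr_kernelP [hz pz] [w [hw ew]].
have hpw : kgr DC i.+1 (q - 1) (kmap p w) by apply: kgr_kmap hw => a; exact: pD.
have [|u [hu eu]] := ex _ hpw; first by rewrite (kdiff_kmap _ px) -ew.
have [u' hu' eu'] := kgr_lift (pS (q := q - 1 - 1)) hu.
exists (w - kdiff x u'); rewrite raddfB /= (kdiffK xC) subr0; split=> //.
apply/kgr_kernelP; split; last by rewrite raddfB /= eu eu' (kdiff_kmap _ px) subrr.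
by apply: (kgrB fB) => //; rewrite -[q - 1](subrK 1); exact: (kgr_kdiff fB).
Qed.

Lemma quotient_kexact k i q : krel kernel_family k i q -> kexact x DB k i.+1 (q - 1) ->
  kexact y DC k i.+1 (q - 1).
Proof.
move=> rel ex z hz dz.
have [z' hz' ez'] := kgr_lift (pS (q := q - 1)) hz.
have [||w [hw ew]] := rel (kdiff x z'); last 1 first.
- have [hBw pw] := (kgr_kernelP _ _ _).1 hw.
  have [||v [hv ev]] := ex (z' - w).
  + exact: (kgrB fB).
  + by rewrite raddfB /= ew subrr.
  exists (kmap p v); split; first by apply: kgr_kmap hv => a; exact: pD.
  by rewrite (kdiff_kmap _ px) -ev raddfB /= pw subr0.
- apply/kgr_kernelP; split; last by rewrite -(kdiff_kmap _ px) -ez'.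
  by rewrite -[q](subrK 1); exact: (kgr_kdiff fB).
- by exists z'.
Qed.

End ShortExactSequence.

Section Subfamily.
Variables (A B : zmodType) (x : nat -> {additive A -> A}) (y : nat -> {additive B -> B}).
Variables (DA : int -> A -> Prop) (DB : int -> B -> Prop) (f : {additive A -> B}).
Hypothesis fx : forall j a, f (x j a) = y j (f a).
Hypothesis fA : graded_family x DA.
Hypothesis fD : forall q a, DA q a -> DB q (f a).
Hypothesis fI : forall q a, DA q a -> f a = 0 -> a = 0.

Lemma kmap_graded_inj k i q (z w : koszul A k) : kgr DA i q z -> kgr DA i q w ->
  kmap f z = kmap f w -> z = w.
Proof.
move=> hz hw /eqP; rewrite -subr_eq0 -raddfB => /eqP e.
apply/eqP; rewrite -subr_eq0; apply/eqP.
have {hz hw} := kgrB fA hz hw; move: e; move: (z - w) => u.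
elim: k i u {z w} => [|k IH] [|i] //= u; first by move=> e h; exact: fI h e.
  by case: u => a b /= [e _] [/(IH _ _ e) -> ->].
by case: u => a b /= [e e'] [/(IH _ _ e) -> /(IH _ _ e') ->].
Qed.

Lemma kgr_boundary k i q (w : koszul A k) : kgr DA i.+1 (q - 1) w -> kgr DA i q (kdiff x w).
Proof. by move=> /(kgr_kdiff fA); rewrite subrK. Qed.

(** A preimage under the differential has coefficients one degree lower, so surjectivity is asked in
    degree q - 1 alone; injectivity brings the equation back to A. *)
Lemma kexact_sub k i q : (forall b, DB (q - 1) b -> exists2 a, DA (q - 1) a & b = f a) ->
  kexact y DB k i q -> kexact x DA k i q.
Proof.
move=> fS ex z hz dz.
have [||w [hw ew]] := ex (kmap f z).
- by apply: kgr_kmap hz => a; exact: fD.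
- by rewrite (kdiff_kmap _ fx) dz raddf0.
have [w' hw' ew'] := kgr_lift fS hw.
exists w'; split=> //; apply: (kmap_graded_inj hz); first exact: kgr_boundary.
by rewrite ew ew' (kdiff_kmap _ fx).
Qed.

(* The Koszul differential of a top class that is missing from A is a cycle of
   A, but not a boundary. *)
Lemma not_kexact_sub k q eta : graded_family y DB -> (forall j k a, y j (y k a) = y k (y j a)) ->
  injective (y 0%N) -> (forall b, DB q b -> exists2 a, DA q a & b = f a) ->
  DB (q - 1) eta -> (forall a, DA (q - 1) a -> eta <> f a) -> ~ kexact x DA k.+1 k q.
Proof.
move=> fB yC yI fS he ne ex.
(* [eta] becomes the coefficient of the product of all exterior generators. *)
have [w [hw topw]] : exists w : koszul B k.+1, kgr DB k.+1 (q - 1) w /\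
    (forall w' : koszul A k.+1, kgr DA k.+1 (q - 1) w' -> w <> kmap f w').
  elim: (k.+1) => [|k' [w [hw topw]]]; first by exists eta.
  exists (0, w); split; first by split=> //; exact: (kgr0 fB).
  by move=> [a b] /= [_ /topw h] [_ /h].
have hdw : kgr DB k q (kdiff y w) by rewrite -[q](subrK 1); exact: (kgr_kdiff fB).
have [z hz ez] := kgr_lift fS hdw.
have [|w' [hw' ew']] := ex z hz.
  apply: (fun h => kmap_graded_inj h (kgr0 fA k.+1 k.-1 (q + 1))).
    by case: (k) z hz {ez ex topw hdw w hw} => [|k'] z hz; [rewrite (kdiff_degree0 x hz); exact: (kgr0 fA)|exact: (kgr_kdiff fA)].
  by rewrite -(kdiff_kmap _ fx) -ez (kdiffK yC) raddf0.
apply: (topw w') => //; apply/eqP; rewrite -subr_eq0; apply/eqP.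
apply: (kdiff_top_inj (k := k) yI (q := q - 1)).
  by apply: (kgrB fB) => //; apply: kgr_kmap hw' => a; exact: fD.
have e : kdiff y (kmap f w') = kdiff y w by rewrite (kdiff_kmap _ fx) -ew' ez.
by rewrite raddfB; apply/eqP; rewrite subr_eq0; apply/eqP; exact: esym e.
Qed.

End Subfamily.

(** * Free modules *)

Section HomogeneousDegrees.
Variables (K : fieldType) (N : nat).
Local Notation S := {mpoly K[N]}.

Lemma homogzD d (f g : S) : homogz d f -> homogz d g -> homogz d (f + g).
Proof. by case: d => d /=; [exact: dhomogD|move=> -> ->; rewrite addr0]. Qed.

Lemma homogzM e d (f g : S) : f \is e.-homog -> homogz d g -> homogz (e%:Z + d) (f * g).
Proof.
move=> hf; case: d => k /= hg; first exact: dhomogM.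
by rewrite hg mulr0; exact: homogz0.
Qed.

Lemma homogzMz e d (f g : S) : homogz e f -> homogz d g -> homogz (e + d) (f * g).
Proof.
case: e => e /= hf hg; first exact: homogzM.
by rewrite hf mul0r; exact: homogz0.
Qed.

Lemma homogz_sum d I r (P : pred I) (F : I -> S) :
  (forall i, homogz d (F i)) -> homogz d (\sum_(i <- r | P i) F i).
Proof.
move=> h; elim/big_ind: _ => // [|f g]; [exact: homogz0|exact: homogzD].
Qed.

Lemma homogzZ d c (f : S) : homogz d f -> homogz d (c *: f).
Proof. by case: d => d /=; [exact: dhomogZ|move=> ->; rewrite scaler0]. Qed.

Lemma pihomog_homogz n d (f : S) : homogz d f ->
  pihomog mdeg n f = if d == n%:Z then f else 0.
Proof.
case: d => d /= hf; last by rewrite hf raddf0.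
have [<-|ne] := eqVneq d n; first by rewrite eqxx pihomog_dE.
by rewrite (pihomog_ne0 ne hf) (_ : (d%:Z == n%:Z) = false) // eqz_nat (negPf ne).
Qed.

Lemma homogz_mcoeff d (f : S) m : homogz d f -> f@_m != 0 -> d = (mdeg m)%:Z.
Proof.
case: d => d /= hf; last by rewrite hf mcoeff0 eqxx.
by rewrite -mcoeff_msupp => hm; rewrite -(dhomogP _ _ _ hf m hm).
Qed.

Lemma mcoeffXM0 (j : 'I_N) (g : S) (m : 'X_{1.. N}) : m j = 0%N -> ('X_j * g)@_m = 0.
Proof.
move=> mj; rewrite [g]mpolyE mulr_sumr raddf_sum big1 // => m' _ /=.
rewrite -scalerAr -mpolyXD mcoeffZ mcoeffX; case: eqP => [e|]; last by rewrite mulr0.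
by move: mj; rewrite -e mnmDE mnm1E eqxx.
Qed.

End HomogeneousDegrees.

Section FreeModules.
Variables (K : fieldType) (N : nat).
Local Notation S := {mpoly K[N.+1]}.

Definition xact (V : lmodType S) (k : nat) : {additive V -> V} :=
  GRing.scale ('X_(inord k) : S).

Lemma xactC (V : lmodType S) j k (a : V) : xact V j (xact V k a) = xact V k (xact V j a).
Proof. by rewrite /xact /= !scalerA mulrC. Qed.

Lemma gm_family (M : gradedModule K N.+1) : graded_family (xact M) (@gm_comp _ _ M).
Proof.
split=> [q|q a b ha hb|q k a ha]; first exact: gm_comp0.
  apply: gm_compD => //; rewrite -scaleN1r -[q]add0r.
  by apply: gm_compZ => //; rewrite rpredN; exact: dhomog1.
by rewrite addrC; apply: gm_compZ => //; rewrite dhomogX /= mdeg1.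
Qed.

Variables (r : nat) (deg : 'I_r -> int).

Definition free_comp (d : int) (v : 'rV[S]_r) : Prop := forall k, homogz (d - deg k) (v 0 k).

Fact free_comp0 d : free_comp d 0.
Proof. by move=> k; rewrite mxE; exact: homogz0. Qed.

Fact free_compD d u v : free_comp d u -> free_comp d v -> free_comp d (u + v).
Proof. by move=> hu hv k; rewrite mxE; exact: homogzD. Qed.

Fact free_compZ (e : nat) d f u : f \is e.-homog -> free_comp d u ->
  free_comp (e%:Z + d) (f *: u).
Proof. by move=> hf hu k; rewrite mxE -addrA; exact: homogzM. Qed.

Fact span_of_sum (V : zmodType) (D : int -> V -> Prop) (I : finType) (e : I -> int) (a : I -> V) :
  (forall d, D d 0) -> (forall d u v, D d u -> D d v -> D d (u + v)) ->
  (forall i, D (e i) (a i)) ->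
  exists (s : seq int) (c : int -> V), [/\ uniq s, forall d, D d (c d) &
    \sum_i a i = \sum_(d <- s) c d].
Proof.
move=> D0 DD Da; exists (undup [seq e i | i : I]), (fun d => \sum_(i | e i == d) a i).
split; first exact: undup_uniq.
  by move=> d; elim/big_ind: _ => [|u v|i /eqP <-]; [exact: D0|exact: DD|exact: Da].
rewrite (exchange_big_dep predT) //=; apply: eq_bigr => i _.
rewrite -big_filter (bigD1_seq (e i)) ?filter_uniq ?undup_uniq //=; last first.
  by rewrite mem_filter eqxx mem_undup; apply: map_f; rewrite mem_enum.
rewrite big_filter_cond big1 ?addr0 // => d /andP[/eqP -> ].
by rewrite eqxx.
Qed.

Fact free_span (u : 'rV[S]_r) : exists (s : seq int) (c : int -> 'rV[S]_r),
  (forall d, free_comp d (c d)) /\ u = \sum_(d <- s) c d.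
Proof.
pose B := (\max_(k < r) mmeasure mdeg (u 0%R k))%N.
have [|s [c [_ hc ec]]] := @span_of_sum _ free_comp ('I_r * 'I_B)%type
  (fun kn => deg kn.1 + kn.2%:Z) (fun kn => pihomog mdeg kn.2 (u 0 kn.1) *: delta_mx 0 kn.1)
  free_comp0 free_compD.
  move=> [k n] l /=; rewrite !mxE eqxx /=; case: eqP => [->|_].
    by rewrite mulr1 addrAC subrr add0r; exact: pihomogP.
  by rewrite mulr0; exact: homogz0.
exists s, c; split=> //; rewrite -ec [LHS]row_sum_delta.
rewrite -(pair_bigA _ (fun k (n : 'I_B) => pihomog mdeg n (u 0 k) *: delta_mx 0 k)) /=.
apply: eq_bigr => k _; rewrite -scaler_suml; congr (_ *: _).
by apply: pihomog_partitionE; exact: (leq_bigmax k).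
Qed.

Fact free_direct (s : seq int) (c : int -> 'rV[S]_r) : uniq s ->
  (forall d, free_comp d (c d)) -> \sum_(d <- s) c d = 0 -> forall d, d \in s -> c d = 0.
Proof.
move=> us hc s0 d ds; apply/rowP => k; rewrite mxE.
have hd := hc d k; case E: (d - deg k) hd => [n|n] /= hd //.
have := congr1 (fun v : 'rV[S]_r => pihomog mdeg n (v 0 k)) s0.
rewrite mxE raddf0 summxE raddf_sum (bigD1_seq d) //= (pihomog_dE hd) big1 ?addr0 //.
move=> e ne; rewrite (pihomog_homogz n (hc e k)); case: eqP => // h.
by move: ne; rewrite -(inj_eq (addIr (- deg k))) h E eqxx.
Qed.

Definition free_module : gradedModule K N.+1 :=
  @GradedModule K N.+1 'rV[S]_r free_comp free_comp0 free_compD free_compZ free_span free_direct.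

End FreeModules.

Section Inclusion.
Variables (V : zmodType) (x : nat -> {additive V -> V}) (D : int -> V -> Prop).

Fixpoint kinc k (v : V) : koszul V k :=
  match k return koszul V k with
  | 0 => v
  | k'.+1 => (kinc k' v, 0)
  end.

Fact kinc_is_zmod_morphism k : zmod_morphism (kinc k).
Proof.
move=> a b; elim: k => //= k ->.
by rewrite -[(_, 0) - _]/(kinc k a - kinc k b, 0 - 0) subr0.
Qed.

HB.instance Definition _ k :=
  GRing.isZmodMorphism.Build _ _ (kinc k) (@kinc_is_zmod_morphism k).

Lemma kmap_kinc (f : {additive V -> V}) k v : kmap f (kinc k v) = kinc k (f v).
Proof. by elim: k => //= k ->; rewrite raddf0. Qed.

Lemma kgr_kinc k q (z : koszul V k) : kgr D 0 q z <-> exists2 v, D q v & z = kinc k v.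
Proof.
elim: k z => [|k IH] /= z; first by split=> [|[v hv ->]] //; exists z.
split=> [[/IH [v hv e] e']|[v hv ->]]; last by split=> //; apply/IH; exists v.
by exists v => //; rewrite -e -e'; case: (z).
Qed.

Hypothesis fD : graded_family x D.

Lemma kdiff_degree1P k q (v : V) :
  (exists2 c : koszul V k, kgr D 1 q c & kinc k v = kdiff x c) <->
  exists2 g : nat -> V, (forall j, D q (g j)) & v = \sum_(j < k) x j (g j).
Proof.
elim: k v => [|k IH] v.
  split=> [[c _ /= ->]|[g _ ->]]; last by exists 0; rewrite //= big_ord0.
  by exists (fun _ => 0) => [j|]; [exact: family0 fD _|rewrite big_ord0].
split.
  move=> [[a b] /= [ha hb] [e _]]; have [w hw eb] := (kgr_kinc _ _).1 hb.
  have [|g hg eg] := (IH (v - x k w)).1.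
    by exists a => //; rewrite raddfB /= e eb kmap_kinc addrK.
  exists (fun j => if j == k then w else g j) => [j|]; first by case: eqP.
  rewrite big_ord_recr /= eqxx; apply/eqP; rewrite -subr_eq eg; apply/eqP.
  by apply: eq_bigr => j _; rewrite ltn_eqF.
move=> [g hg ->]; have [|a ha ea] := (IH (\sum_(j < k) x j (g j))).2; first by exists g.
exists (a, kinc k (g k)); first by split=> //; apply/kgr_kinc; exists (g k).
rewrite /= -ea kmap_kinc big_ord_recr raddfD /=; congr (_, _).
by rewrite (kdiff_degree0 x (q := q) (D := D)) ?oppr0 //; apply/kgr_kinc; exists (g k).
Qed.

(** For i > 1 the component b has positive homological degree and exactness applies to it. For i = 1
    it is a single element, and the last but one hypothesis says that x_k is a nonzerodivisor modulo
    the earlier variables. *)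
Lemma kexact_free_cone k i q : (0 < i)%N ->
  (forall i', (0 < i' <= i)%N -> kexact x D k i' q) ->
  (forall v g, D q v -> (forall j, D q (g j)) -> x k v = \sum_(j < k) x j (g j) ->
    exists2 h : nat -> V, (forall j, D (q - 1) (h j)) & v = \sum_(j < k) x j (h j)) ->
  (forall j l a, x j (x l a) = x l (x j a)) ->
  kexact x D k.+1 i q.
Proof.
move=> i0 ex reg xC; apply: kexact_cone => //; last by apply: ex; rewrite i0 leqnn.
move=> b a; case: i i0 ex => // -[|i] _ ex /= hb ha db ea.
  have [v hv ev] := (kgr_kinc _ _).1 hb; subst b.
  have [|g hg eg] := (kdiff_degree1P k q (x k v)).1.
    exists (- a); last by rewrite raddfN /= ea opprK kmap_kinc.
    exact: (kgrN fD).
  have [h hh eh] := reg _ _ hv hg eg.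
  by have [|c hc ec] := (kdiff_degree1P k (q - 1) v).2; [exists h|exists c].
by have [|c [kc ec]] := ex i.+1 _ b hb db; [rewrite leqnSn|exists c].
Qed.

End Inclusion.

Section FreeExact.
Variables (K : fieldType) (N : nat).
Local Notation S := {mpoly K[N.+1]}.

Lemma mcoeffXD (j : 'I_N.+1) (f : S) m : ('X_j * f)@_(m + U_(j)) = f@_m.
Proof. by rewrite mulrC addmC mcoeffMX. Qed.

Lemma initial_ideal_gen k d (f : S) : (k <= N.+1)%N -> homogz d f ->
  (forall m, f@_m != 0 -> exists2 j : 'I_N.+1, (j < k)%N & m j != 0%N) ->
  exists2 g : nat -> S, (forall j, homogz (d - 1) (g j)) &
    f = \sum_(j < k) 'X_(inord j) * g j.
Proof.
move=> kN hf hm.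
pose P (f' : S) := exists2 g : nat -> S, (forall j, homogz (d - 1) (g j)) &
    f' = \sum_(j < k) 'X_(inord j) * g j.
suff h m : P (f@_m *: 'X_[m]).
  rewrite [f]mpolyE; elim/big_ind: _ => [|f1 f2 [g1 h1 e1] [g2 h2 e2]|m _]; last exact: h.
    by exists (fun _ => 0) => [j|]; [exact: homogz0|rewrite big1 // => j _; rewrite mulr0].
  exists (fun j => g1 j + g2 j) => [j|]; first exact: homogzD.
  by rewrite e1 e2 -big_split; apply: eq_bigr => j _; rewrite mulrDr.
have [e|ne] := eqVneq (f@_m) 0.
  exists (fun _ => 0) => [j|]; first exact: homogz0.
  by rewrite e scale0r big1 // => j _; rewrite mulr0.
have ed := homogz_mcoeff hf ne; have [j jk mj] := hm _ ne.
have em : (m = m - U_(j) + U_(j))%MM by rewrite submK // lep1mP.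
exists (fun i => if i == j :> nat then f@_m *: 'X_[m - U_(j)] else 0) => [i|].
  case: eqP => _; last exact: homogz0.
  apply: homogzZ.
  have -> : d - 1 = (mdeg (m - U_(j)))%:Z by rewrite ed {1}em mdegD mdeg1 PoszD addrK.
  by rewrite /= dhomogX.
rewrite (bigD1 (Ordinal jk)) //= eqxx big1 ?addr0 => [|i ne'].
  have -> : inord j = j :> 'I_N.+1 by apply: val_inj; rewrite /= inordK.
  by rewrite -scalerAr -mpolyXD addmC -em.
by rewrite ifN ?mulr0 //; apply: contra ne' => /eqP e; apply/eqP/val_inj.
Qed.

Lemma free_ideal_gen r (deg : 'I_r -> int) k d (v : 'rV[S]_r) : (k <= N.+1)%N ->
  free_comp deg d v ->
  (forall l m, (v 0 l)@_m != 0 -> exists2 j : 'I_N.+1, (j < k)%N & m j != 0%N) ->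
  exists2 g : nat -> free_module K N deg, (forall j, gm_comp (d - 1) (g j)) &
    v = \sum_(j < k) xact (free_module K N deg) j (g j).
Proof.
move=> kN hv hm.
have h (l : 'I_r) : exists g' : nat -> S, (forall j, homogz (d - deg l - 1) (g' j)) /\
    v 0 l = \sum_(j < k) 'X_(inord j) * g' j.
  by have [g' h1 h2] := initial_ideal_gen kN (hv l) (hm l); exists g'.
have [g' hg'] := boolp.choice h.
exists (fun j => \row_l g' l j) => [j l|]; first by rewrite mxE addrAC; exact: (hg' l).1.
apply/rowP => l; rewrite summxE (hg' l).2; apply: eq_bigr => j _.
by rewrite !mxE.
Qed.

Lemma free_kexact r (deg : 'I_r -> int) k i q : (k <= N.+1)%N -> (0 < i)%N ->
  kexact (xact (free_module K N deg)) (@gm_comp _ _ (free_module K N deg)) k i q.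
Proof.
set F := free_module K N deg.
elim: k i => [|k IH] i kN i0; first by case: i i0 => // i _ z /= -> _; exists 0.
refine (@kexact_free_cone _ _ _ (gm_family F) k i q i0 _ _ (@xactC K N F)).
  by move=> i' /andP[h _]; apply: IH => //; exact: ltnW.
move=> v g hv hg e; apply: (free_ideal_gen (ltnW kN) hv) => l m ne.
case: (pselect (exists2 j : 'I_N.+1, (j < k)%N & m j != 0%N)) => // h.
(* A monomial of [v] without the first k variables would survive in x_k v, whose monomials all
   contain one of them. *)
case/eqP: ne; rewrite -(mcoeffXD (inord k)).
have -> : 'X_(inord k) * (v : 'rV_r) 0 l = (xact F k v : 'rV_r) 0 l by rewrite mxE.
rewrite e summxE raddf_sum big1 // => j _ /=; rewrite mxE; apply: mcoeffXM0.
have jN : (j < N.+1)%N by apply: leq_trans (ltn_ord j) _; exact: ltnW.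
rewrite mnmDE mnm1E -(inj_eq val_inj) /= !inordK // gtn_eqF // addn0.
by apply/eqP/negPn/negP => mj; case: h; exists (inord j); rewrite ?inordK.
Qed.

End FreeExact.

(** * Tor and Koszul homology *)

Section GradedMaps.
Variables (K : fieldType) (N : nat).
Local Notation S := {mpoly K[N.+1]}.

(** The list is made to contain [q], with a zero component if need be, so that directness can be
    applied in that degree. *)
Lemma graded_decomposition (A : gradedModule K N.+1) (u : A) (q : int) :
  exists (s : seq int) (c : int -> A),
    [/\ uniq s, q \in s, forall d, gm_comp d (c d) & u = \sum_(d <- s) c d].
Proof.
have [s [c [hc ->]]] := gm_span u.
have [|t [c' [ut hc' et]]] := @span_of_sum A (@gm_comp _ _ A) 'I_(size s)
    (fun i => s`_i) (fun i => c s`_i) (@gm_comp0 _ _ A) (@gm_compD _ _ A).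
  by move=> i; exact: hc.
rewrite (big_nth 0) big_mkord et; have [qt|qt] := boolP (q \in t); first by exists t, c'.
exists (q :: t), (fun d => if d == q then 0 else c' d); split.
- by rewrite /= qt.
- exact: mem_head.
- by move=> d; case: eqP => // _; exact: gm_comp0.
rewrite big_cons eqxx add0r !big_seq; apply: eq_bigr => d dt.
by case: eqP => // e; rewrite -e dt in qt.
Qed.

Variables (A P : gradedModule K N.+1) (p : {additive A -> P}).
Hypothesis pD : forall d a, gm_comp d a -> gm_comp d (p a).

Lemma graded_lift q a : gm_comp q (p a) -> exists2 a', gm_comp q a' & p a' = p a.
Proof.
move=> h; have [s [c [us qs hc ea]]] := graded_decomposition a q.
exists (c q) => //; apply/eqP; rewrite -subr_eq0; apply/eqP.
have := @gm_direct _ _ P s (fun d => p (c d) - (if d == q then p a else 0)) us.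
move=> /(_ _ _ q qs); rewrite eqxx; apply.
  move=> d; apply: (familyB (gm_family P)); first exact: pD.
  by case: eqP => [->|_] //; exact: gm_comp0.
rewrite sumrB -raddf_sum -ea (bigD1_seq q) //= eqxx big1 ?addr0 ?subrr // => d /negPf ->.
by [].
Qed.

Lemma graded_kernel a : p a = 0 -> exists (s : seq int) (c : int -> A),
  (forall d, gm_comp d (c d) /\ p (c d) = 0) /\ a = \sum_(d <- s) c d.
Proof.
move=> h; have [s [c [us _ hc ea]]] := graded_decomposition a 0.
have z d : d \in s -> p (c d) = 0.
  apply: (@gm_direct _ _ P s (fun d => p (c d)) us) => [e|]; first exact: pD.
  by rewrite -raddf_sum -ea.
exists s, (fun d => if d \in s then c d else 0); split.
  by move=> d; case: ifP => [/z|_]; rewrite ?raddf0; split=> //; exact: gm_comp0.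
by rewrite ea !big_seq; apply: eq_bigr => d ->.
Qed.

End GradedMaps.

Section TorKoszul.
Variables (K : fieldType) (N : nat).
Local Notation S := {mpoly K[N.+1]}.
Variables (M : gradedModule K N.+1) (F : free_resolution M).

Definition res_module i := free_module K N (@res_deg _ _ _ F i).

Definition res_target i : gradedModule K N.+1 := if i is i'.+1 then res_module i' else M.

Definition res_map i : res_module i -> res_target i :=
  match i return res_module i -> res_target i with
  | 0 => fun v => \sum_k (v : 'rV[S]_(res_rank F 0)) 0 k *: res_aug k
  | i'.+1 => fun v => (v : 'rV[S]_(res_rank F i'.+1)) *m res_diff F i'
  end.

Fact res_map_is_zmod_morphism i : zmod_morphism (res_map (i := i)).
Proof.
case: i => [|i] u v /=; last exact: mulmxBl.
by rewrite -sumrB; apply: eq_bigr => k _; rewrite !mxE scalerBl.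
Qed.

HB.instance Definition _ i :=
  GRing.isZmodMorphism.Build _ _ (res_map (i := i)) (@res_map_is_zmod_morphism i).

Lemma res_mapX i j v : res_map (xact (res_module i) j v) = xact (res_target i) j (res_map v).
Proof.
case: i v => [|i] v /=; last by rewrite -scalemxAl.
by rewrite scaler_sumr; apply: eq_bigr => k _; rewrite scalerA mxE.
Qed.

Lemma mulmx_homog d r r' (e : 'I_r -> int) (e' : 'I_r' -> int) (v : 'rV[S]_r) (B : 'M_(r, r')) :
  free_comp e d v -> (forall k l, homogz (e k - e' l) (B k l)) -> free_comp e' d (v *m B).
Proof.
move=> hv hB l; rewrite mxE; apply: homogz_sum => k.
have -> : d - e' l = d - e k + (e k - e' l) by rewrite addrA subrK.
exact: homogzMz.
Qed.

Lemma res_mapD i d (v : res_module i) : gm_comp d v -> gm_comp d (res_map v).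
Proof.
case: i v => [|i] v /= hv; last exact: mulmx_homog hv (@res_diff_homog _ _ _ F i).
elim/big_ind: _ => [|u w|k _]; [exact: gm_comp0|exact: gm_compD|].
have := hv k; case E: (d - res_deg k) => [e|e] /= h; last by rewrite h scale0r; exact: gm_comp0.
by rewrite -[d](subrK (res_deg k)) E; apply: gm_compZ => //; exact: res_aug_homog.
Qed.

Lemma res_map_exact i (v : res_module i) :
  res_map v = 0 <-> exists w : res_module i.+1, v = res_map w.
Proof. by case: i v => [|i] v; [exact: res_exact0|exact: res_exact]. Qed.

(** The i-th syzygy module as a graded part of F_(i-1), the 0-th being [M]. *)
Definition target_family i : int -> res_target i -> Prop :=
  match i return int -> res_target i -> Prop with
  | 0 => @gm_comp _ _ M
  | i'.+1 => kernel_family (@gm_comp _ _ (res_module i')) (@res_map i')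
  end.

Lemma target_familyP i : graded_family (xact (res_target i)) (@target_family i).
Proof.
case: i => [|i]; first exact: gm_family.
exact: (kernel_graded_family (@res_mapX i) (gm_family _)).
Qed.

Lemma res_map_target i d (v : res_module i) : gm_comp d v -> target_family d (res_map v).
Proof.
case: i v => [|i] v hv; first exact: res_mapD.
by split; [exact: (@res_mapD i.+1 d v hv)|apply/res_map_exact; exists v].
Qed.

Lemma target_lift i d (v : res_target i) : target_family d v ->
  exists2 w : res_module i, gm_comp d w & v = res_map w.
Proof.
case: i v => [|i] v hv.
  have [w ew] := res_aug_surj F v; subst v.
  by have [w' hw' e] := graded_lift (@res_mapD 0) hv; exists w'.
have [hv0 /res_map_exact[w ew]] := hv; subst v.
by have [w' hw' e] := graded_lift (@res_mapD i.+1) hv0; exists w'.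
Qed.

Local Notation syzygy_exact s t q :=
  (kexact (xact (res_target s)) (@target_family s) N.+1 t q).
Local Notation syzygy_rel s t q :=
  (krel (xact (res_module s)) (@gm_comp _ _ (res_module s)) (@target_family s.+1) N.+1 t q).

(** Long exact sequence of the s-th free module over the s-th syzygy module with kernel the next
    one; the free module has no Koszul homology in positive degrees. *)
Lemma syzygy_rel_exact s t q : syzygy_exact s t.+1 q <-> syzygy_rel s t (q + 1).
Proof.
have e : q = q + 1 - 1 by rewrite addrK.
split=> h.
  apply: (kernel_krel (@xactC _ _ _) (@res_mapX s) (gm_family _) (@res_map_target s)).
    exact: target_lift.
  by rewrite -e.
rewrite [q in kexact _ _ _ _ q]e.
apply: (quotient_kexact (@res_mapX s) (gm_family _) (@res_map_target s) (@target_lift s) h).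
exact: free_kexact.
Qed.

Lemma syzygy_exact_shift s t q : syzygy_exact s t.+2 q <-> syzygy_exact s.+1 t.+1 (q + 1).
Proof.
rewrite syzygy_rel_exact; split=> h.
  apply: (krel_kexact _ h); last exact: free_kexact.
  by move=> d a [].
exact: (kexact_krel (@xactC _ _ _) h).
Qed.

(** Each step to the next syzygy module lowers the homological degree by one and raises the
    coefficient degree by one, until homological degree 0 is reached. *)
Lemma kexact_syzygy_rel i q : kexact (xact M) (@gm_comp _ _ M) N.+1 i.+1 q <->
  syzygy_rel i 0%N (q + i.+1%:Z).
Proof.
suff h s t : (s + t)%N = i -> syzygy_exact s t.+1 (q + s%:Z) <-> syzygy_rel i 0%N (q + i.+1%:Z).
  by rewrite -(h 0%N i) // addr0.
elim: t s => [|t IH] s e.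
  by move: e; rewrite addn0 => ->; rewrite syzygy_rel_exact -addrA -PoszD addn1.
rewrite syzygy_exact_shift -(IH s.+1); last by rewrite addSnnS.
by rewrite -addrA -PoszD addn1.
Qed.

End TorKoszul.

Section ConstantTerms.
Variables (K : fieldType) (N : nat).
Local Notation S := {mpoly K[N.+1]}.

Definition const_mx r r' (B : 'M[S]_(r, r')) : 'M[K]_(r, r') := map_mx (fun f : S => f@_0%MM) B.

Definition lift_mx r r' (B : 'M[K]_(r, r')) : 'M[S]_(r, r') := map_mx (@mpolyC N.+1 K) B.

Lemma const_mxM r r' r'' (A : 'M[S]_(r, r')) (B : 'M_(r', r'')) :
  const_mx (A *m B) = const_mx A *m const_mx B.
Proof. exact: (map_mxM (mcoeff 0%MM : {rmorphism S -> K})). Qed.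

Lemma const_mxB r r' (A B : 'M[S]_(r, r')) : const_mx (A - B) = const_mx A - const_mx B.
Proof. by apply/matrixP => k l; rewrite !mxE mcoeffB. Qed.

Lemma lift_mxK r r' (B : 'M[K]_(r, r')) : const_mx (lift_mx B) = B.
Proof. by apply/matrixP => k l; rewrite !mxE mcoeffC eqxx mulr1. Qed.

Lemma const_xact r (deg : 'I_r -> int) j (v : free_module K N deg) :
  const_mx (xact _ j v : 'rV_r) = 0.
Proof. by apply/matrixP => k l; rewrite !mxE mcoeffXM0 // mnm0E. Qed.

Lemma lift_mx_homog r (deg : 'I_r -> int) d (v : 'rV[K]_r) :
  (forall k, v 0 k != 0 -> deg k = d) -> free_comp deg d (lift_mx v).
Proof.
move=> h k; rewrite mxE; have [->|/h ->] := eqVneq (v 0 k) 0.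
  by rewrite mpolyC0; exact: homogz0.
by rewrite subrr -[_%:MP]mulr1 mul_mpolyC; apply: homogzZ; exact: dhomog1.
Qed.

Lemma const_mx_homog r (deg : 'I_r -> int) d (v : 'rV[S]_r) : free_comp deg d v ->
  forall k, const_mx v 0 k != 0 -> deg k = d.
Proof.
move=> hv k; rewrite mxE => /(homogz_mcoeff (hv k)); rewrite mdeg0 => /eqP.
by rewrite subr_eq0 => /eqP.
Qed.

Lemma const_mx_eq0 r (deg : 'I_r -> int) d (v : free_module K N deg) : gm_comp d v ->
  const_mx (v : 'rV_r) = 0 ->
  exists2 g : nat -> free_module K N deg, (forall j, gm_comp (d - 1) (g j)) &
    v = \sum_(j < N.+1) xact (free_module K N deg) j (g j).
Proof.
move=> hv v0; apply: (free_ideal_gen (leqnn _) hv) => l m ne.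
have m0 : m != 0%MM.
  by apply: contraNneq ne => ->; move/matrixP/(_ 0 l): v0; rewrite !mxE => ->.
have [j mj] : exists j, m j != 0%N.
  apply/existsP; apply: contraNT m0; rewrite negb_exists => /forallP h.
  by apply/eqP/mnmP => j; rewrite mnm0E; apply/eqP; rewrite -[_ == _]negbK.
by exists j.
Qed.

End ConstantTerms.

Arguments lift_mx {K N r r'} B.

Section TorKoszul.
Variables (K : fieldType) (N : nat).
Local Notation S := {mpoly K[N.+1]}.
Variables (M : gradedModule K N.+1) (F : free_resolution M).

(** The cycle condition of F tensor K, read on the image of a lift: no constant terms. *)
Definition res_min i : res_target F i -> Prop :=
  match i return res_target F i -> Prop with
  | 0 => fun _ => True
  | i'.+1 => fun z => const_mx (z : 'rV[S]_(res_rank F i')) = 0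
  end.

Lemma tor_cycle_lift i (v : 'rV[K]_(res_rank F i)) (y : res_module F i) :
  const_mx (y : 'rV_(res_rank F i)) = v -> tor_cycle v <-> res_min (res_map y).
Proof.
case: i v y => [|i] v y //= ev; rewrite -ev.
by split=> h; [rewrite const_mxM|rewrite /= const_mxM in h].
Qed.

(** For i > 0 both sides say that the i-th syzygy module modulo the variables injects into F_(i-1)
    modulo the variables in degree j; for i = 0, that M_j lies in the variables times M. *)
Lemma tor_vanishing i j :
  (forall v : 'rV[K]_(res_rank F i), tor_deg j v -> tor_cycle v -> tor_boundary j v) <->
  (forall z : res_target F i, target_family j z -> res_min z ->
     exists2 w : koszul (res_target F i) N.+1, kgr (@target_family _ _ _ F i) 1 (j - 1) w &
       kinc N.+1 z = kdiff (xact (res_target F i)) w).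
Proof.
split=> h.
  move=> z hz mz; have [y hy ey] := target_lift hz; subst z.
  have [||w [hw ew]] := h (const_mx (y : 'rV_(res_rank F i))).
  - exact: const_mx_homog hy.
  - exact/(tor_cycle_lift (y := y)).
  have hlw : gm_comp j (lift_mx w : res_module F i.+1) by exact: lift_mx_homog.
  have hy' : gm_comp j (y - res_map (lift_mx w : res_module F i.+1) : res_module F i).
    by apply: (familyB (gm_family _)) => //; exact: (@res_mapD _ _ _ F i.+1).
  have [|g hg eg] := const_mx_eq0 hy'.
    by rewrite const_mxB /= const_mxM lift_mxK ew subrr.
  apply/(kdiff_degree1P (target_familyP F i)).
  exists (fun k => res_map (g k)); first by move=> k; exact: res_map_target.
  have e0 : res_map (res_map (lift_mx w : res_module F i.+1) : res_module F i) = 0.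
    by apply/res_map_exact; exists (lift_mx w).
  rewrite -[LHS]subr0 -{1}e0 -raddfB eg raddf_sum.
  by apply: eq_bigr => k _; exact: res_mapX.
move=> v dv cv.
have hlv : gm_comp j (lift_mx v : res_module F i) by exact: lift_mx_homog.
have [||w hw ew] := h (res_map (lift_mx v : res_module F i)).
- exact: res_map_target.
- by apply/(tor_cycle_lift (v := v)) => //; exact: lift_mxK.
have [|g hg eg] := (kdiff_degree1P (target_familyP F i) N.+1 (j - 1)
    (res_map (lift_mx v : res_module F i))).1; first by exists w.
have [b hb] := boolp.choice (fun k => let: ex_intro2 b h1 h2 := target_lift (hg k) in
  ex_intro (fun b => gm_comp (j - 1) b /\ g k = res_map b) b (conj h1 h2)).
(* [u] lifts [v] up to multiples of the variables and is killed by the next map, hence comes from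
   F_(i+1). *)
pose u : res_module F i := lift_mx v - \sum_(k < N.+1) xact (res_module F i) k (b k).
have hu : gm_comp j u.
  apply: (familyB (gm_family _)) => //; elim/big_ind: _ => [|a c|k _].
  + exact: gm_comp0.
  + exact: gm_compD.
  + by rewrite -[j](subrK 1); apply: (familyX (gm_family _)); case: (hb k).
have [|w' ew'] := (@res_map_exact _ _ _ F i u).1.
  rewrite raddfB raddf_sum; move: eg => /= ->; apply/eqP; rewrite subr_eq0; apply/eqP.
  apply: eq_bigr => k _; case: (hb k) => _ ->; exact: esym (res_mapX _ _).
move: hu; rewrite ew' => /(graded_lift (@res_mapD _ _ _ F i.+1)) [w'' hw'' e''].
exists (const_mx (w'' : 'rV_(res_rank F i.+1))); split; first exact: const_mx_homog hw''.
have -> : const_mx (w'' : 'rV_(res_rank F i.+1)) *m tor_diff F i =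
    const_mx (u : 'rV_(res_rank F i)) by rewrite -const_mxM ew' -e''.
rewrite const_mxB lift_mxK.
suff -> : const_mx (\sum_(k < N.+1) xact (res_module F i) k (b k) : 'rV_(res_rank F i)) = 0.
  by rewrite subr0.
apply/matrixP => k l; rewrite mxE summxE raddf_sum mxE big1 // => l' _.
by have /matrixP/(_ k l) := const_xact l' (b l'); rewrite !mxE.
Qed.

(** Internal degree j in homological degree i means coefficients of degree j - i. The right side
    does not mention [F], which gives independence of the resolution. *)
Lemma tor_kexact i j :
  (forall v : 'rV[K]_(res_rank F i), tor_deg j v -> tor_cycle v -> tor_boundary j v) <->
  kexact (xact M) (@gm_comp _ _ M) N.+1 i (j - i%:Z).
Proof.
rewrite tor_vanishing; case: i => [|i].
  rewrite subr0; split=> h.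
    move=> z /kgr_kinc[v hv ->] _; have [|w hw ew] := h v hv; first by [].
    by exists w.
  move=> z hz _; have [||w [hw ew]] := h (kinc N.+1 z); last by exists w.
    by apply/kgr_kinc; exists z.
  by apply: (kdiff_degree0 _ (D := @gm_comp _ _ M) (q := j)); apply/kgr_kinc; exists z.
rewrite (kexact_syzygy_rel F) subrK; split=> h.
  move=> z /kgr_kinc[v hv ->] [w [hw ew]].
  have [|w' hw' ew'] := h v hv; last by exists w'.
  have [|g hg ->] := (kdiff_degree1P (gm_family (res_module F i)) N.+1 (j - 1) v).1.
    by exists w.
  rewrite /=; apply/matrixP => k l; rewrite mxE summxE raddf_sum mxE big1 // => l' _.
  by have /matrixP/(_ k l) := const_xact l' (g l'); rewrite !mxE.
move=> z hz mz; have [||w [hw ew]] := h (kinc N.+1 z); last by exists w.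
  by apply/kgr_kinc; exists z.
have [g hg eg] := const_mx_eq0 hz.1 mz.
have [|w hw ew] := (kdiff_degree1P (gm_family (res_module F i)) N.+1 (j - 1) z).2.
  by exists g.
by exists w.
Qed.

End TorKoszul.

(** * Existence of free resolutions *)

Section ResolutionExists.
Variables (K : fieldType) (N : nat).
Local Notation S := {mpoly K[N.+1]}.

Lemma subspace_basis s (V : 'rV[K]_s -> Prop) :
  V 0 -> (forall u v, V u -> V v -> V (u + v)) -> (forall c u, V u -> V (c *: u)) ->
  exists r (B : 'I_r -> 'rV[K]_s), (forall k, V (B k)) /\
    forall v, V v -> exists c : 'I_r -> K, v = \sum_k c k *: B k.
Proof.
move=> V0 VD VZ.
pose P r := exists B : 'M[K]_(r, s), row_free B /\ forall k, V (row k B).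
have P0 : exists r, `[< P r >].
  by exists 0%N; apply/asboolP; exists 0; split; [rewrite /row_free mxrank0|case].
have Ps r : `[< P r >] -> (r <= s)%N.
  by move=> /asboolP[B [fB _]]; move: fB => /eqP <-; exact: rank_leq_col.
case: (ex_maxnP P0 Ps) => r /asboolP[B [fB VB]] maxr.
exists r, (fun k => row k B); split=> // v Vv.
have [/submxP[c ->]|nv] := boolP (v <= B)%MS.
  by exists (c 0); rewrite mulmx_sum_row.
suff : P r.+1 by move=> /asboolP /maxr; rewrite ltnn.
rewrite -addn1; exists (col_mx B v); split.
  rewrite /row_free eqn_leq rank_leq_row /=; apply: (leq_trans (n := r.+1)); first by rewrite addn1.
  have /rank_ltmx : (B < col_mx B v)%MS; last by rewrite (eqP fB).
  have h : (v <= col_mx B v)%MS by rewrite -addsmxE addsmxSr.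
  rewrite ltmxE -{1}addsmxE addsmxSl /=; apply: contra nv; exact: submx_trans.
move=> k; rewrite -[k]splitK; case: (split k) => j /=; first by rewrite rowKu.
by rewrite rowKd row_id ?ord1.
Qed.

(** Z is a graded submodule that is bounded below, has finite-dimensional pieces ([tame_coord]) and
    has no Koszul homology in coefficient degrees above b. These properties give finitely many
    generators and pass to the relations among them. *)
Record tame (P : gradedModule K N.+1) (Z : P -> Prop) (b : nat) : Prop := Tame {
  tame0 : Z 0;
  tameD : forall u v, Z u -> Z v -> Z (u + v);
  tameZ : forall (f : S) u, Z u -> Z (f *: u);
  tame_dec : forall u, Z u -> exists (s : seq int) (c : int -> P),
    (forall d, gm_comp d (c d) /\ Z (c d)) /\ u = \sum_(d <- s) c d;
  tame_neg : forall d u, d < 0 -> gm_comp d u -> Z u -> u = 0;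
  tame_coord : forall d, exists s (phi : P -> 'rV[K]_s),
    [/\ forall u v, phi (u + v) = phi u + phi v, forall (c : K) u, phi (c%:MP *: u) = c *: phi u
      & forall u, gm_comp d u -> Z u -> phi u = 0 -> u = 0];
  tame_exact : forall i (q : int), b%:Z < q ->
    kexact (xact P) (fun d u => gm_comp d u /\ Z u) N.+1 i q }.

Section Generators.
Variables (P : gradedModule K N.+1) (Z : P -> Prop) (b : nat).
Hypothesis tZ : tame Z b.

Lemma tame_piece_basis d : exists r (g : 'I_r -> P), (forall k, gm_comp d (g k) /\ Z (g k)) /\
  forall u, gm_comp d u -> Z u -> exists c : 'I_r -> K, u = \sum_k (c k)%:MP *: g k.
Proof.
have [s [phi [phiD phiZ phiI]]] := tame_coord tZ d.
have phi0 : phi 0 = 0 by rewrite -[in LHS](scaler0 P ((0 : K)%:MP)) phiZ scale0r.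
have gmZ c u : gm_comp d u -> gm_comp d (c%:MP *: u : P).
  move=> h; rewrite -[d]add0r; apply: (gm_compZ (e := 0)) => //.
  by rewrite -[_%:MP]mulr1 mul_mpolyC dhomogZ ?dhomog1.
have [|||r [B [VB Bs]]] := @subspace_basis s
    (fun w => exists2 u, gm_comp d u /\ Z u & w = phi u).
- by exists 0 => //; split; [exact: gm_comp0|exact: tame0 tZ].
- move=> _ _ [u [hu Zu] ->] [v [hv Zv] ->]; exists (u + v); last by rewrite phiD.
  by split; [exact: gm_compD|exact: tameD tZ _ _ _ _].
- move=> c _ [u [hu Zu] ->]; exists (c%:MP *: u); last by rewrite phiZ.
  by split; [exact: gmZ|exact: tameZ tZ _ _ _].
have [g hg] := boolp.choice (fun k => let: ex_intro2 u h1 h2 := VB k in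
  ex_intro (fun u => (gm_comp d u /\ Z u) /\ B k = phi u) u (conj h1 h2)).
exists r, g; split=> [k|u hu Zu]; first exact: (hg k).1.
have [|c ec] := Bs (phi u); first by exists u.
exists c; pose w := \sum_k (c k)%:MP *: g k.
have phiw : phi w = phi u.
  rewrite ec (big_morph phi phiD phi0); apply: eq_bigr => k _.
  by rewrite phiZ (hg k).2.
have [hw Zw] : gm_comp d w /\ Z w.
  rewrite /w; elim/big_ind: _ => [|v1 v2 [h1 h2] [h3 h4]|k _].
  - by split; [exact: gm_comp0|exact: tame0 tZ].
  - by split; [exact: gm_compD|exact: tameD tZ _ _ _ _].
  - by have [[h1 h2] _] := hg k; split; [exact: gmZ|exact: tameZ tZ _ _ _].
have eN : -1 = (-1)%:MP :> S by rewrite mpolyCN.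
apply/eqP; rewrite -subr_eq0; apply/eqP; rewrite -scaleN1r eN.
apply: phiI.
- by apply: gm_compD => //; exact: gmZ.
- by apply: (tameD tZ) => //; exact: (tameZ tZ).
- by rewrite phiD phiZ phiw scaleN1r subrr.
Qed.

Definition spans (I : finType) (g : I -> P) (u : P) :=
  exists v : I -> S, u = \sum_k v k *: g k.

Lemma spansD (I : finType) (g : I -> P) u w : spans g u -> spans g w -> spans g (u + w).
Proof.
move=> [v ->] [v' ->]; exists (fun k => v k + v' k).
by rewrite -big_split; apply: eq_bigr => k _; rewrite scalerDl.
Qed.

Lemma spans0 (I : finType) (g : I -> P) : spans g 0.
Proof. by exists (fun _ => 0); rewrite big1 // => k _; rewrite scale0r. Qed.

Lemma spansZ (I : finType) (g : I -> P) f u : spans g u -> spans g (f *: u).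
Proof.
move=> [v ->]; exists (fun k => f * v k).
by rewrite scaler_sumr; apply: eq_bigr => k _; rewrite scalerA.
Qed.

Lemma spans_sum (I : finType) (g : I -> P) J (s : seq J) (F : J -> P) :
  (forall j, spans g (F j)) -> spans g (\sum_(j <- s) F j).
Proof. by move=> h; elim/big_ind: _ => //; [exact: spans0|exact: spansD]. Qed.

Lemma tame_low_generators B : exists (I : finType) (deg : I -> nat) (g : I -> P),
  (forall k, [/\ (deg k < B)%N, gm_comp (deg k)%:Z (g k) & Z (g k)]) /\
  forall d u, (d < B)%N -> gm_comp d%:Z u -> Z u -> spans g u.
Proof.
elim: B => [|B [I [deg [g [hg sg]]]]].
  by exists void, (fun v : void => match v with end), (fun v : void => match v with end); split=> [[]|].
have [r [g' [hg' sg']]] := tame_piece_basis B%:Z.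
exists (I + 'I_r)%type, (fun t => if t is inl k then deg k else B),
  (fun t => match t with inl k => g k | inr k => g' k end); split.
  move=> [k|k]; last by have [h1 h2] := hg' k; split.
  by have [h1 h2 h3] := hg k; split=> //; exact: ltnW.
move=> d u; rewrite ltnS leq_eqVlt => /orP[/eqP -> hu Zu|dB hu Zu].
  have [c ->] := sg' u hu Zu.
  exists (fun t => match t with inl _ => 0 | inr k => (c k)%:MP end).
  by rewrite big_sumType /= [X in _ = X + _]big1 ?add0r // => k _; rewrite scale0r.
have [c ->] := sg d u dB hu Zu.
exists (fun t => match t with inl k => c k | inr _ => 0 end).
by rewrite big_sumType /= [X in _ = _ + X]big1 ?addr0 // => k _; rewrite scale0r.
Qed.

(** Above degree b, exactness in homological degree 0 writes every element through the variables and
    elements of lower degree, so bases of the pieces up to degree b generate. *)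
Lemma tame_generators : exists r (deg : 'I_r -> nat) (g : 'I_r -> P),
  (forall k, [/\ (deg k <= b)%N, gm_comp (deg k)%:Z (g k) & Z (g k)]) /\
  forall u, Z u -> exists v : 'rV[S]_r, u = \sum_k v 0 k *: g k.
Proof.
have [I [deg [g [hg sg]]]] := tame_low_generators b.+1.
have fD : graded_family (xact P) (fun d u => gm_comp d u /\ Z u).
  split=> [q|q u v [h1 h2] [h3 h4]|q k u [h1 h2]].
  - by split; [exact: gm_comp0|exact: tame0 tZ].
  - split; first exact: (familyB (gm_family P)).
    by apply: (tameD tZ) => //; rewrite -scaleN1r; exact: (tameZ tZ).
  - by split; [exact: (familyX (gm_family P))|exact: (tameZ tZ)].
have sn (d : nat) u : gm_comp d%:Z u -> Z u -> spans g u.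
  elim/ltn_ind: d u => d IH u hu Zu; have [db|bd] := ltnP d b.+1; first exact: sg hu Zu.
  case: d bd IH hu => // d bd IH hu.
  have [|||w [hw ew]] := @tame_exact _ _ _ tZ 0%N d.+1%:Z _ (kinc N.+1 u).
  - by rewrite ltz_nat.
  - by apply/kgr_kinc; exists u.
  - by apply: (kdiff_degree0 _ (D := @gm_comp _ _ P) (q := d.+1%:Z)); apply/kgr_kinc; exists u.
  have [|h hh ->] := (kdiff_degree1P fD N.+1 (d.+1%:Z - 1) u).1; first by exists w.
  apply: spans_sum => j; apply: spansZ; have [h1 h2] := hh j.
  apply: (IH d) => //; have <- // : d.+1%:Z - 1 = d by rewrite -addn1 PoszD addrK.
have sz u : Z u -> spans g u.
  move=> Zu; have [s [c [hc ->]]] := tame_dec tZ Zu.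
  apply: spans_sum => d; have [h1 h2] := hc d; case: d h1 h2 => d h1 h2; first exact: sn h1 h2.
  by rewrite (tame_neg tZ _ h1 h2) //; exact: spans0.
exists #|I|, (fun k => deg (enum_val k)), (fun k => g (enum_val k)); split.
  by move=> k; have [h1 h2 h3] := hg (enum_val k).
move=> u /sz[v ->]; exists (\row_k v (enum_val k)).
rewrite (reindex_onto enum_val enum_rank) /=; last by move=> k _; rewrite enum_rankK.
by apply: eq_big => [k|k _]; rewrite ?mxE // enum_valK eqxx.
Qed.

End Generators.

End ResolutionExists.

Section Iterate.
Variables (K : fieldType) (N : nat).
Local Notation S := {mpoly K[N.+1]}.

Definition gen_map (P : gradedModule K N.+1) r (g : 'I_r -> P) (v : 'rV[S]_r) : P :=
  \sum_k v 0 k *: g k.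

Fact gen_map_is_zmod_morphism (P : gradedModule K N.+1) r (g : 'I_r -> P) :
  zmod_morphism (gen_map g).
Proof.
by move=> u v; rewrite /gen_map -sumrB; apply: eq_bigr => k _; rewrite !mxE scalerBl.
Qed.

HB.instance Definition _ (P : gradedModule K N.+1) r (g : 'I_r -> P) :=
  GRing.isZmodMorphism.Build _ _ (gen_map g) (@gen_map_is_zmod_morphism P r g).

Lemma gen_mapZ (P : gradedModule K N.+1) r (g : 'I_r -> P) f v :
  gen_map g (f *: v) = f *: gen_map g v.
Proof. by rewrite /gen_map scaler_sumr; apply: eq_bigr => k _; rewrite mxE scalerA. Qed.

Lemma gen_map_homog (P : gradedModule K N.+1) r (deg : 'I_r -> int) (g : 'I_r -> P) d v :
  (forall k, gm_comp (deg k) (g k)) -> free_comp deg d v -> gm_comp d (gen_map g v).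
Proof.
move=> hg hv; rewrite /gen_map; elim/big_ind: _ => [|u w|k _].
- exact: gm_comp0.
- exact: gm_compD.
have := hv k; case E: (d - deg k) => [e|e] /= h; last by rewrite h scale0r; exact: gm_comp0.
by rewrite -[d](subrK (deg k)) E; exact: gm_compZ.
Qed.

Lemma free_coord r (deg : 'I_r -> nat) d : exists s (phi : 'rV[S]_r -> 'rV[K]_s),
  [/\ forall u v, phi (u + v) = phi u + phi v, forall (c : K) u, phi (c%:MP *: u) = c *: phi u
    & forall u, free_comp (fun k => (deg k)%:Z) d u -> phi u = 0 -> u = 0].
Proof.
pose I : finType := ('I_r * 'X_{1.. N.+1 < `|d|%N.+1})%type.
exists #|I|, (fun u : 'rV[S]_r => \row_(t < #|I|) (u 0 (enum_val t).1)@_(bmnm (enum_val t).2)); split.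
- by move=> u v; apply/rowP => t; rewrite !mxE mcoeffD.
- by move=> c u; apply/rowP => t; rewrite !mxE mcoeffCM.
move=> u hu e; apply/rowP => k; rewrite mxE; apply/mpolyP => m; rewrite mcoeff0.
apply/eqP; apply: contraT => ne; have em := homogz_mcoeff (hu k) ne.
have hm : (mdeg m < `|d|%N.+1)%N by move: em; clear; lia.
have /rowP/(_ (enum_rank (k, BMultinom hm))) := e; rewrite !mxE enum_rankK /= => h.
by rewrite h eqxx in ne.
Qed.

Lemma free_kexact0 r (deg : 'I_r -> nat) (b : nat) (q : int) : (forall k, deg k <= b)%N -> b%:Z < q ->
  kexact (xact (free_module K N (fun k => (deg k)%:Z))) (@gm_comp _ _ (free_module K N (fun k => (deg k)%:Z)))
    N.+1 0 q.
Proof.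
move=> hb bq z /kgr_kinc[v hv ->] _.
have [|g hg eg] := const_mx_eq0 hv.
  apply/rowP => k; rewrite [RHS]mxE; apply/eqP; apply: contraT => /(const_mx_homog hv) e.
  by move: (hb k) bq e; clear; lia.
have [|w hw ew] := (kdiff_degree1P (gm_family _) N.+1 (q - 1) v).2; first by exists g.
by exists w.
Qed.

(** The connecting map shifts coefficient degrees by one, whence the bound b + 1. *)
Lemma tame_kernel (P : gradedModule K N.+1) (Z : P -> Prop) b r (deg : 'I_r -> nat) (g : 'I_r -> P) :
  tame Z b ->
  (forall k, [/\ (deg k <= b)%N, gm_comp (deg k)%:Z (g k) & Z (g k)]) ->
  (forall u, Z u -> exists v, u = gen_map g v) ->
  tame (fun v : free_module K N (fun k => (deg k)%:Z) => gen_map g v = 0) b.+1.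
Proof.
move=> tZ hg sg; set F := free_module _ _ _.
have pD d (v : F) : gm_comp d v -> gm_comp d (gen_map g v).
  by apply: (@gen_map_homog P r (fun k => (deg k)%:Z)) => k; case: (hg k).
have Zg v : Z (gen_map g v).
  rewrite /gen_map; elim/big_ind: _ => [|u w|k _].
  - exact: tame0 tZ.
  - exact: tameD tZ _ _.
  - by apply: (tameZ tZ); case: (hg k).
have px j (v : F) : gen_map g (xact F j v) = xact P j (gen_map g v) by exact: gen_mapZ.
split.
- exact: raddf0.
- by move=> u v hu hv; rewrite raddfD /= hu hv addr0.
- by move=> f u hu; rewrite gen_mapZ hu scaler0.
- by move=> u; exact: (@graded_kernel K N F P (gen_map g) pD).
- move=> d u d0 hu _; apply/rowP => k; rewrite mxE; apply/mpolyP => m; rewrite mcoeff0.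
  apply/eqP; apply: contraT => /(homogz_mcoeff (hu k)) e; move: d0 e; clear; lia.
- move=> d; have [s [phi [h1 h2 h3]]] := free_coord deg d.
  by exists s, phi; split=> // u hu _; exact: h3.
move=> i q bq; have bq' : b%:Z < q by move: bq; clear; lia.
have rel : krel (xact F) (@gm_comp _ _ F) (kernel_family (@gm_comp _ _ F) (gen_map g)) N.+1 i q.
  apply: (@kernel_krel F P (xact F) (xact P) (@gm_comp _ _ F) (fun d u => gm_comp d u /\ Z u) (gen_map g)).
  - exact: xactC.
  - exact: px.
  - exact: gm_family.
  - by move=> d v hv; split; [exact: pD|exact: Zg].
  - move=> d u [hu /sg[v ev]]; subst u.
    by have [v' hv' e] := graded_lift (A := F) pD hu; exists v'.
  - by apply: (tame_exact tZ); move: bq; clear; lia.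
apply: (krel_kexact _ rel); first by move=> d v [].
case: i {rel} => [|i]; last exact: free_kexact.
by apply: (@free_kexact0 r deg b) => // k; case: (hg k).
Qed.

(** A free module with the submodule that remains to be covered, packed for the recursion that
    builds the resolution. *)
Definition stage := {r : nat & ('I_r -> nat) * ('rV[S]_r -> Prop)}%type.

Definition stage_module (st : stage) := free_module K N (fun k => ((projT2 st).1 k)%:Z).

Definition good_stage (st : stage) := exists b, @tame K N (stage_module st) (projT2 st).2 b.

Lemma next_stage (st : stage) : good_stage st ->
  exists (st' : stage) (B : 'M[S]_(projT1 st', projT1 st)),
    [/\ good_stage st', forall k l, homogz (((projT2 st').1 k)%:Z - ((projT2 st).1 l)%:Z) (B k l),
      forall v, (projT2 st).2 v <-> exists w, v = w *m B &
      forall w, (projT2 st').2 w <-> w *m B = 0].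
Proof.
move=> [b tZ]; have [r [deg [g [hg sg]]]] := tame_generators tZ.
pose B : 'M[S]_(r, projT1 st) := \matrix_k (g k : 'rV_(projT1 st)).
have eB v : gen_map g v = v *m B.
  by rewrite mulmx_sum_row; apply: eq_bigr => k _; rewrite rowK.
exists (existT _ r (deg, fun v => gen_map g v = 0)), B; split.
- by exists b.+1; exact: tame_kernel tZ hg sg.
- by move=> k l; rewrite mxE; case: (hg k) => _ h _; exact: h.
- move=> v; split=> [/sg[w ->]|[w ->]]; first by exists w; exact: eB.
  rewrite -eB /gen_map; elim/big_ind: _ => [|u1 u2|k _].
  + exact: tame0 tZ.
  + exact: tameD tZ _ _.
  + by apply: (tameZ tZ); case: (hg k).
- by move=> w; rewrite /= eB.
Qed.

Lemma free_resolution_exists (M : gradedModule K N.+1) b : tame (fun _ : M => True) b ->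
  inhabited (free_resolution M).
Proof.
move=> tM; have [r [deg [g [hg sg]]]] := tame_generators tM.
pose st0 : stage := existT _ r (deg, fun v => gen_map g v = 0).
have good0 : good_stage st0.
  by exists b.+1; apply: (tame_kernel tM) => // u _; exact: sg.
pose good := {st | good_stage st}.
(* [cid] turns existence into data, and the formats of consecutive differentials then agree by
   computation of [chain]. *)
have next (s : good) : {s' : good & {B : 'M[S]_(projT1 (sval s'), projT1 (sval s)) |
    [/\ forall k l, homogz (((projT2 (sval s')).1 k)%:Z - ((projT2 (sval s)).1 l)%:Z) (B k l),
      forall v, (projT2 (sval s)).2 v <-> exists w, v = w *m B &
      forall w, (projT2 (sval s')).2 w <-> w *m B = 0]}}.
  have /boolp.cid [st' /boolp.cid [B [h1 h2 h3 h4]]] := next_stage (svalP s).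
  by exists (exist _ st' h1), B.
pose chain := fix chain i : good := if i is i'.+1 then projT1 (next (chain i')) else exist _ st0 good0.
constructor.
refine (@FreeResolution K N.+1 M (fun i => projT1 (sval (chain i)))
  (fun i k => ((projT2 (sval (chain i))).1 k)%:Z)
  (fun i => sval (projT2 (next (chain i)))) g _ _ _ _ _).
- by move=> i k l; case: (svalP (projT2 (next (chain i)))) => h _ _; exact: h.
- by move=> k; case: (hg k).
- by move=> u; exact: sg.
- by move=> v; case: (svalP (projT2 (next (chain 0%N)))) => _ h _; exact: h.
move=> i v; case: (svalP (projT2 (next (chain i)))) => _ _ h1.
case: (svalP (projT2 (next (chain i.+1)))) => _ h2 _.
by rewrite -h2; apply: iff_sym; exact: h1.
Qed.

End Iterate.

(** * The coordinate ring of a collection of lines *)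

Section LineFamily.
Variables (K : numFieldType) (q m : nat) (u v : 'I_m -> 'I_q.+3 -> K).
Local Notation S := {mpoly K[q.+3]}.
Hypothesis frames : forall i, is_graph_frame (u i) (v i).

(** With too many conditions there is a linear relation among the restriction functionals, and the
    solution of a unit system violates it. *)
Lemma config_solvable_leq d : config_solvable d u v (@no_points K q.+3) ->
  (m * d.+1 <= 'C(q.+2 + d, d))%N.
Proof.
move=> s; rewrite leqNgt; apply/negP => lt.
have [b hb] := @forms_spanned K q.+2 d.
pose phi (jk : 'I_m * 'I_d.+1) f := (lf (u jk.1) (v jk.1) f)`_jk.2.
have [|y [[jk0 y0] hy]] := linear_relation (fun jk k => phi jk (b k)).
  by rewrite card_prod !card_ord.
have hy' f : f \is d.-homog -> \sum_jk y jk * phi jk f = 0.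
  have sphi jk : scalar (phi jk) by exact: coef_lf_scalar.
  move=> /hb[c ->]; under eq_bigr => jk _ do rewrite (scalar_sum _ _ (sphi jk)) mulr_sumr.
  rewrite exchange_big big1 // => k _; under eq_bigr => jk _ do rewrite mulrCA.
  by rewrite -mulr_sumr hy mulr0.
have [f [hf ef]] := s (fun t => match t with inl jk => (jk == jk0)%:R | inr w => match w with end end).
case/eqP: y0; rewrite -[RHS](hy' f hf) (bigD1 jk0) //= big1 => [|jk ne].
  by rewrite addr0 /phi (ef (inl jk0)) eqxx mulr1.
by rewrite /phi (ef (inl jk)) (negPf ne) mulr0.
Qed.

(** The product of the coordinate rings of the lines, each dehomogenized. The graded pieces become
    nested, and on graph frames x_0 acts as the identity map while raising the degree. *)
Definition line_family := {ffun 'I_m -> {poly K}}.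

Definition line_act (k : nat) (e : line_family) : line_family :=
  [ffun i => lf (u i) (v i) 'X_(inord k) * e i].

Fact line_act_is_zmod_morphism k : zmod_morphism (line_act k).
Proof. by move=> e e'; apply/ffunP => i; rewrite !ffunE mulrBr. Qed.

HB.instance Definition _ k :=
  GRing.isZmodMorphism.Build _ _ (line_act k) (line_act_is_zmod_morphism k).

Definition line_comp (d : int) (e : line_family) : Prop :=
  match d with
  | Posz n => forall i, (size (e i) <= n.+1)%N
  | Negz _ => e = 0
  end.

Lemma line_actC j k e : line_act j (line_act k e) = line_act k (line_act j e).
Proof. by apply/ffunP => i; rewrite !ffunE mulrCA. Qed.

Lemma line_act0 e : line_act 0 e = e.
Proof.
have h0 : inord 0 = ord0 :> 'I_q.+3 by apply: val_inj; rewrite /= inordK.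
apply/ffunP => i; rewrite ffunE h0 lfX; have [-> _ -> _] := frames i.
by rewrite mul0r addr0 mul1r.
Qed.

Lemma line_act1 e : line_act 1 e = [ffun i => 'X * e i].
Proof.
have h : inord 1 = lift ord0 ord0 :> 'I_q.+3 by apply: val_inj; rewrite /= inordK.
apply/ffunP => i; rewrite !ffunE h lfX; have [_ -> _ ->] := frames i.
by rewrite add0r mul1r.
Qed.

Lemma line_comp_family : graded_family line_act line_comp.
Proof.
split=> [[n|n]|[n|n] a b|[n|[|n]] k a] //=.
- by move=> i; rewrite ffunE size_poly0.
- by move=> ha hb i; rewrite !ffunE (leq_trans (size_polyD _ _)) // size_polyN geq_max ha hb.
- by move=> -> ->; rewrite subr0.
- move=> ha i; rewrite addn1 ffunE; have [->|ne] := eqVneq (a i) 0; first by rewrite mulr0 size_poly0.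
  apply: leq_trans (size_polyMleq _ _) _.
  have h : (size (lf (u i) (v i) 'X_(inord k)) <= 2)%N by apply: size_lf; rewrite dhomogX /= mdeg1.
  by have := leq_add h (ha i); rewrite add2n; case: (_ + _)%N.
- by move=> ->; rewrite raddf0 => i; rewrite ffunE size_poly0.
- by move=> ->; rewrite raddf0.
Qed.

Definition line_const (e : line_family) : line_family := [ffun i => ((e i)`_0)%:P].
Definition line_div (e : line_family) : line_family := [ffun i => \poly_(k < (size (e i)).-1) (e i)`_k.+1].

Lemma line_divK e : e = line_const e + line_act 1 (line_div e).
Proof.
apply/ffunP => i; rewrite line_act1 !ffunE; apply/polyP => -[|k].
  by rewrite coefD coefC coefXM /= addr0.
rewrite coefD coefC coefXM /= add0r coef_poly; case: ltnP => // h.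
by rewrite nth_default //; move: h; clear; lia.
Qed.

Lemma line_const_comp n e : line_comp (Posz n) (line_const e).
Proof. by move=> i; rewrite ffunE (leq_trans (size_polyC_leq1 _)). Qed.

Lemma line_div_comp n e : line_comp (Posz n.+1) e -> line_comp (Posz n) (line_div e).
Proof.
move=> h i; rewrite ffunE (leq_trans (size_poly _ _)) //.
by move: (h i); clear; lia.
Qed.

(** On each line x_0 and x_1 act as the two homogeneous parameters, a regular sequence with quotient
    in degree 0 only; this settles two variables by explicit formulas. Further variables preserve
    exactness by [kexact_coneS]. *)
Lemma line_kexact k i (d : int) : (2 <= k)%N -> 0 < d -> kexact line_act line_comp k i d.
Proof.
move=> k2 d0; case: d d0 => // -[|n] // _.
have en : (n.+1%:Z - 1) = n by rewrite -addn1 PoszD addrK.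
elim: k i k2 => // -[|[|k]] IH i // _; last first.
  apply: (kexact_coneS line_actC line_comp_family) => i' _; exact: IH.
have Z : graded_family line_act line_comp := line_comp_family.
(* Here b and c are the coefficients of the two exterior generators and e that of their product. *)
have kd (a b c e : line_family) : kdiff line_act (((a, b), (c, e)) : koszul line_family 2) =
    ((b + line_act 1 c, line_act 1 e), (- e, 0)).
  rewrite -[LHS]/(((0 + line_act 0 b) + line_act 1 c, - 0 + line_act 1 e), (- (0 + line_act 0 e), - - 0)).
  by rewrite !line_act0 oppr0 !add0r oppr0.
have kd0 : kdiff line_act (((0, 0), (0, 0)) : koszul line_family 2) = ((0, 0), (0, 0)).
  by rewrite kd !raddf0 addr0.
rewrite /kexact en => -[[a b] [c e]]; rewrite kd; case: i => [|[|[|i]]].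
- move=> [[ha /= b0] /= [c0 e0]] _; subst b c e.
  have h := kd 0 (line_const a) (line_div a) 0; rewrite -line_divK !raddf0 in h.
  exists ((0, line_const a), (line_div a, 0)); split; last exact: esym h.
  by split; split=> //; [exact: line_const_comp|exact: line_div_comp].
- move=> [[/= a0 hb] [/= hc e0]] [] eb; subst a e.
  have {eb} eb : b = - line_act 1 c by apply/eqP; rewrite -addr_eq0 eb.
  have h := kd 0 0 0 (- c); rewrite raddf0 addr0 raddfN -eb opprK in h.
  exists ((0, 0), (0, - c)); split; last exact: esym h.
  split; split=> //= i; rewrite ffunE size_polyN.
  move: (hb i); rewrite eb line_act1 !ffunE size_polyN.
  have [->|ne] := eqVneq (c i) 0; first by rewrite size_poly0.
  by rewrite mulrC size_mulX.
- move=> [[/= a0 b0] [/= c0 he]] dz; have e0 : - e = 0 := congr1 (fun z => z.2.1) dz; subst a b c.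
  have {e0} e0 : e = 0 by apply/eqP; rewrite -oppr_eq0 e0.
  by exists ((0, 0), (0, 0)); split; [exact: (kgr0 Z 2 3 n)|rewrite e0; exact: esym kd0].
- move=> [[/= a0 b0] [/= c0 e0]] _; subst a b c e.
  by exists ((0, 0), (0, 0)); split; [exact: (kgr0 Z 2 i.+4 n)|exact: esym kd0].
Qed.

End LineFamily.

(** * Regularity of the coordinate ring *)

Section Regularity.
Variables (K : numFieldType) (q m : nat) (u v : 'I_m -> 'I_q.+3 -> K).
Local Notation S := {mpoly K[q.+3]}.
Hypothesis frames : forall i, is_graph_frame (u i) (v i).
Variable I : homog_ideal K q.+3.
Hypothesis idealE : forall d f, f \is d.-homog ->
  (I f <-> forall i, lf (u i) (v i) f = 0).

Local Notation M := (quotient_module I).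

Definition lines_eval (f : S) : line_family K m := [ffun i => lf (u i) (v i) f].

Lemma lines_eval_ideal f : I f -> lines_eval f = 0.
Proof.
move=> If; apply/ffunP => i; rewrite !ffunE (pihomog_partitionE (leqnn (mmeasure mdeg f))).
rewrite rmorph_sum big1 // => d _ /=.
by have /(idealE (pihomogP _ _ _)) := ideal_pihomog d If; apply.
Qed.

Definition quot_eval (w : M) : line_family K m := 
  lines_eval (sval (boolp.cid (quotmod_pi_surj w))).

Lemma quot_evalE f : quot_eval (quotmod_pi I f) = lines_eval f.
Proof.
rewrite /quot_eval; case: boolp.cid => g /= /esym/quotmod_piP /lines_eval_ideal e.
 apply/ffunP => i; move/ffunP/(_ i): e; rewrite !ffunE rmorphB /=.
by move/eqP; rewrite subr_eq0 => /eqP.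
Qed.

Fact quot_eval_is_zmod_morphism : zmod_morphism quot_eval.
Proof.
move=> w w'; have [f ->] := quotmod_pi_surj w; have [g ->] := quotmod_pi_surj w'.
have -> : quotmod_pi I f - quotmod_pi I g = quotmod_pi I (f - g).
  by apply/eqP; rewrite subr_eq -quotmod_piD subrK.
by rewrite !quot_evalE; apply/ffunP => i; rewrite !ffunE rmorphB.
Qed.

HB.instance Definition _ :=
  GRing.isZmodMorphism.Build _ _ quot_eval quot_eval_is_zmod_morphism.

Lemma quot_evalX j w : quot_eval (xact M j w) = line_act u v j (quot_eval w).
Proof.
have [f ->] := quotmod_pi_surj w.
have -> : xact M j (quotmod_pi I f) = quotmod_pi I ('X_(inord j) * f) by exact: quotmod_scaleE.
by rewrite !quot_evalE; apply/ffunP => i; rewrite !ffunE rmorphM.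
Qed.

Lemma quot_eval_comp d w : gm_comp d w -> line_comp d (quot_eval w).
Proof.
move=> [f [hf ->]]; rewrite quot_evalE; case: d hf => d /= hf.
  by move=> i; rewrite ffunE; exact: size_lf.
by rewrite hf; apply/ffunP => i; rewrite !ffunE rmorph0.
Qed.

Lemma line_comp_size d (e : line_family K m) i : line_comp d e -> (size (e i) <= `|d|%N.+1)%N.
Proof. by case: d => d /= he; [exact: he|rewrite he ffunE size_poly0]. Qed.

Lemma quot_eval_inj d (w : M) : gm_comp d w -> quot_eval w = 0 -> w = 0.
Proof.
move=> [f [hf ->]]; rewrite quot_evalE -quotmod_pi0 => e.
apply/quotmod_piP; rewrite subr0; case: d hf => d /= hf; last by rewrite hf; exact: ideal0.
by apply/(idealE hf) => i; move/ffunP/(_ i): e; rewrite !ffunE.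
Qed.

Lemma quot_eval_surj (d : nat) : config_solvable d u v (@no_points K q.+3) <->
  forall e : line_family K m, line_comp d%:Z e -> exists2 w : M, gm_comp d%:Z w & e = quot_eval w.
Proof.
rewrite config_solvableP; split=> [s e he|s G c hG].
  have [f [hf ef _]] := s e (fun w => match w with end) he.
  by exists (quotmod_pi I f); [exists f|rewrite quot_evalE; apply/ffunP => i; rewrite ffunE ef].
have [|w [f [hf ->]]] := s [ffun i => G i]; first by move=> i; rewrite ffunE; exact: hG.
rewrite quot_evalE => e; exists f; split=> // i.
by move/ffunP/(_ i): e; rewrite !ffunE.
Qed.

(** In the product of the coordinate rings, degree d + 1 is x_0 times degree d plus x_1 times degree
    d. *)
Lemma config_solvableS d : config_solvable d u v (@no_points K q.+3) ->
  config_solvable d.+1 u v (@no_points K q.+3).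
Proof.
move=> /quot_eval_surj s; apply/quot_eval_surj => e he.
have [w hw ew] := s _ (line_const_comp d e).
have [w' hw' ew'] := s _ (line_div_comp he).
exists (xact M 0 w + xact M 1 w'); last first.
  by rewrite raddfD /= !quot_evalX -ew -ew' line_act0 // -line_divK.
have -> : d.+1%:Z = d%:Z + 1 by rewrite -PoszD addn1.
by apply: gm_compD; apply: (familyX (gm_family M)).
Qed.

Variable alpha : nat.
Hypothesis solvable_alpha : config_solvable alpha u v (@no_points K q.+3).

Lemma quot_kexact i (d : int) : alpha%:Z < d -> kexact (xact M) (@gm_comp _ _ M) q.+3 i d.
Proof.
move=> ad; apply: (@kexact_sub _ _ (xact M) (line_act u v) _ (@line_comp K m) quot_eval).
- exact: quot_evalX.
- exact: gm_family.
- exact: quot_eval_comp.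
- exact: quot_eval_inj.
- case: d ad => // -[|d] // ad; have -> : d.+1%:Z - 1 = d by rewrite -addn1 PoszD addrK.
  apply/quot_eval_surj.
  have : (alpha <= d)%N by move: ad; clear; lia.
  elim: d {ad} => [|d IH]; first by rewrite leqn0 => /eqP <-.
  by rewrite leq_eqVlt => /orP[/eqP <- //|]; rewrite ltnS => /IH; exact: config_solvableS.
by apply: line_kexact => //; move: ad; clear; lia.
Qed.

Lemma quot_tame : tame (fun _ : M => True) alpha.
Proof.
split=> //.
- by move=> w _; have [s [c [hc e]]] := gm_span w; exists s, c; split=> // d; split.
- move=> d w; case: d => // d _ [f [/= -> ->]] _; exact: quotmod_pi0.
- move=> d; pose J : finType := ('I_m * 'I_(`|d|%N.+1))%type.
  exists #|J|, (fun w : M => \row_(t < #|J|) (quot_eval w (enum_val t).1)`_(enum_val t).2).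
  split=> [w w'|c w|w hw _ e].
  + by apply/rowP => t; rewrite !mxE raddfD ffunE coefD.
  + apply/rowP => t; rewrite !mxE; have [f ->] := quotmod_pi_surj w.
    have -> : c%:MP *: (quotmod_pi I f : M) = quotmod_pi I (c%:MP * f) by exact: quotmod_scaleE.
    by rewrite !quot_evalE !ffunE rmorphM /= lfC coefCM.
  apply: (quot_eval_inj hw); apply/ffunP => i; rewrite [RHS]ffunE.
  apply: (poly_eq_coefs (line_comp_size i (quot_eval_comp hw))); first by rewrite size_poly0.
  move=> k; have /rowP/(_ (enum_rank (i, k))) := e; rewrite !mxE enum_rankK /= => ->.
  by rewrite coef0.
- move=> i d ad; have -> : (fun d (w : M) => gm_comp d w /\ True) = @gm_comp _ _ M.
    by apply: funext => d'; apply: funext => w; apply: propext; split=> [[]|].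
  exact: quot_kexact.
Qed.

Hypothesis m_gt0 : (0 < m)%N.
Hypothesis alpha_min : forall k, (m * k.+1 <= 'C(q.+2 + k, k))%N -> (alpha <= k)%N.

(** For [alpha] = 0 the witness is the class of 1. Otherwise the count fails in degree [alpha] - 1,
    so some [eta] there does not come from the quotient; it shows up one below the top homological
    degree. *)
Lemma quot_not_kexact : exists i, ~ kexact (xact M) (@gm_comp _ _ M) q.+3 i alpha%:Z.
Proof.
case: alpha solvable_alpha alpha_min => [|a] sa amin.
  exists 0%N => ex; pose o := quotmod_pi I 1.
  have ho : gm_comp 0 (o : M) by exists 1; split=> //; exact: dhomog1.
  have [||w [hw ew]] := ex (kinc q.+3 (o : M)).
  - by apply/kgr_kinc; exists o.
  - by apply: (kdiff_degree0 _ (D := @gm_comp _ _ M) (q := 0)); apply/kgr_kinc; exists o.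
  have [|g hg eg] := (kdiff_degree1P (gm_family M) q.+3 (0 - 1) (o : M)).1; first by exists w.
  have o0 : o = 0.
    rewrite eg big1 // => j _; have [f [/= -> ->]] := hg j.
    by rewrite quotmod_pi0 raddf0.
  have : I (1 - 0) by apply/quotmod_piP; rewrite quotmod_pi0.
  rewrite subr0 => /lines_eval_ideal /ffunP /(_ (Ordinal m_gt0)); rewrite !ffunE rmorph1.
  by move/eqP; rewrite oner_eq0.
exists q.+2.
have [eta [he ne]] : exists eta : line_family K m, line_comp a%:Z eta /\
    forall w : M, gm_comp a%:Z w -> eta <> quot_eval w.
  apply: contrapT => h; suff /config_solvable_leq /amin : config_solvable a u v (@no_points K q.+3).
    by rewrite ltnn.
  apply/quot_eval_surj => e he; apply: contrapT => h'; apply: h; exists e; split=> // w hw ew.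
  by apply: h'; exists w.
have ea : a.+1%:Z - 1 = a by rewrite -addn1 PoszD addrK.
apply: (@not_kexact_sub _ _ (xact M) (line_act u v) _ (@line_comp K m) quot_eval _ _ _ _ q.+2 _ eta).
- exact: quot_evalX.
- exact: gm_family.
- exact: quot_eval_comp.
- exact: quot_eval_inj.
- exact: line_comp_family.
- exact: line_actC.
- by move=> e e' /=; rewrite !line_act0.
- exact/quot_eval_surj.
- by rewrite ea.
- by rewrite ea.
Qed.

Theorem quotient_regularity : is_regularity M alpha%:Z.
Proof.
split.
  move=> i j [F [w [dw cw nb]]]; rewrite leNgt; apply/negP => lt; apply: nb.
  by have /(tor_kexact F) := quot_kexact (i := i) lt; apply.
have [F] := free_resolution_exists quot_tame.
have [i nex] := quot_not_kexact.
move=> b /(_ i (alpha%:Z + i%:Z)); rewrite addrK; apply.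
apply: contrapT => h; apply: nex.
have -> : alpha%:Z = alpha%:Z + i%:Z - i%:Z by rewrite addrK.
apply/(tor_kexact F) => w dw cw; apply: contrapT => nb; apply: h.
by exists F, w.
Qed.

End Regularity.

(** * From linear forms to points of the lines *)

Section KernelFrame.
Variables (K : numFieldType) (q : nat) (a : 'M[K]_(q.+1, q.+3)).
Hypothesis tail_neq0 : \det (tail_mx a) != 0.
Local Notation i0 := (ord0 : 'I_q.+3).
Local Notation i1 := (lift ord0 ord0 : 'I_q.+3).
Local Notation tl k := (lift ord0 (lift ord0 k)).

Definition in_kernel (w : 'I_q.+3 -> K) := forall k, \sum_l a k l * w l = 0.

Definition kernel_tail (s t : K) := - (invmx (tail_mx a) *m (s *: col i0 a + t *: col i1 a)).

Lemma in_kernelP w : in_kernel w <-> \col_k w (tl k) = kernel_tail (w i0) (w i1).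
Proof.
have uT : tail_mx a \in unitmx by rewrite unitmxE unitfE.
have e k : \sum_l a k l * w l = (tail_mx a *m \col_k' w (tl k') +
    (w i0 *: col i0 a + w i1 *: col i1 a)) k 0.
  rewrite 2!big_ord_recl !mxE addrA addrC; congr (_ + _); last by rewrite mulrC [w i1 * _]mulrC.
  by apply: eq_bigr => l _; rewrite !mxE.
rewrite /kernel_tail; split=> h.
  apply/eqP; rewrite -addr_eq0 -[X in X + _](mulKmx uT) -mulmxDr; apply/eqP.
  rewrite [X in _ *m X](_ : _ = 0) ?mulmx0 //; apply/matrixP => k j; rewrite ord1 -e h.
  by rewrite mxE.
by move=> k; rewrite e h mulmxN mulKVmx // addNr mxE.
Qed.

Lemma kernel_frame : exists u v : 'I_q.+3 -> K,
  [/\ is_graph_frame u v, in_kernel u, in_kernel v &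
    forall w, in_kernel w -> forall l, w l = w i0 * u l + w i1 * v l].
Proof.
pose fv s t := frame_vec s t (fun k => kernel_tail s t k 0).
have kfv s t : in_kernel (fv s t).
  apply/in_kernelP; rewrite /fv frame_vec0 frame_vec1.
  by apply/matrixP => k j; rewrite mxE frame_vecS ord1.
exists (fv 1 0), (fv 0 1); split=> //; first by rewrite /is_graph_frame /fv !frame_vec0 !frame_vec1.
move=> w /in_kernelP hw l.
have [j -> {l}|->] := unliftP ord0 l; last by rewrite /fv !frame_vec0 mulr1 mulr0 addr0.
have [k -> {j}|->] := unliftP ord0 j; last by rewrite /fv !frame_vec1 mulr1 mulr0 add0r.
have /matrixP/(_ k 0) := hw; rewrite mxE => ->; rewrite /fv !frame_vecS.
rewrite /kernel_tail !scale1r !scale0r addr0 add0r mulmxDr -!scalemxAr !mxE opprD.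
by rewrite !mulrN.
Qed.

End KernelFrame.

Section LineIdeal.
Variables (R : realType) (q : nat).
Local Notation C := R[i].
Local Notation S := {mpoly C[q.+3]}.
Variables (X : 'rV[C]_q.+3 -> Prop) (u v : 'I_q.+3 -> C).
Hypothesis frame : is_graph_frame u v.

Lemma vanishing_ideal_eval f w : vanishing_ideal X f -> X w -> f.@[w 0] = 0.
Proof.
move=> [k [c [g [hg ->]]]] Xw; rewrite raddf_sum big1 // => i _ /=.
by rewrite mevalM (hg i).2 // mulr0.
Qed.

Lemma meval_linear_form (b : 'rV[C]_q.+3) w : (linear_form b).@[w] = \sum_l b 0 l * w l.
Proof.
by rewrite /linear_form raddf_sum; apply: eq_bigr => l _; rewrite /= mevalZ mevalXU.
Qed.

Hypothesis XE : forall w, X w <-> w != 0 /\ exists s t, forall l, w 0 l = s * u l + t * v l.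

Lemma vanishing_ideal_lf d f : f \is d.-homog -> vanishing_ideal X f <-> lf u v f = 0.
Proof.
move=> hf; have [u0 u1 v0 v1] := frame; split=> h.
  apply: poly_ext => s; rewrite horner0 lf_horner.
  pose w : 'rV[C]_q.+3 := \row_l (u l + s * v l).
  have -> : (fun l => u l + s * v l) = w 0 by apply: funext => l; rewrite mxE.
  apply: vanishing_ideal_eval h _; apply/XE; split.
    apply/eqP => /rowP/(_ ord0); rewrite !mxE u0 v0 mulr0 addr0 => /eqP.
    by rewrite oner_eq0.
  by exists 1, s => l; rewrite mxE mul1r.
exists 1%N, (fun _ => 1), (fun _ => f); split; last by rewrite big_ord1 mul1r.
move=> _; split; first by exists d.
move=> w /XE [_ [s [t e]]].
have -> : w 0 = (fun l => s * u l + t * v l) by apply: funext.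
(* For s = 0 the point is [v] up to a scalar, at infinity for the parameter of [lf]; its value is
   the top coefficient. *)
have [->|s0] := eqVneq s 0.
  have -> : (fun l => 0 * u l + t * v l) = (fun l => t * v l).
    by apply: funext => l; rewrite mul0r add0r.
  by rewrite (meval_homogZ _ _ hf) -(lf_coef_top u v hf) h coef0 mulr0.
have -> : (fun l => s * u l + t * v l) = (fun l => s * (u l + (t / s) * v l)).
  by apply: funext => l; rewrite mulrDr mulrA [s * (t / s)]mulrC divfK.
by rewrite (meval_homogZ _ _ hf) -lf_horner h horner0 mulr0.
Qed.

End LineIdeal.

Section LinePoints.
Variables (R : realType) (q : nat).
Local Notation C := R[i].
Variables (X : 'rV[C]_q.+3 -> Prop) (a : 'M[C]_(q.+1, q.+3)) (u v : 'I_q.+3 -> C).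
Hypothesis lineX : is_line X.
Hypothesis aX : forall k, vanishing_ideal X (linear_form (row k a)).
Hypothesis ker_a : forall w, in_kernel a w ->
  forall l, w l = w ord0 * u l + w (lift ord0 ord0) * v l.

(** The linear forms vanish on the line, so it lies in the span of [u] and [v]; equality follows
    because its rank is already 2. *)
Lemma line_points w : X w <-> w != 0 /\ exists s t, forall l, w 0 l = s * u l + t * v l.
Proof.
have [A [rA hX]] := lineX.
pose U : 'M[C]_(2, q.+3) := \matrix_(r, l) (if r == 0 then u l else v l).
have mulU (D : 'rV_2) l : (D *m U) 0 l = D 0 0 * u l + D 0 1 * v l.
  by rewrite mxE big_ord_recl big_ord1 !mxE; congr (_ * _ + _ * _); congr (D _ _); apply: val_inj.
have AU : (A <= U)%MS.
  apply/row_subP => r; have Xr : X (row r A).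
    apply/hX; split; last exact: row_sub.
    apply/eqP => r0; have fA : row_free A by rewrite /row_free rA.
    have /(row_free_inj fA) : (delta_mx 0 r : 'rV_2) *m A = 0 *m A by rewrite -rowE r0 mul0mx.
    by move=> /matrixP/(_ 0 r); rewrite !mxE !eqxx => /eqP; rewrite oner_eq0.
  have /ker_a e : in_kernel a (row r A 0).
    move=> k; have := vanishing_ideal_eval (aX k) Xr; rewrite meval_linear_form => h; apply: etrans h.
    by apply: eq_bigr => l _; rewrite [in RHS]mxE.
  apply/submxP; exists (\row_(t < 2) if t == 0 then row r A 0 ord0 else row r A 0 (lift ord0 ord0)).
  by apply/rowP => l; rewrite mulU [LHS]e; congr (_ * _ + _ * _); rewrite [RHS]mxE.
have UA : (U <= A)%MS.
  by rewrite -(mxrank_leqif_sup AU) eqn_leq mxrankS // rA rank_leq_row.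
split=> [/hX[w0 wA]|[w0 [s [t e]]]].
  split=> //; have /submxP[D eD] := submx_trans wA AU.
  by exists (D 0 0), (D 0 1) => l; rewrite eD mulU.
apply/hX; split=> //; apply: submx_trans UA; apply/submxP.
exists (\row_(r < 2) if r == 0 then s else t).
by apply/rowP => l; rewrite e mulU !mxE.
Qed.

End LinePoints.

Lemma regularity_bound_exists n m : (3 <= n)%N ->
  exists alpha, (m * alpha.+1 <= 'C(n + alpha, alpha))%N /\
    forall k, (m * k.+1 <= 'C(n + k, k))%N -> (alpha <= k)%N.
Proof.
move=> n3; have ex : exists k, (m * k.+1 <= 'C(n + k, k))%N.
  (* The value 2 m already works in the plane, where ['C(2 + 2 * m, 2)] = (m + 1) (2 m + 1). *)
  exists (2 * m)%N; apply: (@leq_trans 'C(2 + 2 * m, 2 * m)); last by apply: leq_bin2l; lia.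
  have -> : 'C(2 + 2 * m, 2 * m) = 'C(2 + 2 * m, 2).
    by rewrite -[in RHS]bin_sub ?leq_addr // addKn.
  by rewrite bin2 -(doubleK (m * _)%N) half_leq // -muln2 add2n; nia.
by case: (ex_minnP ex) => alpha h1 h2; exists alpha.
Qed.
Theorem theorem3p5 (R : realType) (n m : nat) (hn : (3 <= n)%N) (hm : (1 <= m)%N)
    (X : 'I_m -> 'rV[R[i]]_n.+1 -> Prop)
    (hX : forall i, is_line (X i)) (hgen : generic_collection X) :
  exists alpha : nat,
    [/\ (m * alpha.+1 <= 'C(n + alpha, alpha))%N,
        forall k : nat, (m * k.+1 <= 'C(n + k, k))%N -> (alpha <= k)%N
      & is_regularity (coordinate_ring X) alpha%:Z].
Proof.
have [alpha [h1 h2]] := regularity_bound_exists m hn.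
exists alpha; split=> //.
case: n hn X hX hgen h1 h2 => [|[|q]] // q1 X hX [a [ind gen]] h1 h2.
have [uv huv] := boolp.choice (fun i => let: ex_intro u (ex_intro v h) :=
  kernel_frame (independent_tail_det ind i) in
  ex_intro (fun uv : ('I_q.+3 -> R[i]) * ('I_q.+3 -> R[i]) =>
    [/\ is_graph_frame uv.1 uv.2, in_kernel (a i) uv.1, in_kernel (a i) uv.2 &
      forall w, in_kernel (a i) w -> forall l, w l = w ord0 * uv.1 l + w (lift ord0 ord0) * uv.2 l])
    (u, v) h).
have aX i k : vanishing_ideal (X i) (linear_form (row k (a i))).
  apply/gen; exists 1%N, (fun _ => 1), (fun _ => linear_form (row k (a i))).
  by split=> [_|]; [exists k|rewrite big_ord1 mul1r].
have fr i : is_graph_frame (uv i).1 (uv i).2 by case: (huv i).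
apply: (@quotient_regularity _ q m _ _ fr (collection_ideal X)) => //.
  move=> d f hf; split=> h i.
    by apply/(vanishing_ideal_lf (fr i) (line_points (hX i) (aX i) _) hf) => //; case: (huv i).
  by apply/(vanishing_ideal_lf (fr i) (line_points (hX i) (aX i) _) hf) => //; case: (huv i).
by apply: (generic_lines_solvable q1 h1 ind fr) => i k; case: (huv i).
Qed.
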